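(* Let $1\le p<\infty$. (i) $[V_{g_t},H^p]=[C_t,H^p]$ as Banach spaces for all $t\in[0,1]$. (ii) $H^p$ is a proper subspace of $[C_t,H^p]$ for all $t\in[0,1]$. (iii) $H^1\subseteq[C_t,H^p]\subseteq A^{-(\frac1p+1)}_0$ for all $1<p<\infty$ and $t\in[0,1)$. Moreover, both inclusions are strict.
   Context: $\mathbb{D}=\{z\in\mathbb{C}:|z|<1\}$; $H(\mathbb{D})$ is the Fréchet space of all analytic functions on $\mathbb{D}$ with the topology of uniform convergence on compact sets; $H^p$ is the classical Hardy space on $\mathbb{D}$ with its usual norm. For $\gamma>0$, $A^{-\gamma}_0:=\{f\in H(\mathbb{D}):\lim_{|z|\to1^-}(1-|z|)^\gamma|f(z)|=0\}$. For $t\in(0,1]$ let $g_t(z):=-\frac{\mathrm{Log}(1-tz)}{t}$ and let $g_0(z):=z$, for $z\in\mathbb{D}$. Thus $(V_{g_t}f)(z)=\int_0^z\frac{f(\xi)}{1-t\xi}\,d\xi$, and the generalized Cesàro operator $C_t$ is $(C_tf)(z):=\frac1z\int_0^z\frac{f(\xi)}{1-t\xi}\,d\xi$ for $z\in\mathbb{D}\setminus\{0\}$, $(C_tf)(0):=f(0)$, for $f\in H(\mathbb{D})$ ($t=1$ gives the classical Cesàro operator). For $X$ a Banach space continuously included in $H(\mathbb{D})$ and $T\colon H(\mathbb{D})\to H(\mathbb{D})$ continuous linear with $T(X)\subseteq X$, the optimal domain is $[T,X]:=\{f\in H(\mathbb{D}):Tf\in X\}$ with (semi-)norm $\|f\|_{[T,X]}:=\|Tf\|_X$.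 Equality ''as Banach spaces'' means equality as linear subspaces of $H(\mathbb{D})$ with equivalent complete norms. *)

(* Defs.v *)
(* Coquelicot over the Stdlib reals.

   A function on the open unit disc D is represented by a total function C -> C
   of which only the values on D matter: membership in the spaces below does not
   depend on the values outside D, and "f = 0" means "f vanishes on D". *)
From Stdlib Require Import Reals Lra.
From Coquelicot Require Import Coquelicot.
Open Scope R_scope.

Definition disc (z : C) : Prop := Cmod z < 1.

(* H(D); [ex_derive] over [C_AbsRing] is complex differentiability. *)
Definition analytic (f : C -> C) : Prop :=
  forall z : C, disc z -> ex_derive (K := C_AbsRing) (V := C_NormedModule) f z.

(* A set of functions on D together with a candidate norm, which is only
   meaningful on members. *)
Record fun_space := FunSpace {
  mem : (C -> C) -> Prop;
  nrm : (C -> C) -> R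
}.

Definition linear_subspace (S : (C -> C) -> Prop) : Prop :=
  (forall f, S f -> analytic f) /\
  S (fun _ => RtoC 0) /\
  (forall f g, S f -> S g -> S (fun z => Cplus (f z) (g z))) /\
  (forall (c : C) f, S f -> S (fun z => Cmult c (f z))).

Definition is_norm (X : fun_space) : Prop :=
  (forall f g, mem X f -> mem X g ->
     nrm X (fun z => Cplus (f z) (g z)) <= nrm X f + nrm X g) /\
  (forall (c : C) f, mem X f ->
     nrm X (fun z => Cmult c (f z)) = Cmod c * nrm X f) /\
  (forall f, mem X f -> nrm X f = 0 -> forall z, disc z -> f z = RtoC 0).

Definition is_complete (X : fun_space) : Prop :=
  forall u : nat -> C -> C,
    (forall n, mem X (u n)) ->
    (forall eps, 0 < eps -> exists N, forall n m, (N <= n)%nat -> (N <= m)%nat ->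
       nrm X (fun z => Cminus (u n z) (u m z)) < eps) ->
    exists f, mem X f /\
      is_lim_seq (fun n => nrm X (fun z => Cminus (u n z) (f z))) 0.

Definition is_banach (X : fun_space) : Prop :=
  linear_subspace (mem X) /\ is_norm X /\ is_complete X.

Definition equal_as_banach (X Y : fun_space) : Prop :=
  is_banach X /\ is_banach Y /\
  (forall f, mem X f <-> mem Y f) /\
  (exists a b, 0 < a /\ 0 < b /\
     forall f, mem X f -> a * nrm X f <= nrm Y f /\ nrm Y f <= b * nrm X f).

Definition strict_incl (S T : (C -> C) -> Prop) : Prop :=
  (forall f, S f -> T f) /\ (exists f, T f /\ ~ S f).

Definition proper_subspace (S T : (C -> C) -> Prop) : Prop :=
  linear_subspace S /\ linear_subspace T /\ strict_incl S T.

(* [Rpower 0 a] is 1, so 0^a = 0 (for a > 0) has to be put in by hand. *)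
Definition rpow (x a : R) : R := if Rlt_dec 0 x then Rpower x a else 0.

Definition integral_mean (p : R) (f : C -> C) (r : R) : R :=
  rpow (/ (2 * PI) *
        RInt (fun th => rpow (Cmod (f (r * cos th, r * sin th))) p) 0 (2 * PI))
       (/ p).

Definition hardy_norm (p : R) (f : C -> C) : Rbar :=
  Lub_Rbar (fun x => exists r, 0 <= r < 1 /\ x = integral_mean p f r).

Definition Hardy (p : R) : fun_space := {|
  mem := fun f => analytic f /\ is_finite (hardy_norm p f);
  nrm := fun f => real (hardy_norm p f)
|}.

(* A^{-gamma}_0 *)
Definition growth0 (gamma : R) (f : C -> C) : Prop :=
  analytic f /\
  forall eps, 0 < eps -> exists delta, 0 < delta /\
    forall z, 1 - delta < Cmod z < 1 ->
      Rpower (1 - Cmod z) gamma * Cmod (f z) < eps.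

(* The integral of h from 0 to z, along the segment. *)
Definition Cint0 (h : C -> C) (z : C) : C :=
  RInt (V := C_R_CompleteNormedModule)
       (fun s : R => Cmult z (h (Cmult (RtoC s) z))) 0 1.

(* Principal argument, in (-PI, PI]. *)
Definition Carg (z : C) : R :=
  if Rle_dec 0 (Im z) then acos (Re z / Cmod z) else - acos (Re z / Cmod z).

Definition CLog (z : C) : C := (ln (Cmod z), Carg z).

Lemma Carg_spec (z : C) : z <> RtoC 0 ->
  - PI < Carg z <= PI /\
  Re z = Cmod z * cos (Carg z) /\ Im z = Cmod z * sin (Carg z).
Proof.
intros Hz.
assert (Hm : 0 < Cmod z) by now apply Cmod_gt_0.
assert (Hsq : (Cmod z)² = (Re z)² + (Im z)²).
{ unfold Cmod, Re, Im. rewrite Rsqr_sqrt; [unfold Rsqr; ring | nra]. }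
set (u := Re z / Cmod z).
assert (Hre : Re z = Cmod z * u) by (unfold u; field; lra).
assert (Hu : -1 <= u <= 1).
{ assert (h := re_le_Cmod z). rewrite Hre, Rabs_mult, Rabs_right in h by lra.
  apply Rabs_le_between. apply Rmult_le_reg_l with (Cmod z); lra. }
assert (Hs : sin (acos u) = Rabs (Im z) / Cmod z).
{ rewrite sin_acos by exact Hu.
  replace (1 - u²) with ((Im z / Cmod z)²).
  2: { unfold u. rewrite !Rsqr_div', Hsq. field.
       rewrite <- Hsq. unfold Rsqr. nra. }
  rewrite sqrt_Rsqr_abs, Rabs_div by lra.
  now rewrite (Rabs_right (Cmod z)) by lra. }
assert (Hc := cos_acos u Hu).
assert (Hb := acos_bound u).
unfold Carg; fold u; destruct (Rle_dec 0 (Im z)) as [H | H].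
- rewrite Hc, Hs, (Rabs_right (Im z)) by lra.
  repeat split; [assert (h := PI_RGT_0); lra | lra | exact Hre | field; lra].
- assert (acos u <> PI).
  { intros E. rewrite E, sin_PI in Hs.
    rewrite (Rabs_left (Im z)) in Hs by lra.
    assert (0 < - Im z / Cmod z) by (apply Rdiv_lt_0_compat; lra). lra. }
  rewrite cos_neg, sin_neg, Hc, Hs, (Rabs_left (Im z)) by lra.
  repeat split; [lra | assert (h := PI_RGT_0); lra | exact Hre | field; lra].
Qed.

Definition g (t : R) (z : C) : C :=
  if Req_dec_T t 0 then z
  else Copp (Cdiv (CLog (Cminus (RtoC 1) (Cmult (RtoC t) z))) (RtoC t)).

(* Volterra operator with symbol h. *)
Definition V_op (h f : C -> C) (z : C) : C :=
  Cint0 (fun xi => Cmult (f xi) (C_derive h xi)) z.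

(* Generalized Cesaro operator. *)
Definition C_op (t : R) (f : C -> C) (z : C) : C :=
  if Ceq_dec z (RtoC 0) then f (RtoC 0)
  else Cdiv (Cint0 (fun xi =>
               Cdiv (f xi) (Cminus (RtoC 1) (Cmult (RtoC t) xi))) z) z.

(* [T, X] *)
Definition opt_dom (T : (C -> C) -> C -> C) (X : fun_space) : fun_space := {|
  mem := fun f => analytic f /\ mem X (T f);
  nrm := fun f => nrm X (T f)
|}.

(* Main.v *)
(* V_(g_t) f = F and C_t f = F / z, where F is the primitive of f / (1 - tz) vanishing at 0, so f lies in
   either optimal domain iff F lies in H^p; dividing by z costs a bounded factor, by Cauchy's formula.

   For t < 1 and f in H^1, F' is in H^1 and F is bounded.  For t = 1, deforming the path of integration
   writes C_1 f as an average of the operators f -> psi_u (f o phi_u), phi_u(z) = uz / (1 - (1-u) z) = z psi_u(z),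
   whose p-th power norm is at most 3 sqrt u (Siskakis' semigroup).

   Conversely, f = (1 - tz) F' with F in H^p, and (1-|z|)^(1/p+1) |F'| is at most a multiple of the norm of F;
   it tends to 0 because F is a limit in H^p of its dilations.  Strictness comes from lacunary series
   F = sum b_k z^(N^k), since the Taylor coefficients of an H^1 function are bounded. *)
Require Import Defs.
From Stdlib Require Import Reals Lra Lia Psatz Classical ClassicalEpsilon.
From Coquelicot Require Import Coquelicot.
Open Scope R_scope.

(** The estimates live on circles of radii r < R0 < 1, through Cauchy's and Poisson's formulas on
    the outer one, and never on the unit circle itself. Completeness of [C_t, H^p] is inherited from
    H^p: C_t is a bijection of H(D) with inverse h -> (1 - tz)(zh)', hence maps [C_t, H^p]
    isometrically onto H^p.

    The bound 3 sqrt u decays as u tends to 0; after the substitution u = v^m this decay absorbs the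
    singularity at v = 0 that appears when the weight is raised to the power p.

    Convergence of the dilations rests on uniform convexity of the p-th power of the modulus, which
    needs p > 1, as (iii) grants.

    A single test, boundedness of Taylor coefficients, settles every strictness claim. With b_k =
    2^-k and N = 4, F is bounded while (1 - tz) F' has coefficients 2^k; as H^p lies in H^1, this
    also makes the inclusion in (ii) proper. With b_k = 2^k and N^(1/p) >= 4, F itself has unbounded
    coefficients, while F' still grows more slowly than (1 - |z|)^-(1/p+1). *)

Notation rcont := (continuous (U := R_UniformSpace)) (only parsing).
Notation ccont := (continuous (U := C_UniformSpace)) (only parsing).

(** * Continuity of real- and complex-valued functions on a uniform space *)

Lemma rcont_plus {T : UniformSpace} (f g : T -> R) x :
  rcont f x -> rcont g x -> rcont (fun y => f y + g y) x.
Proof. exact (fun hf hg => continuous_plus (V := R_NormedModule) f g x hf hg). Qed.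

Lemma rcont_minus {T : UniformSpace} (f g : T -> R) x :
  rcont f x -> rcont g x -> rcont (fun y => f y - g y) x.
Proof. exact (fun hf hg => continuous_minus (V := R_NormedModule) f g x hf hg). Qed.

Lemma rcont_opp {T : UniformSpace} (f : T -> R) x :
  rcont f x -> rcont (fun y => - f y) x.
Proof. exact (fun hf => continuous_opp (V := R_NormedModule) f x hf). Qed.

Lemma rcont_mult {T : UniformSpace} (f g : T -> R) x :
  rcont f x -> rcont g x -> rcont (fun y => f y * g y) x.
Proof. exact (fun hf hg => continuous_mult (K := R_AbsRing) f g x hf hg). Qed.

Lemma rcont_comp {T : UniformSpace} (f : T -> R) (h : R -> R) x :
  rcont f x -> continuity_pt h (f x) -> rcont (fun y => h (f y)) x.
Proof.
intros hf hh. apply (continuous_comp f h x hf).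
now apply continuity_pt_filterlim.
Qed.

Lemma rcont_inv {T : UniformSpace} (f : T -> R) x :
  rcont f x -> f x <> 0 -> rcont (fun y => / f y) x.
Proof.
intros hf h0. apply (continuous_comp f Rinv x hf). now apply continuous_Rinv.
Qed.

Lemma rcont_div {T : UniformSpace} (f g : T -> R) x :
  rcont f x -> rcont g x -> g x <> 0 -> rcont (fun y => f y / g y) x.
Proof. intros. apply rcont_mult; trivial. now apply rcont_inv. Qed.

Lemma rcont_pow {T : UniformSpace} (f : T -> R) n x :
  rcont f x -> rcont (fun y => f y ^ n) x.
Proof.
intros hf. apply (rcont_comp f (fun u => u ^ n)); trivial.
apply derivable_continuous_pt, derivable_pt_pow.
Qed.

Lemma rcont_sqrt {T : UniformSpace} (f : T -> R) x :
  rcont f x -> rcont (fun y => sqrt (f y)) x.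
Proof. intros hf. exact (continuous_comp f sqrt x hf (continuous_sqrt _)). Qed.

Lemma rcont_abs {T : UniformSpace} (f : T -> R) x :
  rcont f x -> rcont (fun y => Rabs (f y)) x.
Proof. intros hf. exact (continuous_comp f Rabs x hf (continuous_Rabs _)). Qed.

Lemma rcont_cos {T : UniformSpace} (f : T -> R) x :
  rcont f x -> rcont (fun y => cos (f y)) x.
Proof. intros hf. exact (continuous_comp f cos x hf (continuous_cos _)). Qed.

Lemma rcont_sin {T : UniformSpace} (f : T -> R) x :
  rcont f x -> rcont (fun y => sin (f y)) x.
Proof. intros hf. exact (continuous_comp f sin x hf (continuous_sin _)). Qed.

Lemma rcont_Re {T : UniformSpace} (f : T -> C) x :
  ccont f x -> rcont (fun y => Re (f y)) x.
Proof.
intros hf. apply (continuous_comp f (fun z : C_UniformSpace => fst z) x hf).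
destruct (f x). apply continuous_fst.
Qed.

Lemma rcont_Im {T : UniformSpace} (f : T -> C) x :
  ccont f x -> rcont (fun y => Im (f y)) x.
Proof.
intros hf. apply (continuous_comp f (fun z : C_UniformSpace => snd z) x hf).
destruct (f x). apply continuous_snd.
Qed.

Lemma ccont_pair {T : UniformSpace} (f g : T -> R) x :
  rcont f x -> rcont g x -> ccont (fun y => (f y, g y)) x.
Proof.
intros hf hg.
apply (continuous_comp_2 f g (fun a b => (a, b) : C_UniformSpace) x hf hg).
intros P [d hd]. exists d. intros y hy. apply hd.
destruct y. exact hy.
Qed.

Lemma ccont_intro {T : UniformSpace} (f : T -> C) x :
  rcont (fun y => Re (f y)) x -> rcont (fun y => Im (f y)) x -> ccont f x.
Proof.
intros hr hi. apply (continuous_ext (fun y => (Re (f y), Im (f y)) : C_UniformSpace)).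
- intros y. now destruct (f y).
- now apply ccont_pair.
Qed.

Lemma ccont_RtoC {T : UniformSpace} (f : T -> R) x :
  rcont f x -> ccont (fun y => RtoC (f y)) x.
Proof. intros hf. apply ccont_pair; trivial. apply continuous_const. Qed.

Lemma ccont_plus {T : UniformSpace} (f g : T -> C) x :
  ccont f x -> ccont g x -> ccont (fun y => (f y + g y)%C) x.
Proof.
intros hf hg. apply ccont_pair.
- exact (rcont_plus _ _ x (rcont_Re f x hf) (rcont_Re g x hg)).
- exact (rcont_plus _ _ x (rcont_Im f x hf) (rcont_Im g x hg)).
Qed.

Lemma ccont_opp {T : UniformSpace} (f : T -> C) x :
  ccont f x -> ccont (fun y => (- f y)%C) x.
Proof.
intros hf. apply ccont_pair.
- exact (rcont_opp _ x (rcont_Re f x hf)).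
- exact (rcont_opp _ x (rcont_Im f x hf)).
Qed.

Lemma ccont_minus {T : UniformSpace} (f g : T -> C) x :
  ccont f x -> ccont g x -> ccont (fun y => (f y - g y)%C) x.
Proof. intros. apply ccont_plus; trivial. now apply ccont_opp. Qed.

Lemma ccont_mult {T : UniformSpace} (f g : T -> C) x :
  ccont f x -> ccont g x -> ccont (fun y => (f y * g y)%C) x.
Proof.
intros hf hg.
assert (h1 := rcont_Re f x hf). assert (h2 := rcont_Im f x hf).
assert (h3 := rcont_Re g x hg). assert (h4 := rcont_Im g x hg).
apply ccont_pair; [apply rcont_minus | apply rcont_plus]; now apply rcont_mult.
Qed.

Lemma rcont_Cmod {T : UniformSpace} (f : T -> C) x :
  ccont f x -> rcont (fun y => Cmod (f y)) x.
Proof.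
intros hf. apply rcont_sqrt, rcont_plus.
- exact (rcont_pow _ 2 x (rcont_Re f x hf)).
- exact (rcont_pow _ 2 x (rcont_Im f x hf)).
Qed.

Lemma Cmod_sqr (z : C) : Cmod z * Cmod z = Re z * Re z + Im z * Im z.
Proof.
unfold Cmod. rewrite sqrt_sqrt; unfold Re, Im; simpl; nra.
Qed.

Lemma Csqr_pos (z : C) : z <> RtoC 0 -> 0 < Re z * Re z + Im z * Im z.
Proof.
intros h. apply Cmod_gt_0 in h. assert (e := Cmod_sqr z). nra.
Qed.

Lemma ccont_inv {T : UniformSpace} (f : T -> C) x :
  ccont f x -> f x <> RtoC 0 -> ccont (fun y => (/ f y)%C) x.
Proof.
intros hf h0.
assert (h1 := rcont_Re f x hf). assert (h2 := rcont_Im f x hf).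
assert (h := Csqr_pos _ h0). unfold Re, Im in *.
assert (h3 : rcont (fun y => fst (f y) ^ 2 + snd (f y) ^ 2) x)
  by (apply rcont_plus; now apply rcont_pow).
apply ccont_pair; apply rcont_div; trivial; try (simpl; lra).
now apply rcont_opp.
Qed.

Lemma ccont_div {T : UniformSpace} (f g : T -> C) x :
  ccont f x -> ccont g x -> g x <> RtoC 0 -> ccont (fun y => (f y / g y)%C) x.
Proof. intros. apply ccont_mult; trivial. now apply ccont_inv. Qed.

Lemma ccont_conj {T : UniformSpace} (f : T -> C) x :
  ccont f x -> ccont (fun y => Cconj (f y)) x.
Proof.
intros hf. apply ccont_pair; [now apply rcont_Re | now apply rcont_opp, rcont_Im].
Qed.

Lemma ccont_pow {T : UniformSpace} (f : T -> C) n x :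
  ccont f x -> ccont (fun y => Cpow (f y) n) x.
Proof.
intros hf. induction n as [|n IH].
- apply continuous_const.
- apply (ccont_mult f (fun y => Cpow (f y) n)); trivial.
Qed.

Lemma ccont_comp {T : UniformSpace} (f : T -> C) (h : C -> C) x :
  ccont f x -> continuous (T := C_UniformSpace) (U := C_UniformSpace) h (f x) ->
  ccont (fun y => h (f y)) x.
Proof. exact (continuous_comp f h x). Qed.

(** Hypotheses are tried first, so a continuity fact placed in the context serves as a leaf for a
    subterm that the syntax-directed rules cannot enter. Nonvanishing of denominators is left as a
    goal. *)
Ltac cont1 := match goal with
  | H : ?G |- ?G => exact H
  | |- continuous (fun _ => ?c) _ => apply continuous_const
  | |- continuous (fun y => y) _ => apply continuous_id
  | |- continuous fst (_, _) => apply continuous_fst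
  | |- continuous snd (_, _) => apply continuous_snd
  | |- continuous (fun y => fst y) (_, _) => apply continuous_fst
  | |- continuous (fun y => snd y) (_, _) => apply continuous_snd
  | |- continuous (fun y => Rplus (@?f y) (@?g y)) _ => apply (rcont_plus f g)
  | |- continuous (fun y => Rminus (@?f y) (@?g y)) _ => apply (rcont_minus f g)
  | |- continuous (fun y => Rmult (@?f y) (@?g y)) _ => apply (rcont_mult f g)
  | |- continuous (fun y => Rdiv (@?f y) (@?g y)) _ => apply (rcont_div f g)
  | |- continuous (fun y => Cplus (@?f y) (@?g y)) _ => apply (ccont_plus f g)
  | |- continuous (fun y => Cminus (@?f y) (@?g y)) _ => apply (ccont_minus f g)
  | |- continuous (fun y => Cmult (@?f y) (@?g y)) _ => apply (ccont_mult f g)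
  | |- continuous (fun y => Cdiv (@?f y) (@?g y)) _ => apply (ccont_div f g)
  | |- continuous (fun y => Ropp (@?f y)) _ => apply (rcont_opp f)
  | |- continuous (fun y => Rinv (@?f y)) _ => apply (rcont_inv f)
  | |- continuous (fun y => sqrt (@?f y)) _ => apply (rcont_sqrt f)
  | |- continuous (fun y => Rabs (@?f y)) _ => apply (rcont_abs f)
  | |- continuous (fun y => cos (@?f y)) _ => apply (rcont_cos f)
  | |- continuous (fun y => sin (@?f y)) _ => apply (rcont_sin f)
  | |- continuous (fun y => RtoC (@?f y)) _ => apply (ccont_RtoC f)
  | |- continuous (fun y => Copp (@?f y)) _ => apply (ccont_opp f)
  | |- continuous (fun y => Cinv (@?f y)) _ => apply (ccont_inv f)
  | |- continuous (fun y => Cconj (@?f y)) _ => apply (ccont_conj f)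
  | |- continuous (fun y => Cmod (@?f y)) _ => apply (rcont_Cmod f)
  | |- continuous (fun y => Re (@?f y)) _ => apply (rcont_Re f)
  | |- continuous (fun y => Im (@?f y)) _ => apply (rcont_Im f)
  | |- continuous (fun y => pow (@?f y) ?n) _ => apply (rcont_pow f n)
  | |- continuous (fun y => Cpow (@?f y) ?n) _ => apply (ccont_pow f n)
  | |- continuous (fun y => (@?f y, @?g y)) _ => apply (ccont_pair f g)
  end.
Ltac cont := repeat cont1.

(** The uniform structure of C is that of a product of two lines, whose balls are squares. The
    square of half-side d contains the disc of radius d and lies in the disc of radius sqrt 2 d,
    whence the factor [sqrt 2] in both directions. *)
Lemma ccont_eps (h : C -> C) (z : C) :
  continuous (T := C_UniformSpace) (U := C_UniformSpace) h z <->
  forall eps, 0 < eps -> exists d, 0 < d /\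
    forall w, Cmod (w - z) < d -> Cmod (h w - h z) < eps.
Proof.
split.
- intros hc eps he.
  assert (he2 : 0 < eps / sqrt 2).
  { apply Rdiv_lt_0_compat; trivial. apply sqrt_lt_R0; lra. }
  destruct (proj1 (filterlim_locally h (h z)) hc (mkposreal _ he2)) as [d hd].
  exists d. split. apply cond_pos.
  intros w hw.
  assert (hb := hd w (C_NormedModule_mixin_compat1 z w d hw)).
  apply C_NormedModule_mixin_compat2 in hb. simpl in hb.
  replace eps with (sqrt 2 * (eps / sqrt 2)).
  exact hb. field. apply Rgt_not_eq, sqrt_lt_R0; lra.
- intros H. apply filterlim_locally. intros eps.
  destruct (H eps (cond_pos eps)) as [d [hd H']].
  assert (hd2 : 0 < d / sqrt 2).
  { apply Rdiv_lt_0_compat; trivial. apply sqrt_lt_R0; lra. }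
  exists (mkposreal _ hd2). intros w hw.
  apply C_NormedModule_mixin_compat1, H'.
  apply C_NormedModule_mixin_compat2 in hw. simpl in hw.
  replace d with (sqrt 2 * (d / sqrt 2)).
  exact hw. field. apply Rgt_not_eq, sqrt_lt_R0; lra.
Qed.

Lemma rcont_locally {T : UniformSpace} (f : T -> R) x eps :
  rcont f x -> 0 < eps -> locally x (fun y => Rabs (f y - f x) < eps).
Proof.
intros hf he. exact (proj1 (filterlim_locally f (f x)) hf (mkposreal _ he)).
Qed.

(** * Integrals of continuous functions on a segment *)

Definition icont (f : R -> R) (a b : R) := forall x, a <= x <= b -> rcont f x.
Definition icontC (f : R -> C) (a b : R) := forall x, a <= x <= b -> ccont f x.

Lemma icont_ex (f : R -> R) a b : a <= b -> icont f a b -> ex_RInt f a b.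
Proof.
intros hab hf. apply (ex_RInt_continuous f). intros x.
rewrite Rmin_left, Rmax_right by lra. apply hf.
Qed.

Lemma int_le f g a b : a <= b -> icont f a b -> icont g a b ->
  (forall x, a <= x <= b -> f x <= g x) -> RInt f a b <= RInt g a b.
Proof.
intros hab hf hg h. apply RInt_le; trivial; try now apply icont_ex.
intros; apply h; lra.
Qed.

Lemma int_ext (f g : R -> R) a b : a <= b -> (forall x, a <= x <= b -> f x = g x) ->
  RInt f a b = RInt g a b.
Proof.
intros hab h. apply (RInt_ext f g). intros x.
rewrite Rmin_left, Rmax_right by lra. intros; apply h; lra.
Qed.

Lemma int_plus f g a b : a <= b -> icont f a b -> icont g a b ->
  RInt (fun x => f x + g x) a b = RInt f a b + RInt g a b.
Proof.
intros hab hf hg. apply (RInt_plus f g); now apply icont_ex.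
Qed.

Lemma int_minus f g a b : a <= b -> icont f a b -> icont g a b ->
  RInt (fun x => f x - g x) a b = RInt f a b - RInt g a b.
Proof.
intros hab hf hg. apply (RInt_minus f g); now apply icont_ex.
Qed.

Lemma int_scal k f a b : a <= b -> icont f a b ->
  RInt (fun x => k * f x) a b = k * RInt f a b.
Proof.
intros hab hf. apply (RInt_scal f); now apply icont_ex.
Qed.

Lemma int_const (k a b : R) : RInt (fun _ => k) a b = (b - a) * k.
Proof. apply (RInt_const (V := R_CompleteNormedModule) a b k). Qed.

Lemma int_ge0 f a b : a <= b -> icont f a b ->
  (forall x, a <= x <= b -> 0 <= f x) -> 0 <= RInt f a b.
Proof.
intros hab hf h. rewrite <- (Rmult_0_r (b - a)), <- int_const.
apply int_le; trivial. intros x _; apply continuous_const.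
Qed.

Lemma int_FTC (F f : R -> R) a b : a <= b ->
  (forall x, a <= x <= b -> is_derive F x (f x)) -> icont f a b ->
  RInt f a b = F b - F a.
Proof.
intros hab hF hf.
apply is_RInt_unique.
apply (is_RInt_derive F f a b); rewrite Rmin_left, Rmax_right by lra; trivial.
Qed.

(** Compactness of [a, b]: each s has a product ball on which [F] varies by less than eps / 2, and
    finitely many of these balls suffice, so one radius in y serves for all s. *)
Lemma tube {T : UniformSpace} (F : T -> R -> R) (y : T) a b :
  (forall s, a <= s <= b -> rcont (fun q : T * R => F (fst q) (snd q)) (y, s)) ->
  forall eps, 0 < eps -> locally y (fun y' => forall s, a <= s <= b ->
    Rabs (F y' s - F y s) < eps).
Proof.
intros hF eps he.
assert (H : forall s, exists d : posreal, a <= s <= b ->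
  forall y' s', ball y d y' -> ball s d s' -> Rabs (F y' s' - F y s) < eps / 2).
{ intros s. destruct (classic (a <= s <= b)) as [hs|hs].
  - destruct (rcont_locally _ _ (eps / 2) (hF s hs)) as [d hd]; [lra|].
    exists d. intros _ y' s' h1 h2. apply (hd (y', s')). now split.
  - exists (mkposreal 1 Rlt_0_1). intros; contradiction. }
assert (D : exists delta : R -> posreal, forall s, a <= s <= b ->
  forall y' s', ball y (delta s) y' -> ball s (delta s) s' -> Rabs (F y' s' - F y s) < eps / 2).
{ exists (fun s => proj1_sig (constructive_indefinite_description _ (H s))).
  intros s. exact (proj2_sig (constructive_indefinite_description _ (H s))). }
destruct D as [delta hd].
destruct (compactness_value_1d a b delta) as [d hdd].
exists d. intros y' hy' s hs.
(* [compactness_value_1d] gives the centre u only under a double negation. *)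
specialize (hdd s hs). apply NNPP in hdd. destruct hdd as [u [hu [h1 h2]]].
assert (k1 : Rabs (F y' s - F y u) < eps / 2).
{ apply (hd u hu); [now apply ball_le with d | exact h1]. }
assert (k2 : Rabs (F y s - F y u) < eps / 2).
{ apply (hd u hu); [apply ball_center | exact h1]. }
replace (F y' s - F y s) with ((F y' s - F y u) - (F y s - F y u)) by ring.
apply Rle_lt_trans with (1 := Rabs_triang _ _). rewrite Rabs_Ropp. lra.
Qed.

Lemma cont_slice {T : UniformSpace} (F : T -> R -> R) (y : T) s :
  rcont (fun q : T * R => F (fst q) (snd q)) (y, s) -> rcont (F y) s.
Proof.
intros hF. apply (continuous_comp_2 (fun _ : R => y) (fun s : R => s) F s).
apply continuous_const. apply continuous_id. exact hF.
Qed.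

Lemma RInt_param_cont {T : UniformSpace} (F : T -> R -> R) (y : T) a b : a <= b ->
  locally y (fun y' => icont (F y') a b) ->
  (forall s, a <= s <= b -> rcont (fun q : T * R => F (fst q) (snd q)) (y, s)) ->
  rcont (fun y => RInt (F y) a b) y.
Proof.
intros hab hl hF. apply filterlim_locally. intros eps.
(* The [+ 1] covers a = b. *)
assert (he : 0 < eps / (b - a + 1)) by (apply Rdiv_lt_0_compat; [apply cond_pos | lra]).
generalize (filter_and _ _ hl (tube F y a b hF _ he)).
apply filter_imp. intros y' [h1 h2].
assert (hy := locally_singleton _ _ hl). simpl in hy.
change (Rabs (RInt (F y') a b - RInt (F y) a b) < eps).
rewrite <- int_minus by trivial.
assert (hm : icont (fun x => F y' x - F y x) a b) by (intros x hx; apply rcont_minus; auto).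
apply Rle_lt_trans with (RInt (fun _ => eps / (b - a + 1)) a b).
- apply Rle_trans with (RInt (fun x => Rabs (F y' x - F y x)) a b).
  + apply abs_RInt_le; trivial. now apply icont_ex.
  + apply int_le; trivial.
    * intros x hx. apply rcont_abs. now apply hm.
    * intros x _; apply continuous_const.
    * intros x hx. apply Rlt_le, h2; trivial.
- rewrite int_const. apply Rmult_lt_reg_r with (b - a + 1); [lra|].
  field_simplify; [| lra]. assert (hp := cond_pos eps). nra.
Qed.

(** As functions of the upper limit of the outer integral, both sides have the same derivative and
    vanish at a. Continuity on the whole plane keeps the derivatives at the end points two-sided. *)
Lemma Fubini_everywhere (F : R -> R -> R) a b c d : a <= b -> c <= d ->
  (forall q : R * R, rcont (fun q : R * R => F (fst q) (snd q)) q) ->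
  RInt (fun x => RInt (fun y => F x y) c d) a b =
  RInt (fun y => RInt (fun x => F x y) a b) c d.
Proof.
intros hab hcd hF.
assert (hF1 : forall x, forall y, rcont (F x) y) by (intros; apply cont_slice, hF).
assert (hsw : forall x y, rcont (fun q : R * R => F (snd q) (fst q)) (y, x)).
{ intros x y. apply (continuous_comp_2 (fun q : R * R => snd q) (fun q : R * R => fst q) F (y, x));
  [apply continuous_snd | apply continuous_fst | apply hF]. }
assert (hF2 : forall x y, rcont (fun x => F x y) x).
{ intros x y. exact (cont_slice (fun y x => F x y) y x (hsw x y)). }
set (G x := RInt (fun y => RInt (fun u => F u y) a x) c d).
assert (hin : forall x y, a <= x -> rcont (fun y => RInt (fun u => F u y) a x) y).
{ intros x y hx. apply (RInt_param_cont (fun y u => F u y)); trivial.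
  apply filter_forall; intros y' u _; apply hF2. }
(* Also for x < a: the derivative of [G] at a looks at both sides. *)
assert (hin' : forall x y, rcont (fun y => RInt (fun u => F u y) a x) y).
{ intros x y. destruct (Rle_dec a x) as [h|h]. now apply hin.
  apply (continuous_ext (fun y => - RInt (fun u => F u y) x a)).
  - intros y'. apply (opp_RInt_swap (fun u => F u y')).
    apply (ex_RInt_continuous (V := R_CompleteNormedModule)). intros; apply hF2.
  - apply rcont_opp. apply (RInt_param_cont (fun y u => F u y)); try lra.
    apply filter_forall; intros y' u _; apply hF2.
    intros; apply hsw. }
assert (hd : forall x y, is_derive (fun x => RInt (fun u => F u y) a x) x (F x y)).
{ intros x y. apply (is_derive_RInt (fun u => F u y) _ a).
  - apply filter_forall. intros z. apply (RInt_correct (V := R_CompleteNormedModule)), (ex_RInt_continuous (V := R_CompleteNormedModule)).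
    intros; apply hF2.
  - apply hF2. }
assert (hG : forall x, is_derive G x (RInt (fun y => F x y) c d)).
{ intros x. unfold G.
  assert (E : RInt (fun y => F x y) c d = RInt (fun t => Derive (fun u => RInt (fun u0 => F u0 t) a u) x) c d).
  { apply RInt_ext. intros y _. symmetry. apply is_derive_unique, hd. }
  rewrite E.
  apply (is_derive_RInt_param (fun x y => RInt (fun u => F u y) a x)).
  - apply filter_forall. intros z y _. eexists; apply hd.
  - intros y _. apply continuity_2d_pt_ext with F.
    + intros u v. symmetry. apply is_derive_unique, hd.
    + apply continuity_2d_pt_filterlim. apply (hF (x, y)).
  - apply filter_forall. intros z. apply (ex_RInt_continuous (V := R_CompleteNormedModule)).
    intros; apply hin'. }
assert (hc : icont (fun x => RInt (fun y => F x y) c d) a b).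
{ intros x _. apply (RInt_param_cont F); trivial.
  apply filter_forall; intros x' y _; apply hF1.
}
rewrite (int_FTC G _ a b hab) by auto.
assert (E : G a = 0).
{ unfold G. rewrite <- (Rmult_0_r (d - c)), <- int_const. apply RInt_ext.
  intros y _. apply (RInt_point (V := R_CompleteNormedModule)). }
rewrite E. apply Rminus_0_r.
Qed.

(* Clamping the arguments extends a function continuously off the rectangle. *)
Definition clamp (a b x : R) := Rmax a (Rmin b x).

Lemma clamp_id a b x : a <= x <= b -> clamp a b x = x.
Proof. intros h. unfold clamp. rewrite Rmin_right, Rmax_right; lra. Qed.

Lemma clamp_in a b x : a <= b -> a <= clamp a b x <= b.
Proof. intros h. unfold clamp, Rmax, Rmin. repeat destruct Rle_dec; lra. Qed.

Lemma clamp_cont {T : UniformSpace} a b (f : T -> R) x : a <= b ->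
  rcont f x -> rcont (fun y => clamp a b (f y)) x.
Proof.
intros hab hf. apply (continuous_ext (fun y => (a + (b + f y - Rabs (b - f y)) / 2
  + Rabs (a - (b + f y - Rabs (b - f y)) / 2)) / 2)).
- intros y. unfold clamp, Rmax, Rmin, Rabs. repeat destruct Rle_dec; repeat destruct Rcase_abs; lra.
- cont; lra.
Qed.

Lemma Fubini (F : R -> R -> R) a b c d : a <= b -> c <= d ->
  (forall x y, a <= x <= b -> c <= y <= d -> rcont (fun q : R * R => F (fst q) (snd q)) (x, y)) ->
  RInt (fun x => RInt (fun y => F x y) c d) a b =
  RInt (fun y => RInt (fun x => F x y) a b) c d.
Proof.
intros hab hcd hF.
transitivity (RInt (fun x => RInt (fun y => F (clamp a b x) (clamp c d y)) c d) a b).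
{ apply int_ext; trivial. intros x hx. apply int_ext; trivial. intros y hy.
  now rewrite !clamp_id. }
transitivity (RInt (fun y => RInt (fun x => F (clamp a b x) (clamp c d y)) a b) c d).
2:{ apply int_ext; trivial. intros x hx. apply int_ext; trivial. intros y hy.
  now rewrite !clamp_id. }
apply (Fubini_everywhere (fun x y => F (clamp a b x) (clamp c d y))); trivial.
intros [x y].
apply (continuous_comp_2 (fun q : R * R => clamp a b (fst q)) (fun q : R * R => clamp c d (snd q)) F);
  try (apply clamp_cont; trivial; cont).
apply hF; now apply clamp_in.
Qed.

(** * Complex derivatives *)

Definition cder (f : C -> C) (z l : C) : Prop :=
  is_derive (K := C_AbsRing) (V := C_NormedModule) f z l.
Notation cts := (continuous (T := C_UniformSpace) (U := C_UniformSpace)) (only parsing).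

Lemma C_locally (z : C) (P : C -> Prop) :
  locally (T := AbsRing_UniformSpace C_AbsRing) z P <->
  exists d, 0 < d /\ forall w, Cmod (w - z) < d -> P w.
Proof.
split.
- intros [d hd]. exists d. split. apply cond_pos. exact hd.
- intros [d [h hd]]. exists (mkposreal d h). exact hd.
Qed.

Lemma cder_eps (f : C -> C) z l : cder f z l <->
  forall eps, 0 < eps -> exists d, 0 < d /\ forall w, Cmod (w - z) < d ->
    Cmod (f w - f z - (w - z) * l) <= eps * Cmod (w - z).
Proof.
split.
- intros [_ h] eps he.
  apply C_locally. exact (h z (fun P hP => hP) (mkposreal eps he)).
- intros h. split.
  + exact (is_linear_scal_l (K := C_AbsRing) (V := C_NormedModule) l).
  + intros x hx eps.
    apply (is_filter_lim_locally_unique (K := C_AbsRing) (V := AbsRing_NormedModule C_AbsRing)) in hx.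
    rewrite <- hx. apply C_locally. exact (h eps (cond_pos eps)).
Qed.

(** Caratheodory's form of differentiability: the difference quotient extends continuously to z. It
    turns the sum, product and chain rules into algebra plus continuity. *)
Lemma cder_car (f : C -> C) z l : cder f z l <->
  exists phi : C -> C, cts phi z /\ phi z = l /\
    forall w, f w = (f z + (w - z) * phi w)%C.
Proof.
rewrite cder_eps. split.
- intros h.
  exists (fun w => if Ceq_dec w z then l else ((f w - f z) / (w - z))%C).
  split; [|split].
  + apply ccont_eps. intros eps he.
    destruct (h (eps / 2)) as [d [hd H]]; [lra|]. exists d. split; trivial.
    intros w hw. destruct (Ceq_dec z z) as [_|n]; [|easy].
    destruct (Ceq_dec w z) as [e|n].
    * replace (l - l)%C with (RtoC 0) by ring. now rewrite Cmod_0.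
    * assert (hn : (w - z)%C <> RtoC 0) by now apply Cminus_eq_contra.
      replace ((f w - f z) / (w - z) - l)%C
        with ((f w - f z - (w - z) * l) / (w - z))%C by now field.
      rewrite Cmod_div by trivial.
      assert (hp := proj1 (Cmod_gt_0 _) hn).
      apply Rle_lt_trans with (eps / 2); [|lra].
      apply Rmult_le_reg_r with (1 := hp). unfold Rdiv at 1. rewrite Rmult_assoc, Rinv_l, Rmult_1_r by lra.
      now apply H.
  + now destruct (Ceq_dec z z).
  + intros w. destruct (Ceq_dec w z) as [e|n].
    * rewrite e. ring.
    * field. now apply Cminus_eq_contra.
- intros [phi [hc [hl H]]] eps he.
  destruct (proj1 (ccont_eps _ _) hc eps he) as [d [hd Hd]].
  exists d. split; trivial. intros w hw.
  replace (f w - f z - (w - z) * l)%C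
    with ((w - z) * (phi w - phi z))%C by (rewrite H, hl; ring).
  rewrite Cmod_mult, Rmult_comm. apply Rmult_le_compat_r. apply Cmod_ge_0.
  now apply Rlt_le, Hd.
Qed.

Lemma cder_cts (f : C -> C) z l : cder f z l -> cts f z.
Proof.
intros h. apply cder_car in h. destruct h as [phi [hc [_ H]]].
apply (continuous_ext (U := C_UniformSpace) (fun w => (f z + (w - z) * phi w)%C)).
intros w; symmetry; apply H.
cont.
Qed.

Lemma cder_ext_loc (f g : C -> C) z l d : 0 < d ->
  (forall w, Cmod (w - z) < d -> f w = g w) -> cder f z l -> cder g z l.
Proof.
intros hd h. apply (is_derive_ext_loc (K := C_AbsRing) (V := C_NormedModule) f g).
apply C_locally. now exists d.
Qed.

Lemma cder_ext (f g : C -> C) z l : (forall w, f w = g w) -> cder f z l -> cder g z l.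
Proof. intros h. apply (cder_ext_loc f g z l 1). lra. auto. Qed.

Lemma cder_eq (f : C -> C) z l l' : cder f z l -> l = l' -> cder f z l'.
Proof. now intros h <-. Qed.

Lemma cder_const c z : cder (fun _ => c) z (RtoC 0).
Proof. apply cder_car. exists (fun _ => RtoC 0). repeat split. cont. intros; ring. Qed.

Lemma cder_id z : cder (fun w => w) z (RtoC 1).
Proof. apply cder_car. exists (fun _ => RtoC 1). repeat split. cont. intros; ring. Qed.

Lemma cder_plus f g z l m : cder f z l -> cder g z m ->
  cder (fun w => (f w + g w)%C) z (l + m)%C.
Proof.
intros hf hg. apply cder_car in hf, hg.
destruct hf as [p [hp [e H]]], hg as [q [hq [e' H']]].
apply cder_car. exists (fun w => (p w + q w)%C). split; [cont|split].
now rewrite e, e'. intros w. rewrite H, H'. ring.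
Qed.

Lemma cder_mult f g z l m : cder f z l -> cder g z m ->
  cder (fun w => (f w * g w)%C) z (l * g z + f z * m)%C.
Proof.
intros hf hg. assert (hgc := cder_cts _ _ _ hg). apply cder_car in hf, hg.
destruct hf as [p [hp [e H]]], hg as [q [hq [e' H']]].
apply cder_car. exists (fun w => (p w * g w + f z * q w)%C). split; [cont|split].
now rewrite e, e'. intros w. rewrite H, H'. ring.
Qed.

Lemma cder_scal c f z l : cder f z l -> cder (fun w => (c * f w)%C) z (c * l)%C.
Proof.
intros hf. eapply cder_eq. apply (cder_mult (fun _ => c)). apply cder_const. apply hf. ring.
Qed.

Lemma cder_opp f z l : cder f z l -> cder (fun w => (- f w)%C) z (- l)%C.
Proof.
intros hf. apply (cder_ext (fun w => ((- RtoC 1) * f w)%C)). intros; ring.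
apply (cder_eq _ _ _ _ (cder_scal _ _ _ _ hf)). ring.
Qed.

Lemma cder_minus f g z l m : cder f z l -> cder g z m ->
  cder (fun w => (f w - g w)%C) z (l - m)%C.
Proof. intros hf hg. apply cder_plus; trivial. now apply cder_opp. Qed.

Lemma cder_comp f g z l m : cder f (g z) l -> cder g z m ->
  cder (fun w => f (g w)) z (m * l)%C.
Proof.
intros hf hg. assert (hgc := cder_cts _ _ _ hg). apply cder_car in hf, hg.
destruct hf as [p [hp [e H]]], hg as [q [hq [e' H']]].
apply cder_car. exists (fun w => (q w * p (g w))%C). split; [|split].
apply ccont_mult; trivial. now apply ccont_comp.
now rewrite e, e'. intros w. rewrite H. rewrite (H' w) at 1. ring.
Qed.

Lemma cder_inv z : z <> RtoC 0 -> cder Cinv z (- (/ (z * z)))%C.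
Proof.
(* On the disc of radius |z| about z one has w <> 0, and there 1/w is already in Caratheodory form
   with quotient -1/(zw). *)
intros hz. apply (cder_ext_loc (fun w => (/ z + (w - z) * (- (/ (z * w))))%C) _ _ _ (Cmod z)).
- now apply Cmod_gt_0.
- intros w hw. assert (w <> RtoC 0).
  { intros ->. replace (0 - z)%C with (- z)%C in hw by ring. rewrite Cmod_opp in hw. lra. }
  field. now split.
- apply cder_car. exists (fun w => (- (/ (z * w)))%C). split; [|split; trivial].
  cont. now apply Cmult_neq_0.
  intros w. ring.
Qed.

Lemma cder_div f g z l m : cder f z l -> cder g z m -> g z <> RtoC 0 ->
  cder (fun w => (f w / g w)%C) z
    ((l * g z - f z * m) / (g z * g z))%C.
Proof.
intros hf hg h. eapply cder_eq. apply (cder_mult f). exact hf.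
apply (cder_comp Cinv g z). now apply cder_inv. apply hg. simpl. now field.
Qed.

Lemma cder_pow z n : cder (fun w => Cpow w n) z (RtoC (INR n) * Cpow z (pred n))%C.
Proof.
induction n as [|n IH].
- apply (cder_eq _ _ _ _ (cder_const (RtoC 1) z)). simpl. ring.
- apply (cder_ext (fun w => (w * Cpow w n)%C)). intros; apply eq_sym, Cpow_S.
  apply (cder_eq _ _ _ _ (cder_mult _ _ _ _ _ (cder_id z) IH)).
  rewrite S_INR, RtoC_plus. destruct n; simpl; ring.
Qed.

Lemma cder_unique f z l m : cder f z l -> cder f z m -> l = m.
Proof. intros h1 h2. rewrite <- (is_C_derive_unique f z l), <- (is_C_derive_unique f z m); auto. Qed.

(** * Paths *)

Definition pder (g : R -> C) s l :=
  is_derive (fun u => Re (g u)) s (Re l) /\ is_derive (fun u => Im (g u)) s (Im l).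

(** The second factor need only be continuous, because the first one vanishes at s. This is the
    situation along a path, where the Caratheodory quotient of the outer function is merely
    continuous. *)
Lemma is_derive_vanishing (u v : R -> R) s u' : is_derive u s u' -> rcont v s ->
  is_derive (fun x => (u x - u s) * v x) s (u' * v s).
Proof.
intros hu hv. apply is_derive_Reals. apply is_derive_Reals in hu.
intros eps he.
assert (hA : 0 < Rabs u' + 1) by (assert (h := Rabs_pos u'); lra).
assert (hB : 0 < Rabs (v s) + 1) by (assert (h := Rabs_pos (v s)); lra).
set (e1 := eps / 2 / (Rabs (v s) + 1)).
set (e2 := Rmin 1 (eps / 2 / (Rabs u' + 1))).
assert (h1 : 0 < e1) by (apply Rdiv_lt_0_compat; lra).
assert (h2 : 0 < e2) by (apply Rmin_case; [lra | apply Rdiv_lt_0_compat; lra]).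
destruct (hu e1 h1) as [d1 H1].
destruct (rcont_locally _ _ e2 hv h2) as [d2 H2].
assert (hd : 0 < Rmin d1 d2) by (apply Rmin_case; apply cond_pos).
exists (mkposreal _ hd). intros h hn hlt. simpl in hlt.
specialize (H1 h hn (Rlt_le_trans _ _ _ hlt (Rmin_l _ _))).
assert (H2' : Rabs (v (s + h) - v s) < e2).
{ apply H2. change (Rabs (s + h - s) < d2). replace (s + h - s) with h by ring.
  exact (Rlt_le_trans _ _ _ hlt (Rmin_r _ _)). }
replace (((u (s + h) - u s) * v (s + h) - (u s - u s) * v s) / h - u' * v s)
  with (((u (s + h) - u s) / h - u') * v (s + h) + u' * (v (s + h) - v s)) by (field; trivial).
apply Rle_lt_trans with (1 := Rabs_triang _ _). rewrite !Rabs_mult.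
assert (k : Rabs (v (s + h)) <= Rabs (v s) + 1).
{ replace (v (s + h)) with (v s + (v (s + h) - v s)) by ring.
  apply Rle_trans with (1 := Rabs_triang _ _).
  assert (k := Rmin_l 1 (eps / 2 / (Rabs u' + 1))). fold e2 in k. lra. }
assert (k1 : Rabs ((u (s + h) - u s) / h - u') * Rabs (v (s + h)) <= e1 * (Rabs (v s) + 1)).
{ apply Rmult_le_compat; try apply Rabs_pos; lra. }
assert (k2 : Rabs u' * Rabs (v (s + h) - v s) < (Rabs u' + 1) * (eps / 2 / (Rabs u' + 1))).
{ apply Rle_lt_trans with (Rabs u' * (eps / 2 / (Rabs u' + 1))).
  apply Rmult_le_compat_l. apply Rabs_pos.
  assert (k' := Rmin_r 1 (eps / 2 / (Rabs u' + 1))). fold e2 in k'. lra.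
  apply Rmult_lt_compat_r. apply Rdiv_lt_0_compat; lra. lra. }
replace (e1 * (Rabs (v s) + 1)) with (eps / 2) in k1 by (unfold e1; field; lra).
replace ((Rabs u' + 1) * (eps / 2 / (Rabs u' + 1))) with (eps / 2) in k2 by (field; lra).
lra.
Qed.

Lemma pder_cont g s l : pder g s l -> ccont g s.
Proof.
intros [h1 h2]. apply ccont_intro.
apply (ex_derive_continuous (K := R_AbsRing) (V := R_NormedModule)). now exists (Re l).
apply (ex_derive_continuous (K := R_AbsRing) (V := R_NormedModule)). now exists (Im l).
Qed.

(** By Caratheodory, f(g u) - f(g s) is (g u - g s) times a continuous factor; its real and
    imaginary parts are combinations of the products treated in [is_derive_vanishing]. *)
Lemma pder_comp f g s l m : cder f (g s) l -> pder g s m ->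
  pder (fun u => f (g u)) s (m * l)%C.
Proof.
intros hf hg. assert (hgc := pder_cont _ _ _ hg). destruct hg as [hr hi].
apply cder_car in hf. destruct hf as [p [hp [e H]]].
assert (hpg : ccont (fun u => p (g u)) s) by now apply ccont_comp.
assert (h1 := rcont_Re _ _ hpg). assert (h2 := rcont_Im _ _ hpg).
split.
- apply (is_derive_ext (fun u => Re (f (g s)) + ((Re (g u) - Re (g s)) * Re (p (g u))
   - (Im (g u) - Im (g s)) * Im (p (g u))))).
  { intros u. rewrite (H (g u)). unfold Re, Im; simpl. ring. }
  rewrite <- (Rplus_0_l (Re (m * l))). apply (is_derive_plus (V := R_NormedModule)).
  apply (is_derive_const (K := R_AbsRing) (V := R_NormedModule)). rewrite <- e.
  apply (is_derive_minus (V := R_NormedModule)).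
  exact (is_derive_vanishing _ _ _ _ hr h1). exact (is_derive_vanishing _ _ _ _ hi h2).
- apply (is_derive_ext (fun u => Im (f (g s)) + ((Re (g u) - Re (g s)) * Im (p (g u))
   + (Im (g u) - Im (g s)) * Re (p (g u))))).
  { intros u. rewrite (H (g u)). unfold Re, Im; simpl. ring. }
  rewrite <- (Rplus_0_l (Im (m * l))). apply (is_derive_plus (V := R_NormedModule)).
  apply (is_derive_const (K := R_AbsRing) (V := R_NormedModule)). rewrite <- e.
  apply (is_derive_plus (V := R_NormedModule)).
  exact (is_derive_vanishing _ _ _ _ hr h2). exact (is_derive_vanishing _ _ _ _ hi h1).
Qed.

Lemma pder_affine (a b : C) s : pder (fun u => (a + RtoC u * b)%C) s b.
Proof.
split.
- apply (is_derive_ext (fun u => Re a + u * Re b)). intros; unfold Re; simpl; ring.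
  auto_derive; trivial; ring.
- apply (is_derive_ext (fun u => Im a + u * Im b)). intros; unfold Im; simpl; ring.
  auto_derive; trivial; ring.
Qed.

(** * Complex-valued integrals *)

(** Taken componentwise so that its properties come from the real integral; [CI_correct] identifies
    it with the vector-valued integral that occurs in [Cint0]. *)
Definition CI (h : R -> C) (a b : R) : C :=
  (RInt (fun s => Re (h s)) a b, RInt (fun s => Im (h s)) a b).

Lemma icontC_Re h a b : icontC h a b -> icont (fun s => Re (h s)) a b.
Proof. intros H x hx. now apply rcont_Re, H. Qed.
Lemma icontC_Im h a b : icontC h a b -> icont (fun s => Im (h s)) a b.
Proof. intros H x hx. now apply rcont_Im, H. Qed.

Lemma CI_correct (h : R -> C) a b : a <= b -> icontC h a b ->
  RInt (V := C_R_CompleteNormedModule) h a b = CI h a b.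
Proof.
intros hab hh. apply is_RInt_unique.
apply (is_RInt_ext (V := C_R_NormedModule) (fun s => (Re (h s), Im (h s)))).
intros x _; now destruct (h x).
apply (is_RInt_fct_extend_pair (U := R_NormedModule) (V := R_NormedModule));
  apply (RInt_correct (V := R_CompleteNormedModule)), icont_ex; trivial.
now apply icontC_Re. now apply icontC_Im.
Qed.

Lemma CI_ext (f g : R -> C) a b : a <= b -> (forall x, a <= x <= b -> f x = g x) ->
  CI f a b = CI g a b.
Proof.
intros hab h. unfold CI. f_equal; apply int_ext; trivial; intros; now rewrite h.
Qed.

Lemma CI_plus f g a b : a <= b -> icontC f a b -> icontC g a b ->
  CI (fun x => (f x + g x)%C) a b = (CI f a b + CI g a b)%C.
Proof.
intros hab hf hg. unfold CI, Cplus; simpl. f_equal.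
- exact (int_plus _ _ a b hab (icontC_Re f a b hf) (icontC_Re g a b hg)).
- exact (int_plus _ _ a b hab (icontC_Im f a b hf) (icontC_Im g a b hg)).
Qed.

Lemma CI_scal c f a b : a <= b -> icontC f a b ->
  CI (fun x => (c * f x)%C) a b = (c * CI f a b)%C.
Proof.
intros hab hf. assert (h1 := icontC_Re _ _ _ hf). assert (h2 := icontC_Im _ _ _ hf).
unfold CI, Cmult; simpl.
assert (sc : forall k u, icont u a b -> icont (fun x => k * u x) a b).
{ intros k u hu x hx. apply rcont_mult; auto. apply continuous_const. }
f_equal.
- rewrite <- !int_scal by trivial. rewrite <- int_minus by auto. reflexivity.
- rewrite <- !int_scal by trivial. rewrite <- int_plus by auto. reflexivity.
Qed.

Lemma CI_minus f g a b : a <= b -> icontC f a b -> icontC g a b ->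
  CI (fun x => (f x - g x)%C) a b = (CI f a b - CI g a b)%C.
Proof.
intros hab hf hg. unfold CI, Cminus, Cplus, Copp; simpl. f_equal.
- exact (int_minus _ _ a b hab (icontC_Re f a b hf) (icontC_Re g a b hg)).
- exact (int_minus _ _ a b hab (icontC_Im f a b hf) (icontC_Im g a b hg)).
Qed.

Lemma CI_const (c : C) a b : CI (fun _ => c) a b = (RtoC (b - a) * c)%C.
Proof.
unfold CI. rewrite !int_const. unfold RtoC, Cmult, Re, Im; simpl. f_equal; ring.
Qed.

Lemma CI_FTC (F f : R -> C) a b : a <= b ->
  (forall x, a <= x <= b -> pder F x (f x)) -> icontC f a b ->
  CI f a b = (F b - F a)%C.
Proof.
intros hab hF hf. unfold CI.
rewrite (int_FTC (fun x => Re (F x)) _ a b hab) by (try (intros; now apply hF); now apply icontC_Re).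
rewrite (int_FTC (fun x => Im (F x)) _ a b hab) by (try (intros; now apply hF); now apply icontC_Im).
reflexivity.
Qed.

(** Rotating the value I onto the positive axis: |I|^2 is the integral of Re(conj I h), and the
    integrand is at most |I| |h|. Divide by |I|. *)
Lemma CI_mod h a b : a <= b -> icontC h a b ->
  Cmod (CI h a b) <= RInt (fun s => Cmod (h s)) a b.
Proof.
intros hab hh. set (I := CI h a b).
assert (hm : icont (fun s => Cmod (h s)) a b) by (intros x hx; now apply rcont_Cmod, hh).
destruct (Req_dec (Cmod I) 0) as [e|n].
{ rewrite e. apply int_ge0; trivial. intros; apply Cmod_ge_0. }
assert (hp : 0 < Cmod I) by (assert (k := Cmod_ge_0 I); lra).
apply Rmult_le_reg_l with (1 := hp). rewrite Cmod_sqr, <- int_scal by trivial.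
assert (E : Re I * Re I + Im I * Im I = RInt (fun x => Re (Cconj I * h x)) a b).
{ change (Re I * Re I + Im I * Im I = Re (CI (fun x => (Cconj I * h x)%C) a b)).
  rewrite CI_scal by trivial. fold I. unfold Re, Im, Cconj, Cmult; simpl. ring. }
rewrite E. apply int_le; trivial.
- intros x hx. assert (k := hh x hx). cont.
- intros x hx. assert (k := hh x hx). cont.
- intros x hx. apply Rle_trans with (1 := Rle_abs _).
  apply Rle_trans with (1 := re_le_Cmod _). rewrite Cmod_mult. apply Req_le. f_equal.
  unfold Cmod, Cconj; simpl. f_equal. ring.
Qed.

Lemma CI_Fubini (F : R -> R -> C) a b c d : a <= b -> c <= d ->
  (forall x y, a <= x <= b -> c <= y <= d -> ccont (fun q : R * R => F (fst q) (snd q)) (x, y)) ->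
  CI (fun x => CI (fun y => F x y) c d) a b =
  CI (fun y => CI (fun x => F x y) a b) c d.
Proof.
intros hab hcd hF. unfold CI; simpl. f_equal.
- apply (Fubini (fun x y => Re (F x y))); trivial. intros. now apply (rcont_Re (fun q : R * R => F (fst q) (snd q))), hF.
- apply (Fubini (fun x y => Im (F x y))); trivial. intros. now apply (rcont_Im (fun q : R * R => F (fst q) (snd q))), hF.
Qed.

(** * Goursat's theorem *)

Lemma near_lt rho z w : Cmod (w - z) < rho - Cmod z -> Cmod w < rho.
Proof.
intros h. replace w with (z + (w - z))%C by ring.
apply Rle_lt_trans with (1 := Cmod_triangle _ _). lra.
Qed.

(** [holo 1] is analyticity on D. The radius is a parameter because auxiliary functions, such as
    Herglotz kernels and the correction term of Poisson's formula, are holomorphic on other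
    discs. *)
Definition holo (rho : R) (f : C -> C) : Prop :=
  forall z, Cmod z < rho -> exists l, cder f z l.

Lemma holo_cts rho f : holo rho f -> forall z, Cmod z < rho -> cts f z.
Proof. intros h z hz. destruct (h z hz) as [l hl]. exact (cder_cts _ _ _ hl). Qed.

Definition seg_pt (a b : C) (s : R) : C := (a + RtoC s * (b - a))%C.

Definition seg (h : C -> C) (a b : C) : C :=
  CI (fun s => ((b - a) * h (seg_pt a b s))%C) 0 1.

Definition ccball (rho : R) (h : C -> C) := forall z, Cmod z < rho -> cts h z.

Lemma seg_pt_le a b s M : Cmod a <= M -> Cmod b <= M -> 0 <= s <= 1 ->
  Cmod (seg_pt a b s) <= M.
Proof.
intros ha hb hs. unfold seg_pt.
replace (a + RtoC s * (b - a))%C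
  with (RtoC (1 - s) * a + RtoC s * b)%C by (rewrite RtoC_minus; ring).
apply Rle_trans with (1 := Cmod_triangle _ _).
rewrite !Cmod_mult, !Cmod_R, !Rabs_pos_eq by lra. nra.
Qed.

Lemma seg_pt_lt a b s rho : Cmod a < rho -> Cmod b < rho -> 0 <= s <= 1 ->
  Cmod (seg_pt a b s) < rho.
Proof.
intros ha hb hs. apply Rle_lt_trans with (Rmax (Cmod a) (Cmod b)).
apply seg_pt_le; trivial. apply Rmax_l. apply Rmax_r.
now apply Rmax_case.
Qed.

Lemma seg_pt_cont {T : UniformSpace} a b (s : T -> R) x : rcont s x -> ccont (fun y => seg_pt a b (s y)) x.
Proof. intros hs. unfold seg_pt. cont. Qed.

Lemma seg_icont rho h a b : ccball rho h -> Cmod a < rho -> Cmod b < rho ->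
  icontC (fun s => ((b - a) * h (seg_pt a b s))%C) 0 1.
Proof.
intros hc ha hb s hs. apply ccont_mult. apply continuous_const.
apply ccont_comp. apply (seg_pt_cont a b (fun s => s)), continuous_id.
apply hc. now apply seg_pt_lt.
Qed.

(** Used with u = -1 to reverse a segment and with u = 1/2 to halve it. In the proof u = 0 is
    treated apart, since it collapses the interval to a point. *)
Lemma CI_comp_lin (f : R -> C) u v a b : a <= b ->
  (forall x, a <= x <= b -> ccont f (u * x + v)) ->
  CI (fun y => (RtoC u * f (u * y + v)%R)%C) a b = CI f (u * a + v) (u * b + v).
Proof.
intros hab hf.
assert (ex : forall g : C -> R, (forall x, a <= x <= b -> rcont (fun s => g (f s)) (u * x + v)) ->
  RInt (fun y => u * g (f (u * y + v))) a b = RInt (fun s => g (f s)) (u * a + v) (u * b + v)).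
{ intros g hg. apply (RInt_comp_lin (V := R_CompleteNormedModule) (fun s => g (f s))).
  apply (ex_RInt_continuous (V := R_CompleteNormedModule)). intros z hz.
  destruct (Req_dec u 0) as [e|n].
  - rewrite e, !Rmult_0_l, Rplus_0_l, Rmin_left, Rmax_left in hz by lra.
    replace z with (u * a + v) by (rewrite e; lra). apply hg; lra.
  - replace z with (u * ((z - v) / u) + v) by (field; trivial). apply hg.
    assert (k : u * ((z - v) / u) = z - v) by (field; trivial).
    set (q := (z - v) / u) in *. clearbody q.
    unfold Rmin, Rmax in hz. destruct (Rle_dec (u * a + v) (u * b + v)).
    + assert (0 < u \/ u < 0) as [h|h] by lra. split; nra. split; nra.
    + assert (0 < u \/ u < 0) as [h|h] by lra. split; nra. split; nra. }
unfold CI. rewrite <- (ex Re), <- (ex Im).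
2: intros; now apply rcont_Im, hf. 2: intros; now apply rcont_Re, hf.
f_equal; apply int_ext; trivial; intros x _; unfold Re, Im; simpl; ring.
Qed.

Lemma CI_Chasles (f : R -> C) a b c : a <= b -> b <= c -> icontC f a c ->
  CI f a c = (CI f a b + CI f b c)%C.
Proof.
intros hab hbc hf. unfold CI, Cplus; simpl.
assert (h1 : icontC f a b) by (intros x hx; apply hf; lra).
assert (h2 : icontC f b c) by (intros x hx; apply hf; lra).
f_equal; symmetry.
- apply (RInt_Chasles (V := R_CompleteNormedModule) (fun s => Re (f s)));
  apply icont_ex; trivial; now apply icontC_Re.
- apply (RInt_Chasles (V := R_CompleteNormedModule) (fun s => Im (f s)));
  apply icont_ex; trivial; now apply icontC_Im.
Qed.

Lemma CI_swap (f : R -> C) a b : a <= b -> icontC f a b -> CI f b a = (- CI f a b)%C.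
Proof.
intros hab hf. unfold CI, Copp; simpl. f_equal; symmetry.
- apply (opp_RInt_swap (V := R_CompleteNormedModule) (fun s => Re (f s))).
  apply icont_ex; trivial; now apply icontC_Re.
- apply (opp_RInt_swap (V := R_CompleteNormedModule) (fun s => Im (f s))).
  apply icont_ex; trivial; now apply icontC_Im.
Qed.

Lemma RtoC_m1 : RtoC (-1) = (- RtoC 1)%C.
Proof. unfold RtoC, Copp; simpl. f_equal; ring. Qed.

Lemma seg_rev rho h a b : ccball rho h -> Cmod a < rho -> Cmod b < rho ->
  seg h b a = (- seg h a b)%C.
Proof.
intros hc ha hb. unfold seg.
assert (hi := seg_icont rho h a b hc ha hb).
set (k := fun s => ((b - a) * h (seg_pt a b s))%C) in *.
rewrite <- CI_swap by (trivial; lra).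
replace (CI k 1 0) with (CI k ((-1) * 0 + 1) ((-1) * 1 + 1)) by (f_equal; ring).
rewrite <- (CI_comp_lin k (-1) 1) by (try lra; intros; apply hi; lra).
apply CI_ext. lra. intros s hs. unfold k.
replace (seg_pt a b (-1 * s + 1)) with (seg_pt b a s).
rewrite RtoC_m1. ring.
unfold seg_pt. rewrite RtoC_plus, RtoC_mult, RtoC_m1. ring.
Qed.

Definition mid (a b : C) : C := (RtoC (/ 2) * (a + b))%C.

Lemma RtoC_half : (RtoC (/ 2) + RtoC (/ 2))%C = RtoC 1.
Proof. rewrite <- RtoC_plus. f_equal. lra. Qed.

Lemma mid_minus_l a b : (mid a b - a)%C = (RtoC (/ 2) * (b - a))%C.
Proof.
unfold mid. replace a with (1 * a)%C at 2 by ring. rewrite <- RtoC_half. ring.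
Qed.

Lemma mid_minus_r a b : (b - mid a b)%C = (RtoC (/ 2) * (b - a))%C.
Proof.
unfold mid. replace b with (1 * b)%C at 1 by ring. rewrite <- RtoC_half. ring.
Qed.

Lemma mid_comm a b : mid a b = mid b a.
Proof. unfold mid. ring. Qed.

Lemma mid_le a b M : Cmod a <= M -> Cmod b <= M -> Cmod (mid a b) <= M.
Proof.
intros ha hb. unfold mid. rewrite Cmod_mult, Cmod_R, Rabs_pos_eq by lra.
assert (h := Cmod_triangle a b). lra.
Qed.

Lemma mid_lt a b rho : Cmod a < rho -> Cmod b < rho -> Cmod (mid a b) < rho.
Proof.
intros ha hb. unfold mid. rewrite Cmod_mult, Cmod_R, Rabs_pos_eq by lra.
assert (h := Cmod_triangle a b). lra.
Qed.

Lemma seg_split rho h a b : ccball rho h -> Cmod a < rho -> Cmod b < rho ->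
  seg h a b = (seg h a (mid a b) + seg h (mid a b) b)%C.
Proof.
intros hc ha hb.
assert (hi := seg_icont rho h a b hc ha hb). unfold seg at 1.
rewrite (CI_Chasles _ 0 (/ 2) 1) by (trivial; lra).
set (k := fun s => ((b - a) * h (seg_pt a b s))%C) in *.
f_equal.
- replace (CI k 0 (/ 2)) with (CI k (/ 2 * 0 + 0) (/ 2 * 1 + 0)) by (f_equal; ring).
  rewrite <- (CI_comp_lin k) by (try lra; intros; apply hi; lra).
  apply CI_ext. lra. intros s hs. unfold k. rewrite mid_minus_l.
  replace (seg_pt a (mid a b) s) with (seg_pt a b (/ 2 * s + 0)). ring.
  unfold seg_pt. rewrite mid_minus_l, RtoC_plus, RtoC_mult. ring.
- replace (CI k (/ 2) 1) with (CI k (/ 2 * 0 + / 2) (/ 2 * 1 + / 2)) by (f_equal; field).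
  rewrite <- (CI_comp_lin k) by (try lra; intros; apply hi; lra).
  apply CI_ext. lra. intros s hs. unfold k. rewrite mid_minus_r.
  replace (seg_pt (mid a b) b s) with (seg_pt a b (/ 2 * s + / 2)). ring.
  unfold seg_pt. rewrite mid_minus_r, RtoC_plus, RtoC_mult.
  replace (mid a b) with (a + (mid a b - a))%C by ring. rewrite mid_minus_l. ring.
Qed.

Lemma seg_bound rho h a b B : ccball rho h -> Cmod a < rho -> Cmod b < rho ->
  (forall s, 0 <= s <= 1 -> Cmod (h (seg_pt a b s)) <= B) ->
  Cmod (seg h a b) <= Cmod (b - a) * B.
Proof.
intros hc ha hb hB. assert (hi := seg_icont rho h a b hc ha hb).
apply Rle_trans with (1 := CI_mod _ 0 1 Rle_0_1 hi).
apply Rle_trans with (RInt (fun _ => Cmod (b - a) * B) 0 1).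
- apply int_le. lra. intros s hs; now apply rcont_Cmod, hi. intros s _; apply continuous_const.
  intros s hs. rewrite Cmod_mult. apply Rmult_le_compat_l. apply Cmod_ge_0. now apply hB.
- rewrite int_const. lra.
Qed.

Lemma seg_FTC rho F h a b : ccball rho h -> (forall z, Cmod z < rho -> cder F z (h z)) ->
  Cmod a < rho -> Cmod b < rho -> seg h a b = (F b - F a)%C.
Proof.
intros hc hF ha hb. unfold seg.
rewrite (CI_FTC (fun s => F (seg_pt a b s))).
- f_equal; f_equal; unfold seg_pt; ring.
- lra.
- intros s hs. apply (pder_comp F (seg_pt a b)). now apply hF, seg_pt_lt.
  unfold seg_pt. apply pder_affine.
- now apply (seg_icont rho).
Qed.

Lemma seg_plus rho f g a b : ccball rho f -> ccball rho g -> Cmod a < rho -> Cmod b < rho ->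
  seg (fun z => (f z + g z)%C) a b = (seg f a b + seg g a b)%C.
Proof.
intros hf hg ha hb. unfold seg.
rewrite <- CI_plus; try lra; try now apply (seg_icont rho).
apply CI_ext. lra. intros; ring.
Qed.

Definition tri (h : C -> C) (T : C * C * C) : C :=
  let '(a, b, c) := T in (seg h a b + seg h b c + seg h c a)%C.

Definition tri_in (M : R) (T : C * C * C) :=
  let '(a, b, c) := T in Cmod a <= M /\ Cmod b <= M /\ Cmod c <= M.

Definition tri_small (d : R) (T : C * C * C) :=
  let '(a, b, c) := T in
  Cmod (b - a) <= d /\ Cmod (c - b) <= d /\ Cmod (a - c) <= d.

Definition sub1 (T : C * C * C) := let '(a, b, c) := T in (a, mid a b, mid c a).
Definition sub2 (T : C * C * C) := let '(a, b, c) := T in (mid a b, b, mid b c).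
Definition sub3 (T : C * C * C) := let '(a, b, c) := T in (mid c a, mid b c, c).
Definition sub4 (T : C * C * C) := let '(a, b, c) := T in (mid a b, mid b c, mid c a).

Lemma tri_split rho M h T : ccball rho h -> tri_in M T -> M < rho ->
  tri h T = (tri h (sub1 T) + tri h (sub2 T) + (tri h (sub3 T) + tri h (sub4 T)))%C.
Proof.
destruct T as [[a b] c]. simpl. intros hc [ha [hb hcc]] hM.
assert (ha' : Cmod a < rho) by lra. assert (hb' : Cmod b < rho) by lra.
assert (hc' : Cmod c < rho) by lra.
assert (m1 := mid_lt _ _ _ ha' hb'). assert (m2 := mid_lt _ _ _ hb' hc').
assert (m3 := mid_lt _ _ _ hc' ha').
rewrite (seg_split rho h a b), (seg_split rho h b c), (seg_split rho h c a) by trivial.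
rewrite (seg_rev rho h (mid a b) (mid c a)) by trivial.
rewrite (seg_rev rho h (mid b c) (mid a b)) by trivial.
rewrite (seg_rev rho h (mid c a) (mid b c)) by trivial.
ring.
Qed.

Definition next (h : C -> C) (T : C * C * C) :=
  let e := Cmod (tri h T) / 4 in
  if Rle_dec e (Cmod (tri h (sub1 T))) then sub1 T else
  if Rle_dec e (Cmod (tri h (sub2 T))) then sub2 T else
  if Rle_dec e (Cmod (tri h (sub3 T))) then sub3 T else sub4 T.

Lemma next_large rho M h T : ccball rho h -> tri_in M T -> M < rho ->
  Cmod (tri h T) / 4 <= Cmod (tri h (next h T)).
Proof.
intros hc hT hM. unfold next.
do 3 (destruct Rle_dec; trivial).
assert (E := tri_split rho M h T hc hT hM).
assert (k : Cmod (tri h T) <= (Cmod (tri h (sub1 T)) + Cmod (tri h (sub2 T))) +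
  (Cmod (tri h (sub3 T)) + Cmod (tri h (sub4 T)))).
{ rewrite E at 1. apply Rle_trans with (1 := Cmod_triangle _ _).
  apply Rplus_le_compat; apply Cmod_triangle. }
lra.
Qed.

Lemma next_case h T (P : C * C * C -> Prop) :
  P (sub1 T) -> P (sub2 T) -> P (sub3 T) -> P (sub4 T) -> P (next h T).
Proof. intros. unfold next. now do 3 (destruct Rle_dec; trivial). Qed.

Lemma next_in M h T : tri_in M T -> tri_in M (next h T).
Proof.
intros hT. apply next_case; destruct T as [[a b] c]; simpl in *;
  destruct hT as [h1 [h2 h3]]; repeat split; trivial; now apply mid_le.
Qed.

Lemma Cmod_half z : Cmod (RtoC (/ 2) * z) = Cmod z / 2.
Proof. rewrite Cmod_mult, Cmod_R, Rabs_pos_eq by lra. lra. Qed.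

Lemma Cmod_sym a b : Cmod (a - b) = Cmod (b - a).
Proof. rewrite <- (Cmod_opp (a - b)%C). f_equal. ring. Qed.

Lemma next_small d h T : tri_small d T -> tri_small (d / 2) (next h T).
Proof.
intros hT. apply next_case; destruct T as [[a b] c]; simpl in *;
  destruct hT as [h1 [h2 h3]]; repeat split.
all: try rewrite mid_minus_l; try rewrite mid_minus_r; try rewrite Cmod_half; try lra.
all: unfold mid;
  match goal with |- Cmod (?k * (?x + ?y) - ?k * (?y + ?z)) <= _ =>
     replace (k * (x + y) - k * (y + z))%C with (k * (x - z))%C by ring
   | |- Cmod (?k * (?x + ?y) - ?k * (?z + ?x)) <= _ =>
     replace (k * (x + y) - k * (z + x))%C with (k * (y - z))%C by ring end.
all: rewrite Cmod_half; rewrite Cmod_sym; lra || (rewrite Cmod_sym; lra).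
Qed.

Lemma next_near d h a b c : tri_small d (a, b, c) ->
  Cmod (fst (fst (next h (a, b, c))) - a) <= d.
Proof.
intros [h1 [h2 h3]]. assert (hd : 0 <= d) by (assert (k := Cmod_ge_0 (b - a)%C); lra).
apply (next_case h (a, b, c) (fun T => Cmod (fst (fst T) - a) <= d)); simpl.
- replace (a - a)%C with (RtoC 0) by ring. now rewrite Cmod_0.
- rewrite mid_minus_l, Cmod_half. lra.
- rewrite mid_comm, mid_minus_l, Cmod_half, Cmod_sym. lra.
- rewrite mid_minus_l, Cmod_half. lra.
Qed.

Lemma C_cauchy (u : nat -> C) :
  (forall eps, 0 < eps -> exists N, forall n m, (N <= n)%nat -> (N <= m)%nat ->
    Cmod (u n - u m) < eps) ->
  exists l, forall eps, 0 < eps -> exists N, forall n, (N <= n)%nat -> Cmod (u n - l) < eps.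
Proof.
intros hu.
assert (H : forall g : C -> R, (forall z w, g (z - w)%C = g z - g w) -> (forall z, Rabs (g z) <= Cmod z) ->
  exists l : R, is_lim_seq (fun n => g (u n)) l).
{ intros g hg hb. assert (K : ex_finite_lim_seq (fun n => g (u n))).
  { apply ex_lim_seq_cauchy_corr. intros eps. destruct (hu eps (cond_pos eps)) as [N hN].
    exists N. intros n m hn hm. rewrite <- hg. apply Rle_lt_trans with (1 := hb _). now apply hN. }
  exact K. }
destruct (H Re) as [l1 H1]. intros; unfold Re; simpl; ring. apply re_le_Cmod.
destruct (H Im) as [l2 H2]. intros; unfold Im; simpl; ring.
{ intros z. apply Rle_trans with (2 := Rmax_Cmod z). apply Rmax_r. }
exists (l1, l2). intros eps he.
apply is_lim_seq_spec in H1. apply is_lim_seq_spec in H2.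
assert (he2 : 0 < eps / 2) by lra.
destruct (H1 (mkposreal _ he2)) as [N1 k1]. destruct (H2 (mkposreal _ he2)) as [N2 k2].
exists (max N1 N2). intros n hn. specialize (k1 n ltac:(lia)). specialize (k2 n ltac:(lia)). simpl in k1, k2.
set (w := (u n - (l1, l2))%C).
replace w with (RtoC (Re w) + Ci * RtoC (Im w))%C.
2:{ apply injective_projections; unfold Re, Im; simpl; ring. }
apply Rle_lt_trans with (1 := Cmod_triangle _ _). rewrite Cmod_mult, Cmod_Ci, !Cmod_R.
unfold w, Re, Im in *; simpl. rewrite <- !Rminus_def. lra.
Qed.

Lemma pow_half_small (eps d : R) : 0 < eps -> 0 <= d -> exists n, d / 2 ^ n < eps.
Proof.
intros he hd. destruct (Req_dec d 0) as [->|n0].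
{ exists O. simpl. lra. }
destruct (pow_lt_1_zero (/ 2)) with (y := eps / d) as [N hN].
rewrite Rabs_pos_eq; lra. apply Rdiv_lt_0_compat; lra.
exists N. specialize (hN N (le_n _)). rewrite Rabs_pos_eq, pow_inv in hN by (apply pow_le; lra).
unfold Rdiv. apply Rmult_lt_reg_l with (/ d). apply Rinv_0_lt_compat; lra.
rewrite <- Rmult_assoc, Rinv_l, Rmult_1_l by trivial. unfold Rdiv in hN. lra.
Qed.

(** Repeated bisection: if the integral had modulus eta > 0, some triangle of the n-th generation
    would keep at least eta / 4^n. These triangles shrink to a point l, where differentiability
    makes the integral smaller than that. *)
Theorem Goursat rho h M T : holo rho h -> tri_in M T -> M < rho -> tri h T = RtoC 0.
Proof.
intros hh hT hM. assert (hc := holo_cts _ _ hh).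
apply NNPP. intros hn. apply Cmod_gt_0 in hn. set (eta := Cmod (tri h T)) in hn.
set (U := fix U n := match n with O => T | S n => next h (U n) end).
assert (hd : exists d, 0 < d /\ tri_small d T).
{ destruct T as [[a b] c].
  exists (1 + Cmod (b - a) + Cmod (c - b) + Cmod (a - c)).
  assert (k1 := Cmod_ge_0 (b - a)%C). assert (k2 := Cmod_ge_0 (c - b)%C).
  assert (k3 := Cmod_ge_0 (a - c)%C). simpl. lra. }
destruct hd as [d [hd0 hd]].
assert (Uin : forall n, tri_in M (U n)).
{ induction n; simpl; trivial. now apply next_in. }
assert (Usm : forall n, tri_small (d / 2 ^ n) (U n)).
{ induction n as [|n IH]; simpl. now rewrite Rdiv_1_r.
  replace (d / (2 * 2 ^ n)) with (d / 2 ^ n / 2) by (field; apply pow_nonzero; lra).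
  now apply next_small. }
assert (Ula : forall n, eta / 4 ^ n <= Cmod (tri h (U n))).
{ induction n as [|n IH]; simpl. fold eta. lra.
  apply Rle_trans with (2 := next_large rho M h (U n) hc (Uin n) hM).
  replace (eta / (4 * 4 ^ n)) with (eta / 4 ^ n / 4) by (field; apply pow_nonzero; lra). lra. }
(* Only the first vertex is followed: consecutive ones are at most d / 2^n apart, so they form a
   Cauchy sequence, within 2 d / 2^n of its limit. *)
set (v n := fst (fst (U n))).
assert (Unear : forall n, Cmod (v (S n) - v n) <= d / 2 ^ n).
{ intros n. unfold v. simpl. generalize (Usm n). destruct (U n) as [[a b] c]. intros k. exact (next_near _ h a b c k). }
assert (Uc : forall n k, Cmod (v (k + n)%nat - v n) <= 2 * d / 2 ^ n - 2 * d / 2 ^ (k + n)).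
{ intros n. induction k as [|k IH]; simpl.
  - replace (v n - v n)%C with (RtoC 0) by ring. rewrite Cmod_0. lra.
  - replace (v (S (k + n)) - v n)%C
      with (v (S (k + n)) - v (k + n)%nat + (v (k + n)%nat - v n))%C by ring.
    apply Rle_trans with (1 := Cmod_triangle _ _). assert (k1 := Unear (k + n)%nat).
    replace (2 * d / (2 * 2 ^ (k + n))) with (d / 2 ^ (k + n)) by (field; apply pow_nonzero; lra).
    replace (2 * d / 2 ^ (k + n)) with (2 * (d / 2 ^ (k + n))) in IH by (field; apply pow_nonzero; lra).
    lra. }
assert (Uc' : forall n m, (n <= m)%nat -> Cmod (v m - v n) <= 2 * d / 2 ^ n).
{ intros n m hm. replace m with ((m - n) + n)%nat by lia.
  apply Rle_trans with (1 := Uc n (m - n)%nat).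
  assert (0 < 2 * d / 2 ^ (m - n + n)). apply Rdiv_lt_0_compat; [lra | apply pow_lt; lra]. lra. }
destruct (C_cauchy v) as [l hl].
{ intros eps he. destruct (pow_half_small (eps / 2) (2 * d)) as [N hN]; [lra|lra|].
  exists N. intros n m gn gm.
  replace (v n - v m)%C with (v n - v N - (v m - v N))%C by ring.
  unfold Cminus at 1. apply Rle_lt_trans with (1 := Cmod_triangle _ _). rewrite Cmod_opp.
  assert (k1 := Uc' N n gn). assert (k2 := Uc' N m gm). lra. }
assert (hvl : forall n, Cmod (v n - l) <= 2 * d / 2 ^ n).
{ intros n. apply le_epsilon. intros eps he. destruct (hl eps he) as [N hN].
  specialize (hN (max n N) ltac:(lia)). assert (k1 := Uc' n (max n N) ltac:(lia)).
  replace (v n - l)%C with (v n - v (max n N) + (v (max n N) - l))%C by ring.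
  apply Rle_trans with (1 := Cmod_triangle _ _). rewrite Cmod_sym. lra. }
assert (hlM : Cmod l <= M).
{ apply le_epsilon. intros eps he. destruct (hl eps he) as [N hN]. specialize (hN N (le_n _)).
  replace l with (v N + (l - v N))%C by ring.
  apply Rle_trans with (1 := Cmod_triangle _ _). rewrite Cmod_sym in hN.
  assert (k : Cmod (v N) <= M). { generalize (Uin N). unfold v. destruct (U N) as [[a b] c]. simpl. tauto. }
  lra. }
destruct (hh l ltac:(lra)) as [q hq]. assert (hq' := proj1 (cder_eps _ _ _) hq).
(* The remainder will contribute at most 3 sides times dn times 3 eps dn, that is 9 eps d^2 / 4^n;
   this choice makes it half of eta / 4^n. *)
set (eps := eta / (18 * d * d)).
assert (he : 0 < eps). { apply Rdiv_lt_0_compat; trivial. nra. }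
destruct (hq' eps he) as [del [hdel Hdel]].
(* A point of the n-th triangle is within d / 2^n of [v n], which is within 2 d / 2^n of l. *)
destruct (pow_half_small del (3 * d)) as [n hn']; [lra|lra|].
(* The affine part has the primitive [P] below, hence integrates to zero around a triangle; only the
   remainder [r] is estimated. *)
set (A z := (h l + (z - l) * q)%C).
set (r z := (h z - A z)%C).
assert (hAc : ccball rho A). { intros z _. unfold A. cont. }
assert (hrc : ccball rho r). { intros z hz. unfold r, A. assert (k := hc z hz). cont. }
assert (hp : 0 < 2 ^ n) by (apply pow_lt; lra).
set (dn := d / 2 ^ n) in *.
assert (hdn : 0 < dn) by (apply Rdiv_lt_0_compat; lra).
replace (3 * d / 2 ^ n) with (3 * dn) in hn' by (unfold dn; field; lra).
assert (hv := hvl n). replace (2 * d / 2 ^ n) with (2 * dn) in hv by (unfold dn; field; lra).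
assert (small : forall z, Cmod (z - v n) <= dn -> Cmod (r z) <= eps * (3 * dn)).
{ intros z hz.
  assert (k : Cmod (z - l) <= 3 * dn).
  { replace (z - l)%C with (z - v n + (v n - l))%C by ring.
    apply Rle_trans with (1 := Cmod_triangle _ _). lra. }
  assert (k' := Hdel z ltac:(lra)).
  replace (h z - h l - (z - l) * q)%C with (r z) in k' by (unfold r, A; ring).
  apply Rle_trans with (1 := k'). apply Rmult_le_compat_l; lra. }
assert (main : Cmod (tri h (U n)) <= 3 * (dn * (eps * (3 * dn)))).
{ assert (hin := Uin n). assert (hsm := Usm n). fold dn in hsm. unfold v in small.
  destruct (U n) as [[a b] c]. simpl in small, hsm, hin |- *.
  destruct hsm as [s1 [s2 s3]]. destruct hin as [i1 [i2 i3]].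
  assert (ia : Cmod a < rho) by lra. assert (ib : Cmod b < rho) by lra. assert (ic : Cmod c < rho) by lra.
  set (P z := (h l * z + q * (RtoC (/ 2) * ((z - l) * (z - l))))%C).
  assert (hP : forall z, Cmod z < rho -> cder P z (A z)).
  { intros z _. unfold P.
    assert (hm : cder (fun z => (z - l)%C) z (RtoC 1)).
    { apply (cder_eq _ _ _ _ (cder_minus _ _ _ _ _ (cder_id z) (cder_const l z))). ring. }
    apply (cder_eq _ _ _ _ (cder_plus _ _ _ _ _ (cder_scal (h l) _ _ _ (cder_id z))
      (cder_scal q _ _ _ (cder_scal (RtoC (/ 2)) _ _ _ (cder_mult _ _ _ _ _ hm hm))))).
    unfold A.
    replace (RtoC (/ 2) * (1 * (z - l) + (z - l) * 1))%C
      with ((RtoC (/2) + RtoC (/2)) * (z - l))%C by ring.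
    rewrite RtoC_half. ring. }
  assert (sg : forall x y, Cmod x < rho -> Cmod y < rho -> seg h x y = (seg r x y + (P y - P x))%C).
  { intros x y hx hy. rewrite <- (seg_FTC rho P A) by trivial.
    rewrite <- (seg_plus rho) by trivial. f_equal.
    apply FunctionalExtensionality.functional_extensionality. intros z. unfold r. ring. }
  rewrite !sg by trivial.
  replace (seg r a b + (P b - P a) + (seg r b c + (P c - P b)) + (seg r c a + (P a - P c)))%C with (seg r a b + seg r b c + seg r c a)%C by ring.
  apply Rle_trans with (1 := Cmod_triangle _ _).
  assert (k := Cmod_triangle (seg r a b) (seg r b c)).
  assert (hB0 : 0 <= eps * (3 * dn)) by nra.
  assert (pts : forall x y, Cmod x < rho -> Cmod y < rho -> Cmod (x - a) <= dn -> Cmod (y - a) <= dn ->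
     Cmod (y - x) <= dn -> Cmod (seg r x y) <= dn * (eps * (3 * dn))).
  { intros x y hx hy hxa hya hxy.
    apply Rle_trans with (Cmod (y - x) * (eps * (3 * dn))).
    - apply (seg_bound rho); trivial. intros s hs. apply small.
      replace (seg_pt x y s - a)%C with (seg_pt (x - a)%C (y - a)%C s) by (unfold seg_pt; ring).
      now apply seg_pt_le.
    - now apply Rmult_le_compat_r. }
  assert (e0 : Cmod (a - a) <= dn).
  { replace (a - a)%C with (RtoC 0) by ring. rewrite Cmod_0. lra. }
  assert (s3' := s3). rewrite Cmod_sym in s3'.
  assert (k1 := pts a b ia ib e0 s1 s1). assert (k2 := pts b c ib ic s1 s3' s2).
  assert (k3 := pts c a ic ia s3' e0 s3). lra. }
assert (big := Ula n).
assert (E4 : 4 ^ n = 2 ^ n * 2 ^ n). { rewrite <- Rpow_mult_distr. replace (2 * 2) with 4 by lra. reflexivity. }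
assert (K : 3 * (dn * (eps * (3 * dn))) = eta / 4 ^ n / 2).
{ unfold eps, dn. rewrite E4. field. lra. }
assert (0 < eta / 4 ^ n). { apply Rdiv_lt_0_compat; trivial. apply pow_lt; lra. }
lra.
Qed.

(** Goursat on the triangle 0, z, w turns the increment of the primitive into the integral over
    [z, w], which is close to (w - z) h(z) by continuity. *)
Theorem holo_primitive rho h : holo rho h ->
  forall z, Cmod z < rho -> cder (seg h (RtoC 0)) z (h z).
Proof.
intros hh z hz. assert (hc := holo_cts _ _ hh).
assert (h0 : Cmod (RtoC 0) < rho) by (rewrite Cmod_0; assert (k := Cmod_ge_0 z); lra).
apply cder_eps. intros eps he.
destruct (proj1 (ccont_eps _ _) (hc z hz) eps he) as [d [hd Hd]].
exists (Rmin d (rho - Cmod z)). split. apply Rmin_case; lra.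
intros w hw.
assert (hw1 := Rlt_le_trans _ _ _ hw (Rmin_l _ _)). assert (hw2 := Rlt_le_trans _ _ _ hw (Rmin_r _ _)).
assert (hwr : Cmod w < rho).
{ replace w with (z + (w - z))%C by ring. apply Rle_lt_trans with (1 := Cmod_triangle _ _). lra. }
assert (T := Goursat rho h (Rmax (Cmod z) (Cmod w)) (RtoC 0, z, w) hh).
assert (E : (seg h (RtoC 0) w - seg h (RtoC 0) z)%C = seg h z w).
{ simpl in T. rewrite (seg_rev rho h (RtoC 0) w) in T by trivial.
  assert (T' := T ltac:(split; [rewrite Cmod_0; apply Rle_trans with (2 := Rmax_l _ _); apply Cmod_ge_0 | split; [apply Rmax_l | apply Rmax_r]]) ltac:(now apply Rmax_case)).
  replace (seg h z w) with (seg h (RtoC 0) z + seg h z w + (- seg h (RtoC 0) w) + (seg h (RtoC 0) w - seg h (RtoC 0) z))%C by ring.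
  rewrite T'. ring. }
rewrite E.
assert (hk : ccball rho (fun _ => h z)) by (intros ? _; cont).
assert (hm : ccball rho (fun x => (h x - h z)%C)) by (intros x hx; assert (k := hc x hx); cont).
replace (seg h z w) with (seg (fun x => (h x - h z)%C) z w + seg (fun _ => h z) z w)%C.
2:{ rewrite <- (seg_plus rho) by trivial. f_equal.
  apply FunctionalExtensionality.functional_extensionality. intros x. ring. }
rewrite (seg_FTC rho (fun x => (h z * x)%C) (fun _ => h z) z w) by (trivial; intros x _;
  apply (cder_eq _ _ _ _ (cder_scal _ _ _ _ (cder_id x))); ring).
match goal with |- Cmod ?X <= _ => replace X with (seg (fun x => (h x - h z)%C) z w) by ring end.
rewrite Rmult_comm. apply (seg_bound rho); trivial.
intros s hs. apply Rlt_le, Hd. unfold seg_pt.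
replace (z + RtoC s * (w - z) - z)%C with (RtoC s * (w - z))%C by ring.
rewrite Cmod_mult, Cmod_R, Rabs_pos_eq by lra. assert (k := Cmod_ge_0 (w - z)%C). nra.
Qed.

(** * Averages over circles and Cauchy's formula *)

Definition circ (r th : R) : C := (r * cos th, r * sin th).

Definition avg (u : R -> R) : R := / (2 * PI) * RInt u 0 (2 * PI).
Definition Cavg (u : R -> C) : C := (RtoC (/ (2 * PI)) * CI u 0 (2 * PI))%C.

Definition tcont (u : R -> R) := forall th, 0 <= th <= 2 * PI -> rcont u th.
Definition tcontC (u : R -> C) := forall th, 0 <= th <= 2 * PI -> ccont u th.

Lemma twoPI_pos : 0 < 2 * PI.
Proof. assert (h := PI_RGT_0). lra. Qed.

Lemma twoPI_le : 0 <= 2 * PI.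
Proof. apply Rlt_le, twoPI_pos. Qed.

Lemma inv_twoPI_pos : 0 < / (2 * PI).
Proof. apply Rinv_0_lt_compat, twoPI_pos. Qed.

Lemma circ_cont {T : UniformSpace} (r th : T -> R) x :
  rcont r x -> rcont th x -> ccont (fun y => circ (r y) (th y)) x.
Proof. intros. unfold circ. cont. Qed.

Lemma circ_mod r th : 0 <= r -> Cmod (circ r th) = r.
Proof.
intros hr. unfold Cmod, circ; simpl.
replace (r * cos th * (r * cos th * 1) + r * sin th * (r * sin th * 1))
  with (r * r * ((sin th)² + (cos th)²)) by (unfold Rsqr; ring).
rewrite sin2_cos2, Rmult_1_r. now apply sqrt_square.
Qed.

Lemma circ_scal r th : circ r th = (RtoC r * circ 1 th)%C.
Proof. unfold circ, RtoC, Cmult; simpl. f_equal; ring. Qed.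

Lemma circ_period r : circ r (2 * PI) = circ r 0.
Proof. unfold circ. now rewrite cos_2PI, sin_2PI, cos_0, sin_0. Qed.

Lemma circ_conj r th : (circ r th * Cconj (circ r th))%C = RtoC (r * r).
Proof.
unfold circ, Cconj, Cmult, RtoC; simpl. f_equal; [|ring].
assert (h := sin2_cos2 th). unfold Rsqr in h.
replace (r * cos th * (r * cos th) - r * sin th * - (r * sin th))
  with (r * r * (sin th * sin th + cos th * cos th)) by ring. rewrite h. ring.
Qed.

Lemma circ_pder r th : pder (circ r) th (Ci * circ r th)%C.
Proof.
split; unfold circ, Re, Im; simpl; auto_derive; trivial; ring.
Qed.

Lemma avg_le u v : tcont u -> tcont v -> (forall th, 0 <= th <= 2 * PI -> u th <= v th) ->
  avg u <= avg v.
Proof.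
intros hu hv h. apply Rmult_le_compat_l. apply Rlt_le, inv_twoPI_pos.
apply int_le; trivial. apply twoPI_le.
Qed.

Lemma avg_ext u v : (forall th, 0 <= th <= 2 * PI -> u th = v th) -> avg u = avg v.
Proof. intros h. unfold avg. f_equal. apply int_ext; trivial. apply twoPI_le. Qed.

Lemma avg_plus u v : tcont u -> tcont v -> avg (fun th => u th + v th) = avg u + avg v.
Proof.
intros hu hv. unfold avg. rewrite int_plus by (trivial; apply twoPI_le). ring.
Qed.

Lemma avg_scal k u : tcont u -> avg (fun th => k * u th) = k * avg u.
Proof.
intros hu. unfold avg. rewrite int_scal by (trivial; apply twoPI_le). ring.
Qed.

Lemma avg_const k : avg (fun _ => k) = k.
Proof. unfold avg. rewrite int_const. field. apply PI_neq0. Qed.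

Lemma avg_ge0 u : tcont u -> (forall th, 0 <= th <= 2 * PI -> 0 <= u th) -> 0 <= avg u.
Proof.
intros hu h. rewrite <- (avg_const 0). apply avg_le; trivial. intros th _; apply continuous_const.
Qed.

Lemma cont_slice_l (F : R -> R -> R) x y :
  rcont (fun q : R * R => F (fst q) (snd q)) (x, y) -> rcont (fun x => F x y) x.
Proof.
intros hF. apply (continuous_comp_2 (fun x : R => x) (fun _ : R => y) F x).
apply continuous_id. apply continuous_const. exact hF.
Qed.

Lemma avg_Fubini (F : R -> R -> R) :
  (forall x y, 0 <= x <= 2 * PI -> 0 <= y <= 2 * PI -> rcont (fun q : R * R => F (fst q) (snd q)) (x, y)) ->
  avg (fun x => avg (fun y => F x y)) = avg (fun y => avg (fun x => F x y)).
Proof.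
intros hF. assert (hp := twoPI_le). set (c := / (2 * PI)).
unfold avg; fold c. f_equal.
transitivity (RInt (fun x => RInt (fun y => c * F x y) 0 (2 * PI)) 0 (2 * PI)).
{ apply int_ext; trivial. intros x hx. symmetry. apply int_scal; trivial.
  intros y hy. apply (cont_slice F), hF; trivial. }
rewrite (Fubini (fun x y => c * F x y)) by
  (trivial; (intros x y hx hy; apply rcont_mult; [apply continuous_const | now apply hF])).
apply int_ext; trivial. intros y hy. apply int_scal; trivial.
intros x hx. now apply cont_slice_l, hF.
Qed.

Lemma RInt_cont_r (F : R -> R -> R) a b y : a <= b ->
  (forall x y, a <= x <= b -> rcont (fun q : R * R => F (fst q) (snd q)) (x, y)) ->
  rcont (fun y => RInt (fun x => F x y) a b) y.
Proof.
intros hab hF. apply (RInt_param_cont (fun y x => F x y)); trivial.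
- apply filter_forall. intros y' x hx. now apply cont_slice_l, hF.
- intros x hx.
  apply (continuous_comp_2 (fun q : R * R => snd q) (fun q : R * R => fst q) F (y, x)).
  apply continuous_snd. apply continuous_fst. now apply hF.
Qed.

Lemma RInt_avg_Fubini (F : R -> R -> R) a b : a <= b ->
  (forall x y, a <= x <= b -> rcont (fun q : R * R => F (fst q) (snd q)) (x, y)) ->
  RInt (fun x => avg (fun y => F x y)) a b = avg (fun y => RInt (fun x => F x y) a b).
Proof.
intros hab hF. assert (hp := twoPI_le). set (c := / (2 * PI)).
unfold avg; fold c.
transitivity (RInt (fun x => RInt (fun y => c * F x y) 0 (2 * PI)) a b).
{ apply int_ext; trivial. intros x hx. symmetry. apply int_scal; trivial.
  intros y hy. now apply (cont_slice F), hF. }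
rewrite (Fubini (fun x y => c * F x y)) by
  (trivial; (intros x y hx hy; apply rcont_mult; [apply continuous_const | now apply hF])).
rewrite <- int_scal; trivial.
- apply int_ext; trivial. intros y hy. apply int_scal; trivial.
  intros x hx. now apply cont_slice_l, hF.
- intros y hy. now apply RInt_cont_r.
Qed.
Lemma tcontC_Re u : tcontC u -> tcont (fun th => Re (u th)).
Proof. intros h th hth. now apply rcont_Re, h. Qed.
Lemma tcontC_mod u : tcontC u -> tcont (fun th => Cmod (u th)).
Proof. intros h th hth. now apply rcont_Cmod, h. Qed.

Lemma Re_Cavg u : Re (Cavg u) = avg (fun th => Re (u th)).
Proof. unfold Cavg, avg, CI, Cmult, RtoC, Re, Im; simpl. ring. Qed.

Lemma Cavg_ext u v : (forall th, 0 <= th <= 2 * PI -> u th = v th) -> Cavg u = Cavg v.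
Proof. intros h. unfold Cavg. f_equal. apply CI_ext; trivial. apply twoPI_le. Qed.

Lemma Cavg_plus u v : tcontC u -> tcontC v -> Cavg (fun th => (u th + v th)%C) = (Cavg u + Cavg v)%C.
Proof.
intros hu hv. unfold Cavg. rewrite CI_plus by (trivial; apply twoPI_le). ring.
Qed.

Lemma Cavg_minus u v : tcontC u -> tcontC v -> Cavg (fun th => (u th - v th)%C) = (Cavg u - Cavg v)%C.
Proof.
intros hu hv. unfold Cavg. rewrite CI_minus by (trivial; apply twoPI_le). ring.
Qed.

Lemma Cavg_scal c u : tcontC u -> Cavg (fun th => (c * u th)%C) = (c * Cavg u)%C.
Proof.
intros hu. unfold Cavg. rewrite CI_scal by (trivial; apply twoPI_le). ring.
Qed.

Lemma Cavg_const c : Cavg (fun _ => c) = c.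
Proof.
unfold Cavg. rewrite CI_const, Rminus_0_r, Cmult_assoc, <- RtoC_mult, Rinv_l.
ring. apply Rgt_not_eq, twoPI_pos.
Qed.

Lemma Cavg_mod u : tcontC u -> Cmod (Cavg u) <= avg (fun th => Cmod (u th)).
Proof.
intros hu. unfold Cavg. rewrite Cmod_mult, Cmod_R, Rabs_pos_eq by apply Rlt_le, inv_twoPI_pos.
apply Rmult_le_compat_l. apply Rlt_le, inv_twoPI_pos. apply CI_mod; trivial. apply twoPI_le.
Qed.

Lemma Cavg_bound u B : tcontC u -> (forall th, 0 <= th <= 2 * PI -> Cmod (u th) <= B) ->
  Cmod (Cavg u) <= B.
Proof.
intros hu h. apply Rle_trans with (1 := Cavg_mod u hu). rewrite <- (avg_const B).
apply avg_le; trivial. now apply tcontC_mod. intros th _; apply continuous_const.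
Qed.

Lemma Cavg_der (B u : R -> C) : (forall th, 0 <= th <= 2 * PI -> pder B th (u th)) -> tcontC u ->
  B (2 * PI) = B 0 -> Cavg u = RtoC 0.
Proof.
intros hB hu e. unfold Cavg. rewrite (CI_FTC B u) by (trivial; apply twoPI_le).
rewrite e. ring.
Qed.

Lemma CI_ext_open (f g : R -> C) a b : a <= b -> (forall x, a < x < b -> f x = g x) ->
  CI f a b = CI g a b.
Proof.
intros hab h. unfold CI. f_equal; apply RInt_ext; rewrite Rmin_left, Rmax_right by lra;
intros; now rewrite h.
Qed.

(** By the fundamental theorem and Fubini, the difference of the two averages is the integral over l
    of the averages of [D l]. Their vanishing is asked only for 0 < l < 1, because in [Cauchy_C1] it
    is shown by a primitive carrying a factor 1/l. *)
Lemma homotopy (A D : R -> R -> C) :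
  (forall l th, 0 <= l <= 1 -> 0 <= th <= 2 * PI -> pder (fun l => A l th) l (D l th)) ->
  (forall l th, 0 <= l <= 1 -> 0 <= th <= 2 * PI -> ccont (fun q : R * R => D (fst q) (snd q)) (l, th)) ->
  (forall l, 0 < l < 1 -> Cavg (D l) = RtoC 0) ->
  tcontC (A 0) -> tcontC (A 1) -> Cavg (A 1) = Cavg (A 0).
Proof.
intros hA hD h0 c0 c1.
assert (E : (Cavg (A 1) - Cavg (A 0))%C = RtoC 0).
{ rewrite <- Cavg_minus by trivial. unfold Cavg.
  rewrite (CI_ext _ (fun th => CI (fun l => D l th) 0 1)); [|apply twoPI_le|].
  - rewrite <- (CI_Fubini D); [|lra|apply twoPI_le|trivial].
    rewrite (CI_ext_open _ (fun _ => RtoC 0)); [|lra|].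
    rewrite CI_const. ring.
    intros l hl. specialize (h0 l hl). unfold Cavg in h0.
    apply NNPP. intros n. apply (Cmult_neq_0 (RtoC (/ (2 * PI)))) in n.
    now apply n. intros e. apply RtoC_inj in e. assert (k := inv_twoPI_pos). lra.
  - intros th hth. rewrite (CI_FTC (fun l => A l th)); trivial. lra. intros; now apply hA.
    intros l hl. apply (continuous_comp_2 (fun l : R => l) (fun _ : R => th) D l).
    apply continuous_id. apply continuous_const. apply hD; trivial. }
replace (Cavg (A 1)) with (Cavg (A 1) - Cavg (A 0) + Cavg (A 0))%C by ring.
rewrite E. ring.
Qed.

Lemma circ_neq R0 a th : Cmod a < R0 -> (circ R0 th - a)%C <> RtoC 0.
Proof.
intros ha e. apply Ceq_minus in e. assert (k := circ_mod R0 th). rewrite e in k.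
assert (h := Cmod_ge_0 a). lra.
Qed.

Lemma circ_dist R0 a th : Cmod a < R0 -> R0 - Cmod a <= Cmod (circ R0 th - a).
Proof.
intros ha. assert (h := Cmod_triangle (circ R0 th - a)%C a).
replace (circ R0 th - a + a)%C with (circ R0 th) in h by ring.
rewrite circ_mod in h by (assert (k := Cmod_ge_0 a); lra). lra.
Qed.

Lemma circ_cont1 r th : ccont (circ r) th.
Proof. apply (circ_cont (fun _ => r) (fun th => th)); cont. Qed.

Lemma pder_scal c g s l : pder g s l -> pder (fun u => (c * g u)%C) s (c * l)%C.
Proof.
intros h. rewrite Cmult_comm. apply (pder_comp (fun z => (c * z)%C)); trivial.
apply (cder_eq _ _ _ _ (cder_scal _ _ _ _ (cder_id _))). ring.
Qed.

Lemma pder_eq g s l l' : pder g s l -> l = l' -> pder g s l'.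
Proof. now intros h <-. Qed.

(** Deform a to 0 through l a: at l = 0 the integrand is 1, and its l-derivative is the
    th-derivative of the periodic function i a / (w - l a), so the average does not move. *)
Lemma Cauchy_kernel R0 a : Cmod a < R0 ->
  Cavg (fun th => (circ R0 th / (circ R0 th - a))%C) = RtoC 1.
Proof.
intros ha. assert (hR : 0 < R0) by (assert (k := Cmod_ge_0 a); lra).
assert (hl : forall l, 0 <= l <= 1 -> Cmod (RtoC l * a) < R0).
{ intros l hl. rewrite Cmod_mult, Cmod_R, Rabs_pos_eq by lra. assert (k := Cmod_ge_0 a). nra. }
set (A l th := (circ R0 th / (circ R0 th - RtoC l * a))%C).
set (D l th := (a * circ R0 th / ((circ R0 th - RtoC l * a) * (circ R0 th - RtoC l * a)))%C).
assert (cA : forall l, 0 <= l <= 1 -> tcontC (A l)).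
{ intros l h th _. assert (k := circ_cont1 R0 th). unfold A.
  assert (n := circ_neq R0 _ th (hl l h)). cont. }
assert (cden : forall l th, cder (fun z => (circ R0 th - z * a)%C) (RtoC l) (- a)%C).
{ intros l th. apply (cder_eq _ _ _ _ (cder_minus _ _ _ _ _ (cder_const (circ R0 th) (RtoC l))
     (cder_mult _ _ _ _ _ (cder_id (RtoC l)) (cder_const a _)))). ring. }
transitivity (Cavg (A 1)).
{ apply Cavg_ext. intros th _. unfold A. now rewrite Cmult_1_l. }
rewrite (homotopy A D).
- rewrite <- (Cavg_const (RtoC 1)). apply Cavg_ext. intros th _. unfold A.
  rewrite Cmult_0_l. replace (circ R0 th - 0)%C with (circ R0 th) by ring.
  field. intros e. assert (k := circ_mod R0 th). rewrite e, Cmod_0 in k. lra.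
- intros l th h hth. assert (n := circ_neq R0 _ th (hl l h)).
  assert (H := cder_div (fun _ => circ R0 th) _ (RtoC l) _ _ (cder_const _ _) (cden l th) n).
  apply (pder_eq _ _ _ _ (pder_comp _ (fun l => RtoC l) l _ (RtoC 1) H
     (conj (is_derive_id (K := R_AbsRing) l) (is_derive_const (K := R_AbsRing) (V := R_NormedModule) 0 l)))).
  unfold D. field. trivial.
- intros l th h hth. assert (n := circ_neq R0 _ th (hl l h)).
  assert (k : ccont (fun q : R * R => circ R0 (snd q)) (l, th)).
  { apply circ_cont; cont. }
  unfold D. cont. now apply Cmult_neq_0.
- intros l h. assert (h' : 0 <= l <= 1) by lra.
  apply (Cavg_der (fun th => (Ci * a * (/ (circ R0 th - RtoC l * a)))%C)).
  + intros th _. assert (n := circ_neq R0 _ th (hl l h')).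
    assert (H : cder (fun z => (/ (z - RtoC l * a))%C) (circ R0 th)
       (- (/ ((circ R0 th - RtoC l * a) * (circ R0 th - RtoC l * a))))%C).
    { apply (cder_eq _ _ _ _ (cder_comp Cinv (fun z => (z - RtoC l * a)%C) _ _ _ (cder_inv _ n)
        (cder_minus _ _ _ _ _ (cder_id _) (cder_const _ _)))). ring. }
    apply (pder_eq _ _ _ _ (pder_scal _ _ _ _ (pder_comp _ _ _ _ _ H (circ_pder R0 th)))).
    unfold D. replace (Ci * a * (Ci * circ R0 th * (- (/ ((circ R0 th - RtoC l * a) * (circ R0 th - RtoC l * a))))))%C
      with ((- (Ci * Ci)) * (a * circ R0 th / ((circ R0 th - RtoC l * a) * (circ R0 th - RtoC l * a))))%C by (field; trivial).
    replace (- (Ci * Ci))%C with (RtoC 1). ring.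
    unfold Ci, Copp, Cmult, RtoC; simpl. f_equal; ring.
  + intros th _. assert (k := circ_cont1 R0 th). assert (n := circ_neq R0 _ th (hl l h')).
    unfold D. cont. now apply Cmult_neq_0.
  + now rewrite circ_period.
- apply cA; lra.
- apply cA; lra.
Qed.

(** Contract the circle to a through the points a + l (w - a). The l-derivative, P1 times w, is up
    to the constant i l the th-derivative of P at that point, so its average vanishes; at l = 0
    there remains P(a) times the Cauchy kernel. Continuity of P1 is what Fubini asks for. *)
Lemma Cauchy_C1 rho P P1 R0 a : (forall z, Cmod z < rho -> cder P z (P1 z)) -> ccball rho P1 ->
  Cmod a < R0 -> R0 < rho ->
  Cavg (fun th => (P (circ R0 th) * circ R0 th / (circ R0 th - a))%C) = P a.
Proof.
intros hP hP1 ha hR. assert (hR0 : 0 < R0) by (assert (k := Cmod_ge_0 a); lra).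
assert (hcr : forall th, Cmod (circ R0 th) < rho) by (intros; rewrite circ_mod; lra).
assert (hPc : forall z, Cmod z < rho -> cts P z) by (intros z hz; exact (cder_cts _ _ _ (hP z hz))).
assert (hsp : forall l th, 0 <= l <= 1 -> Cmod (seg_pt a (circ R0 th) l) < rho).
{ intros l th hl. apply seg_pt_lt; trivial. lra. }
set (om th := (circ R0 th / (circ R0 th - a))%C).
assert (com : tcontC om).
{ intros th _. assert (k := circ_cont1 R0 th). assert (n := circ_neq R0 _ th ha). unfold om. cont. }
set (A l th := (om th * P (seg_pt a (circ R0 th) l))%C).
set (D l th := (P1 (seg_pt a (circ R0 th) l) * circ R0 th)%C).
assert (csp : forall l th, ccont (fun q : R * R => seg_pt a (circ R0 (snd q)) (fst q)) (l, th)).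
{ intros l th. assert (k : ccont (fun q : R * R => circ R0 (snd q)) (l, th)) by (apply circ_cont; cont).
  unfold seg_pt. cont. }
assert (cA : forall l, 0 <= l <= 1 -> tcontC (A l)).
{ intros l h th hth. unfold A. apply ccont_mult; [now apply com|].
  apply (ccont_comp (fun th => seg_pt a (circ R0 th) l)). 2: now apply hPc, hsp.
  assert (k := circ_cont1 R0 th). unfold seg_pt. cont. }
transitivity (Cavg (A 1)).
{ apply Cavg_ext. intros th _. unfold A, om. replace (seg_pt a (circ R0 th) 1) with (circ R0 th).
  field. now apply circ_neq. unfold seg_pt. ring. }
rewrite (homotopy A D).
- transitivity (Cavg (fun th => (P a * om th)%C)).
  { apply Cavg_ext. intros th _. unfold A. replace (seg_pt a (circ R0 th) 0) with a. ring. unfold seg_pt. ring. }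
  rewrite Cavg_scal by trivial. unfold om. rewrite Cauchy_kernel by trivial. ring.
- intros l th h hth. unfold A.
  assert (H := pder_comp P (seg_pt a (circ R0 th)) l _ _ (hP _ (hsp l th h)) (pder_affine a (circ R0 th - a)%C l)).
  apply (pder_eq _ _ _ _ (pder_scal (om th) _ _ _ H)). unfold D, om. field. now apply circ_neq.
- intros l th h hth. unfold D. apply ccont_mult.
  + apply (ccont_comp (fun q : R * R => seg_pt a (circ R0 (snd q)) (fst q))). apply csp. now apply hP1, hsp.
  + apply circ_cont; cont.
- intros l h. assert (h' : 0 <= l <= 1) by lra.
  assert (nl : RtoC l <> RtoC 0) by (intros e; apply RtoC_inj in e; lra).
  apply (Cavg_der (fun th => (/ (Ci * RtoC l) * P (seg_pt a (circ R0 th) l))%C)).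
  + intros th _.
    assert (H : cder (fun z => P (seg_pt a z l)) (circ R0 th) (RtoC l * P1 (seg_pt a (circ R0 th) l))%C).
    { apply (cder_comp P (fun z => seg_pt a z l)). now apply hP, hsp. unfold seg_pt.
      apply (cder_eq _ _ _ _ (cder_plus _ _ _ _ _ (cder_const a _) (cder_scal (RtoC l) _ _ _
        (cder_minus _ _ _ _ _ (cder_id (circ R0 th)) (cder_const a _))))). ring. }
    apply (pder_eq _ _ _ _ (pder_scal _ _ _ _ (pder_comp _ _ _ _ _ H (circ_pder R0 th)))).
    unfold D. field. split; trivial. apply Ci_nz.
  + intros th hth. unfold D. apply ccont_mult.
    * apply (ccont_comp (fun th => seg_pt a (circ R0 th) l)). 2: now apply hP1, hsp.
      assert (k := circ_cont1 R0 th). unfold seg_pt. cont.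
    * apply circ_cont1.
  + now rewrite circ_period.
- apply cA; lra.
- apply cA; lra.
Qed.

(** * Cauchy-type integrals and Cauchy's formula *)

(** With u = h(w) w this is the contour integral of h(w) / (w - a)^n over 2 pi i, since dw = i w dth
    on the circle. *)
Definition Kn (R0 : R) (n : nat) (u : R -> C) (a : C) : C :=
  Cavg (fun th => (u th / Cpow (circ R0 th - a) n)%C).

Lemma Kn_cont R0 n u a : Cmod a < R0 -> tcontC u ->
  tcontC (fun th => (u th / Cpow (circ R0 th - a) n)%C).
Proof.
intros ha hu th hth. assert (k := circ_cont1 R0 th). assert (k' := hu th hth). cont.
now apply Cpow_nz, circ_neq.
Qed.

Lemma tcontC_bounded u : tcontC u -> exists B, 0 < B /\ forall th, 0 <= th <= 2 * PI -> Cmod (u th) <= B.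
Proof.
intros hu.
destruct (continuity_ab_maj (fun th => Cmod (u th)) 0 (2 * PI) twoPI_le) as [M [hM _]].
{ intros th hth. apply continuity_pt_filterlim. now apply rcont_Cmod, hu. }
exists (Cmod (u M) + 1). split. assert (k := Cmod_ge_0 (u M)); lra.
intros th hth. specialize (hM th hth). simpl in hM. lra.
Qed.

(** Differentiation under the average: a second-order remainder of the kernel, uniform in th, gives
    a remainder at most B M |w - a|^2 for the average, where B bounds u. *)
Lemma kernel_der (u : R -> C) (k : C -> R -> C) (k1 : R -> C) a d M :
  tcontC u -> 0 < d -> 0 < M ->
  (forall w, Cmod (w - a) < d -> tcontC (k w)) -> tcontC k1 ->
  (forall w th, Cmod (w - a) < d -> 0 <= th <= 2 * PI ->
    Cmod (k w th - k a th - (w - a) * k1 th) <= M * (Cmod (w - a) * Cmod (w - a))) ->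
  cder (fun w => Cavg (fun th => (u th * k w th)%C)) a (Cavg (fun th => (u th * k1 th)%C)).
Proof.
intros hu hd hM hk hk1 H. destruct (tcontC_bounded u hu) as [B [hB0 hB]].
apply cder_eps. intros eps he.
exists (Rmin d (eps / (B * M))). split.
{ apply Rmin_case; trivial. apply Rdiv_lt_0_compat; trivial. now apply Rmult_lt_0_compat. }
intros w hw.
assert (hw1 := Rlt_le_trans _ _ _ hw (Rmin_l _ _)). assert (hw2 := Rlt_le_trans _ _ _ hw (Rmin_r _ _)).
assert (ha : Cmod (a - a) < d) by (replace (a - a)%C with (RtoC 0) by ring; now rewrite Cmod_0).
assert (c1 : tcontC (fun th => (u th * k w th)%C)) by (intros th hth; apply ccont_mult; [now apply hu | now apply hk]).
assert (c2 : tcontC (fun th => (u th * k a th)%C)) by (intros th hth; apply ccont_mult; [now apply hu | now apply hk]).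
assert (c3 : tcontC (fun th => (u th * k1 th)%C)) by (intros th hth; apply ccont_mult; [now apply hu | now apply hk1]).
assert (c4 : tcontC (fun th => ((w - a) * (u th * k1 th))%C)).
{ intros th hth; apply ccont_mult; [apply continuous_const | now apply c3]. }
assert (c5 : tcontC (fun th => (u th * k w th - u th * k a th)%C)).
{ intros th hth; apply ccont_minus; [now apply c1 | now apply c2]. }
rewrite <- Cavg_scal, <- Cavg_minus, <- Cavg_minus by trivial.
apply Cavg_bound.
{ intros th hth; apply ccont_minus; [now apply c5 | now apply c4]. }
intros th hth.
replace (u th * k w th - u th * k a th - (w - a) * (u th * k1 th))%C
  with (u th * (k w th - k a th - (w - a) * k1 th))%C by ring.
rewrite Cmod_mult.
assert (q := Cmod_ge_0 (w - a)%C).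
apply Rle_trans with (B * (M * (Cmod (w - a) * Cmod (w - a)))).
- apply Rmult_le_compat; try apply Cmod_ge_0; auto.
- assert (B * M * Cmod (w - a) <= eps).
  { apply Rlt_le in hw2. apply Rmult_le_compat_l with (r := B * M) in hw2; [|nra].
    replace (B * M * (eps / (B * M))) with eps in hw2 by (field; lra). trivial. }
  nra.
Qed.

Lemma Kn_der1 R0 u a : Cmod a < R0 -> tcontC u -> cder (Kn R0 1 u) a (Kn R0 2 u a).
Proof.
intros ha hu. set (d := R0 - Cmod a). assert (hd : 0 < d) by (unfold d; lra).
assert (hnear : forall w th, Cmod (w - a) < d / 2 -> d / 2 <= Cmod (circ R0 th - w)).
{ intros w th hw. assert (h := circ_dist R0 a th ha). fold d in h.
  assert (t := Cmod_triangle (circ R0 th - w)%C (w - a)%C).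
  replace (circ R0 th - w + (w - a))%C with (circ R0 th - a)%C in t by ring. lra. }
assert (hne : forall w th, Cmod (w - a) < d / 2 -> (circ R0 th - w)%C <> RtoC 0).
{ intros w th hw. apply Cmod_gt_0. assert (k := hnear w th hw). lra. }
(* The remainder of 1/x is (w - a)^2 over x^2 (circ - w) with x = circ - a, where |x| >= d and |circ
   - w| >= d/2. *)
assert (hM : 0 < 2 / (d * d * d)) by (apply Rdiv_lt_0_compat; repeat apply Rmult_lt_0_compat; lra).
apply (kernel_der u (fun w th => (/ Cpow (circ R0 th - w) 1)%C)
  (fun th => (/ Cpow (circ R0 th - a) 2)%C) a (d / 2) (2 / (d * d * d)) hu ltac:(lra) hM).
- intros w hw th hth. assert (k := circ_cont1 R0 th). cont. now apply Cpow_nz, hne.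
- intros th hth. assert (k := circ_cont1 R0 th). cont. now apply Cpow_nz, circ_neq.
- intros w th hw _. assert (n1 := hne w th hw). assert (n2 := circ_neq R0 a th ha).
  match goal with |- Cmod ?X <= _ => replace X with ((w - a) * (w - a) / ((circ R0 th - a) * (circ R0 th - a) * (circ R0 th - w)))%C by (simpl; now field) end.
  rewrite Cmod_div, !Cmod_mult by (repeat apply Cmult_neq_0; trivial).
  unfold Rdiv at 1. rewrite Rmult_comm. apply Rmult_le_compat_r.
  { assert (q := Cmod_ge_0 (w - a)%C). nra. }
  assert (h1 := circ_dist R0 a th ha). fold d in h1. assert (h2 := hnear w th hw).
  replace (2 / (d * d * d)) with (/ (d * d * (d / 2))) by (field; lra).
  apply Rinv_le_contravar. { assert (0 < d * d) by nra. nra. }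
  assert (d * d <= Cmod (circ R0 th - a) * Cmod (circ R0 th - a)) by nra.
  apply Rmult_le_compat; nra.
Qed.

Lemma Kn_der2 R0 u a : Cmod a < R0 -> tcontC u -> cder (Kn R0 2 u) a (2 * Kn R0 3 u a)%C.
Proof.
intros ha hu. set (d := R0 - Cmod a). assert (hd : 0 < d) by (unfold d; lra).
assert (hnear : forall w th, Cmod (w - a) < d / 2 -> Cmod (circ R0 th - a) / 2 <= Cmod (circ R0 th - w)).
{ intros w th hw. assert (h := circ_dist R0 a th ha). fold d in h.
  assert (t := Cmod_triangle (circ R0 th - w)%C (w - a)%C).
  replace (circ R0 th - w + (w - a))%C with (circ R0 th - a)%C in t by ring. lra. }
assert (hda : forall th, d <= Cmod (circ R0 th - a)) by (intros th; exact (circ_dist R0 a th ha)).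
assert (hne : forall w th, Cmod (w - a) < d / 2 -> (circ R0 th - w)%C <> RtoC 0).
{ intros w th hw. apply Cmod_gt_0. assert (k := hnear w th hw). assert (k' := hda th). lra. }
(* With x = circ - a and e = w - a, the remainder of 1/x^2 is e^2 (3x - 2e) / (x^3 (x - e)^2). The
   bracket is at most 4|x| and |x - e| >= |x|/2, which gives 16 / |x|^4. *)
assert (hM : 0 < 16 / (d * d * (d * d))) by (apply Rdiv_lt_0_compat; repeat apply Rmult_lt_0_compat; lra).
unfold Kn at 2. rewrite <- Cavg_scal by now apply Kn_cont.
rewrite (Cavg_ext _ (fun th => (u th * (2 * (/ Cpow (circ R0 th - a) 3)))%C)) by
  (intros; unfold Cdiv; ring).
apply (kernel_der u (fun w th => (/ Cpow (circ R0 th - w) 2)%C)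
  (fun th => (2 * (/ Cpow (circ R0 th - a) 3))%C) a (d / 2) _ hu ltac:(lra) hM).
- intros w hw th hth. assert (k := circ_cont1 R0 th). cont. now apply Cpow_nz, hne.
- intros th hth. assert (k := circ_cont1 R0 th). cont. now apply Cpow_nz, circ_neq.
- intros w th hw _. assert (n1 := hne w th hw). assert (n2 := circ_neq R0 a th ha).
  set (x := (circ R0 th - a)%C) in *. set (e := (w - a)%C) in *.
  assert (h2 := hnear w th hw). assert (h1 := hda th). fold x in h1, h2.
  replace (circ R0 th - w)%C with (x - e)%C in * by (unfold x, e; ring).
  match goal with |- Cmod ?X <= _ => replace X with (e * e * (x + (x + x) - (e + e)) / (x * (x * x) * ((x - e) * (x - e))))%C end.
  2:{ replace (RtoC 2) with (1 + 1)%C by (rewrite <- RtoC_plus; f_equal; ring).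
    simpl. field. now split. }
  rewrite Cmod_div, !Cmod_mult by (repeat apply Cmult_neq_0; trivial).
  set (X := Cmod x) in *. set (Y := Cmod (x - e)) in *. set (E := Cmod e) in *.
  assert (hN : Cmod (x + (x + x) - (e + e)) <= 4 * X).
  { unfold Cminus. assert (t1 := Cmod_triangle (x + (x + x))%C (- (e + e))%C).
    rewrite Cmod_opp in t1. assert (t2 := Cmod_triangle x (x + x)%C).
    assert (t3 := Cmod_triangle x x). assert (t4 := Cmod_triangle e e).
    assert (t5 : E < d / 2) by exact hw. unfold X, E in *. lra. }
  set (N := Cmod (x + (x + x) - (e + e))) in *.
  assert (hN0 : 0 <= N) by apply Cmod_ge_0.
  assert (hE0 : 0 <= E) by apply Cmod_ge_0.
  replace (E * E * N / (X * (X * X) * (Y * Y))) with (N / (X * (X * X) * (Y * Y)) * (E * E)) by (field; lra).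
  apply Rmult_le_compat_r. nra.
  apply Rle_trans with (16 / (X * X * (X * X))).
  + apply Rle_trans with (4 * X / (X * (X * X) * (X / 2 * (X / 2)))).
    * assert (x3 : 0 < X * (X * X)) by (repeat apply Rmult_lt_0_compat; lra).
      assert (q : 0 < X / 2 * (X / 2)) by (apply Rmult_lt_0_compat; lra).
      assert (q' : X / 2 * (X / 2) <= Y * Y) by (apply Rmult_le_compat; lra).
      apply Rmult_le_compat; trivial.
      apply Rlt_le, Rinv_0_lt_compat, Rmult_lt_0_compat; lra.
      apply Rinv_le_contravar. now apply Rmult_lt_0_compat.
      apply Rmult_le_compat_l; lra.
    * apply Req_le. field. lra.
  + unfold Rdiv. apply Rmult_le_compat_l. lra. apply Rinv_le_contravar. repeat apply Rmult_lt_0_compat; lra.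
    assert (d * d <= X * X) by nra. nra.
Qed.

Lemma holo_circ_cont rho h R0 : holo rho h -> 0 <= R0 -> R0 < rho -> tcontC (fun th => h (circ R0 th)).
Proof.
intros hh h0 h1 th _. apply (ccont_comp (circ R0)). apply circ_cont1.
apply (holo_cts rho); trivial. rewrite circ_mod; lra.
Qed.

(** A merely differentiable h is reached through its primitive P, whose derivative is continuous.
    [Cauchy_C1] for P, differentiated in a, expresses h(a) by P against (w - a)^-2; integrating by
    parts around the circle moves the derivative from the kernel back onto P. *)
Theorem Cauchy_formula rho h R0 a : holo rho h -> Cmod a < R0 -> R0 < rho ->
  h a = Kn R0 1 (fun th => (h (circ R0 th) * circ R0 th)%C) a.
Proof.
intros hh ha hR. assert (h0 : 0 < R0) by (assert (k := Cmod_ge_0 a); lra).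
set (P := seg h (RtoC 0)).
assert (hP : forall z, Cmod z < rho -> cder P z (h z)) by now apply holo_primitive.
assert (hPh : holo rho P) by (intros z hz; exists (h z); now apply hP).
assert (cP := holo_circ_cont _ _ R0 hPh (Rlt_le _ _ h0) hR).
assert (ch := holo_circ_cont _ _ R0 hh (Rlt_le _ _ h0) hR).
set (u th := (P (circ R0 th) * circ R0 th)%C).
assert (cu : tcontC u) by (intros th hth; apply ccont_mult; [now apply cP | apply circ_cont1]).
assert (E : h a = Kn R0 2 u a).
{ apply (cder_unique P a). now apply hP; lra.
  apply (cder_ext_loc (Kn R0 1 u) P a _ (R0 - Cmod a)). lra.
  - intros w hw. symmetry.
    assert (hwR := near_lt R0 a w hw).
    rewrite <- (Cauchy_C1 rho P h R0 w) by (trivial; exact (holo_cts rho h hh)).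
    apply Cavg_ext. intros th _. unfold u. rewrite Cpow_1_r. reflexivity.
  - now apply Kn_der1. }
rewrite E.
assert (c1 := Kn_cont R0 2 u a ha cu).
assert (cu2 : tcontC (fun th => (h (circ R0 th) * circ R0 th)%C)) by
  (intros th hth; apply ccont_mult; [now apply ch | apply circ_cont1]).
assert (c2 := Kn_cont R0 1 _ a ha cu2).
assert (Z : (Kn R0 1 (fun th => (h (circ R0 th) * circ R0 th)%C) a - Kn R0 2 u a)%C = RtoC 0).
{ unfold Kn. rewrite <- Cavg_minus by trivial.
  apply (Cavg_der (fun th => (/ Ci * (P (circ R0 th) / (circ R0 th - a)))%C)).
  - intros th _. assert (n := circ_neq R0 a th ha).
    assert (H := cder_div P (fun z => (z - a)%C) (circ R0 th) _ _ (hP (circ R0 th) ltac:(rewrite circ_mod; lra))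
      (cder_minus _ _ _ _ _ (cder_id _) (cder_const a _)) n).
    apply (pder_eq _ _ _ _ (pder_scal (/ Ci)%C _ _ _ (pder_comp _ _ _ _ _ H (circ_pder R0 th)))).
    unfold u. simpl. field. split; trivial. apply Ci_nz.
  - intros th hth. apply ccont_minus; [now apply c2 | now apply c1].
  - now rewrite circ_period. }
symmetry. apply Ceq_minus. exact Z.
Qed.

Lemma Cauchy_der rho h R0 a : holo rho h -> Cmod a < R0 -> R0 < rho ->
  cder h a (Kn R0 2 (fun th => (h (circ R0 th) * circ R0 th)%C) a).
Proof.
intros hh ha hR. assert (h0 : 0 < R0) by (assert (k := Cmod_ge_0 a); lra).
apply (cder_ext_loc (Kn R0 1 (fun th => (h (circ R0 th) * circ R0 th)%C)) h a _ (R0 - Cmod a)). lra.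
- intros w hw. symmetry. apply (Cauchy_formula rho); trivial.
  exact (near_lt R0 a w hw).
- apply Kn_der1; trivial. intros th hth. apply ccont_mult; [|apply circ_cont1].
  apply (holo_circ_cont rho h R0 hh); lra.
Qed.

Lemma C_derive_eq f z l : cder f z l -> C_derive f z = l.
Proof. apply is_C_derive_unique. Qed.

Lemma holo_cder rho h z : holo rho h -> Cmod z < rho -> cder h z (C_derive h z).
Proof. intros hh hz. destruct (hh z hz) as [l hl]. now rewrite (C_derive_eq _ _ _ hl). Qed.

Lemma C_derive_Cauchy rho h R0 a : holo rho h -> Cmod a < R0 -> R0 < rho ->
  C_derive h a = Kn R0 2 (fun th => (h (circ R0 th) * circ R0 th)%C) a.
Proof. intros. apply C_derive_eq. now apply Cauchy_der with rho. Qed.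

Theorem holo_derive rho h : holo rho h -> holo rho (C_derive h).
Proof.
intros hh a ha. set (R0 := (Cmod a + rho) / 2).
set (u th := (h (circ R0 th) * circ R0 th)%C).
exists (2 * Kn R0 3 u a)%C.
assert (k := Cmod_ge_0 a).
assert (h1 : Cmod a < R0) by (unfold R0; lra). assert (h2 : R0 < rho) by (unfold R0; lra).
apply (cder_ext_loc (Kn R0 2 u) _ a _ (R0 - Cmod a)). lra.
- intros w hw. symmetry. apply (C_derive_Cauchy rho); trivial.
  exact (near_lt R0 a w hw).
- apply Kn_der2; trivial. intros th hth. apply ccont_mult; [|apply circ_cont1].
  apply (holo_circ_cont rho h R0 hh); lra.
Qed.

Lemma mean_value rho h R0 : holo rho h -> 0 < R0 -> R0 < rho ->
  Cavg (fun th => h (circ R0 th)) = h (RtoC 0).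
Proof.
intros hh h0 hR. rewrite (Cauchy_formula rho h R0) by (trivial; rewrite Cmod_0; lra).
apply Cavg_ext. intros th _. simpl.
assert (n : circ R0 th <> RtoC 0).
{ intros e. assert (k := circ_mod R0 th). rewrite e, Cmod_0 in k. lra. }
field. replace (circ R0 th - 0)%C with (circ R0 th) by ring. trivial.
Qed.

(** * The Poisson kernel *)

Definition Pk (R0 : R) (a : C) (th : R) : R :=
  (R0 * R0 - Cmod a * Cmod a) / (Cmod (circ R0 th - a) * Cmod (circ R0 th - a)).

Lemma Cmod_sqr_conj z : RtoC (Cmod z * Cmod z) = (z * Cconj z)%C.
Proof. rewrite Cmod_sqr. unfold RtoC, Cmult, Cconj, Re, Im; simpl. f_equal; ring. Qed.

Lemma Cconj_minus a b : Cconj (a - b) = (Cconj a - Cconj b)%C.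
Proof. unfold Cconj, Cminus, Cplus, Copp; simpl. f_equal; ring. Qed.

Lemma Cconj_neq0 a : a <> RtoC 0 -> Cconj a <> RtoC 0.
Proof.
intros h e. apply h. destruct a as [x y]. unfold Cconj, RtoC in e; simpl in e.
injection e as -> e2. unfold RtoC. f_equal. lra.
Qed.

Lemma Cmod_conj a : Cmod (Cconj a) = Cmod a.
Proof. unfold Cmod, Cconj; simpl. f_equal. ring. Qed.

(** On the circle conj w = R0^2 / w. This substitution makes the kernel the Cauchy kernel plus a
    term that extends analytically in w across the closed disc. *)
Lemma Pk_split R0 a th : Cmod a < R0 ->
  RtoC (Pk R0 a th) = (circ R0 th / (circ R0 th - a) + Cconj a * circ R0 th / (RtoC (R0 * R0) - Cconj a * circ R0 th))%C.
Proof.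
intros ha. assert (k := Cmod_ge_0 a). assert (n := circ_neq R0 a th ha).
assert (nw : circ R0 th <> RtoC 0).
{ intros e. assert (q := circ_mod R0 th). rewrite e, Cmod_0 in q. lra. }
assert (n' := Cconj_neq0 _ n). rewrite Cconj_minus in n'.
unfold Pk. rewrite RtoC_div, RtoC_minus, !Cmod_sqr_conj, Cconj_minus.
2:{ apply Cmod_gt_0 in n. nra. }
rewrite <- (circ_conj R0 th).
set (w := circ R0 th) in *. set (w' := Cconj w) in *. set (a' := Cconj a) in *.
replace (w * w' - a' * w)%C with (w * (w' - a'))%C by ring.
field. repeat split; trivial.
Qed.

Lemma Pk_cont R0 a : Cmod a < R0 -> tcont (Pk R0 a).
Proof.
intros ha th _. unfold Pk. assert (k := circ_cont1 R0 th). cont.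
assert (n := circ_neq R0 a th ha). apply Cmod_gt_0 in n. nra.
Qed.

Lemma Pk_pos R0 a th : Cmod a < R0 -> 0 <= Pk R0 a th.
Proof.
intros ha. assert (n := circ_neq R0 a th ha). apply Cmod_gt_0 in n. assert (k := Cmod_ge_0 a).
apply Rlt_le, Rdiv_lt_0_compat; nra.
Qed.

Lemma Pk_le R0 a th : Cmod a < R0 -> Pk R0 a th <= (R0 + Cmod a) / (R0 - Cmod a).
Proof.
intros ha. assert (k := Cmod_ge_0 a). assert (h := circ_dist R0 a th ha). unfold Pk.
apply Rle_trans with ((R0 * R0 - Cmod a * Cmod a) / ((R0 - Cmod a) * (R0 - Cmod a))).
- apply Rmult_le_compat_l. nra. apply Rinv_le_contravar; nra.
- apply Req_le. field. lra.
Qed.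

(* Multiplied by h, the second summand of Pk_split is analytic and vanishes at 0, so its average is 0. *)
Theorem Poisson_formula rho h R0 a : holo rho h -> Cmod a < R0 -> R0 < rho ->
  h a = Cavg (fun th => (h (circ R0 th) * RtoC (Pk R0 a th))%C).
Proof.
intros hh ha hR. assert (ka := Cmod_ge_0 a). assert (h0 : 0 < R0) by lra.
(* The reflected pole R0^2 / conj a lies outside the circle. Any m with |a| < m < R0 gives a disc of
   radius R0^2 / m, larger than R0, that avoids it. *)
set (m := (Cmod a + R0) / 2).
assert (hm : Cmod a < m < R0) by (unfold m; lra).
set (rho' := Rmin rho (R0 * R0 / m)).
assert (hr' : R0 < rho').
{ apply Rmin_case; trivial. apply Rmult_lt_reg_r with m. lra.
  replace (R0 * R0 / m * m) with (R0 * R0) by (field; lra). nra. }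
assert (hnz : forall z, Cmod z < rho' -> (RtoC (R0 * R0) - Cconj a * z)%C <> RtoC 0).
{ intros z hz e. apply Ceq_minus in e. apply (f_equal Cmod) in e.
  rewrite Cmod_R, Rabs_pos_eq, Cmod_mult, Cmod_conj in e by nra.
  assert (hz2 := Rlt_le_trans _ _ _ hz (Rmin_r _ _)).
  apply Rmult_lt_compat_r with (r := m) in hz2; [|lra].
  replace (R0 * R0 / m * m) with (R0 * R0) in hz2 by (field; lra).
  assert (kz := Cmod_ge_0 z). nra. }
set (q z := (h z * Cconj a * z / (RtoC (R0 * R0) - Cconj a * z))%C).
assert (hq : holo rho' q).
{ intros z hz. destruct (hh z (Rlt_le_trans _ _ _ hz (Rmin_l _ _))) as [l hl].
  eexists. unfold q.
  exact (cder_div _ _ _ _ _ (cder_mult _ _ _ _ _ (cder_mult _ _ _ _ _ hl (cder_const (Cconj a) z)) (cder_id z))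
    (cder_minus _ _ _ _ _ (cder_const (RtoC (R0 * R0)) z) (cder_scal (Cconj a) _ _ _ (cder_id z))) (hnz z hz)). }
assert (E := mean_value rho' q R0 hq h0 hr').
assert (q0 : q (RtoC 0) = RtoC 0) by (unfold q, Cdiv; ring).
assert (ch := holo_circ_cont _ _ R0 hh (Rlt_le _ _ h0) hR).
assert (cq := holo_circ_cont _ _ R0 hq (Rlt_le _ _ h0) hr').
assert (cu : tcontC (fun th => (h (circ R0 th) * circ R0 th)%C)) by
  (intros th hth; apply ccont_mult; [now apply ch | apply circ_cont1]).
rewrite (Cauchy_formula rho h R0 a) at 1 by trivial.
transitivity (Kn R0 1 (fun th => (h (circ R0 th) * circ R0 th)%C) a + Cavg (fun th => q (circ R0 th)))%C.
{ rewrite E, q0. ring. }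
unfold Kn. rewrite <- Cavg_plus; trivial.
2: now apply Kn_cont.
apply Cavg_ext. intros th _. rewrite Pk_split by trivial. unfold q. rewrite Cpow_1_r. field. split.
apply hnz. rewrite circ_mod; lra. now apply circ_neq.
Qed.

Lemma avg_Pk R0 a : Cmod a < R0 -> avg (Pk R0 a) = 1.
Proof.
intros ha. assert (hh : holo (R0 + 1) (fun _ => RtoC 1)) by (intros z _; eexists; apply cder_const).
assert (E := Poisson_formula (R0 + 1) _ R0 a hh ha ltac:(lra)). simpl in E.
apply (f_equal Re) in E. rewrite Re_Cavg in E. simpl in E. rewrite E.
apply avg_ext. intros th _. ring.
Qed.

(** * Powers, Jensen and Minkowski *)

Lemma rpow_pos_eq x a : 0 < x -> rpow x a = Rpower x a.
Proof. intros h. unfold rpow. now destruct (Rlt_dec 0 x). Qed.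

Lemma rpow_npos x a : x <= 0 -> rpow x a = 0.
Proof. intros h. unfold rpow. destruct (Rlt_dec 0 x); trivial. lra. Qed.

Lemma rpow_0 a : rpow 0 a = 0.
Proof. apply rpow_npos, Rle_refl. Qed.

Lemma rpow_gt0 x a : 0 < x -> 0 < rpow x a.
Proof. intros h. rewrite rpow_pos_eq by trivial. apply exp_pos. Qed.

Lemma rpow_ge0 x a : 0 <= rpow x a.
Proof.
destruct (Rlt_dec 0 x). now apply Rlt_le, rpow_gt0. rewrite rpow_npos; lra.
Qed.

Lemma rpow_1_l a : rpow 1 a = 1.
Proof. rewrite rpow_pos_eq by lra. unfold Rpower. now rewrite ln_1, Rmult_0_r, exp_0. Qed.

Lemma rpow_1_r x : 0 <= x -> rpow x 1 = x.
Proof.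
intros [h|<-]. now rewrite rpow_pos_eq, Rpower_1. apply rpow_0.
Qed.

Lemma rpow_mult x y a : 0 <= x -> 0 <= y -> rpow (x * y) a = rpow x a * rpow y a.
Proof.
intros [hx|<-] [hy|<-]; rewrite ?Rmult_0_l, ?Rmult_0_r, ?rpow_0, ?Rmult_0_l, ?Rmult_0_r; trivial.
rewrite !rpow_pos_eq; trivial. now rewrite Rpower_mult_distr. now apply Rmult_lt_0_compat.
Qed.

Lemma rpow_lt x y a : 0 < a -> 0 <= x < y -> rpow x a < rpow y a.
Proof.
intros ha [[hx|<-] hxy].
- rewrite !rpow_pos_eq by lra. unfold Rpower. apply exp_increasing, Rmult_lt_compat_l; trivial.
  now apply ln_increasing.
- rewrite rpow_0. now apply rpow_gt0.
Qed.

Lemma rpow_le x y a : 0 < a -> 0 <= x <= y -> rpow x a <= rpow y a.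
Proof.
intros ha [hx [hxy| ->]]. apply Rlt_le, rpow_lt; lra. lra.
Qed.

Lemma rpow_rpow x a b : 0 <= x -> rpow (rpow x a) b = rpow x (a * b).
Proof.
intros [h|<-].
- rewrite (rpow_pos_eq (rpow x a)) by now apply rpow_gt0. rewrite !rpow_pos_eq by trivial. apply Rpower_mult.
- now rewrite !rpow_0.
Qed.

Lemma rpow_root x p : 0 < p -> 0 <= x -> rpow (rpow x p) (/ p) = x.
Proof. intros hp hx. rewrite rpow_rpow, Rinv_r by lra. now apply rpow_1_r. Qed.

Lemma rpow_root' x p : 0 < p -> 0 <= x -> rpow (rpow x (/ p)) p = x.
Proof. intros hp hx. rewrite rpow_rpow, Rinv_l by lra. now apply rpow_1_r. Qed.

Lemma rpow_cont a x : 0 < a -> continuous (T := R_UniformSpace) (U := R_UniformSpace) (fun y => rpow y a) x.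
Proof.
intros ha. destruct (Rtotal_order x 0) as [h|[->|h]].
- apply (continuous_ext_loc (T := R_UniformSpace) (U := R_UniformSpace) _ (fun _ => 0)).
  + assert (hd : 0 < - x) by lra. exists (mkposreal _ hd). intros y hy.
    apply Rabs_def2 in hy. unfold minus, plus, opp in hy; simpl in hy. rewrite rpow_npos; lra.
  + apply continuous_const.
- apply filterlim_locally. intros eps.
  assert (hd : 0 < rpow eps (/ a)) by apply rpow_gt0, cond_pos.
  exists (mkposreal _ hd). intros y hy. change (Rabs (y - 0) < rpow eps (/ a)) in hy.
  change (Rabs (rpow y a - rpow 0 a) < eps). rewrite rpow_0, Rminus_0_r, Rabs_pos_eq by apply rpow_ge0.
  rewrite Rminus_0_r in hy. apply Rabs_def2 in hy.
  destruct (Rle_dec y 0) as [k|k]. rewrite rpow_npos by trivial. apply cond_pos.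
  rewrite <- (rpow_root' eps a ha) by apply Rlt_le, cond_pos. apply rpow_lt; lra.
- apply (continuous_ext_loc (T := R_UniformSpace) (U := R_UniformSpace) _ (fun y => Rpower y a)).
  + exists (mkposreal _ h). intros y hy.
    apply Rabs_def2 in hy. unfold minus, plus, opp in hy; simpl in hy. rewrite rpow_pos_eq; lra.
  + unfold Rpower. apply continuous_exp_comp.
    apply (rcont_mult (fun _ => a) ln). apply continuous_const.
    apply continuity_pt_filterlim. apply derivable_continuous_pt. eexists. now apply derivable_pt_lim_ln.
Qed.

Lemma rcont_rpow {T : UniformSpace} (f : T -> R) a x : 0 < a -> rcont f x -> rcont (fun y => rpow (f y) a) x.
Proof. intros ha hf. exact (continuous_comp f (fun y => rpow y a) x hf (rpow_cont a (f x) ha)). Qed.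

(** Two instances of 1 + x <= exp x: exp c (1 + pc - c) <= exp(pc), and exp c (1 - c) <= 1 with
    weight p - 1. Their sum is the claim. *)
Lemma exp_convex c a p : 1 <= p -> a = p * c -> 1 + p * (exp c - 1) <= exp a.
Proof.
intros hp ->.
assert (h1 : exp c * (1 + (p * c - c)) <= exp (p * c)).
{ replace (exp (p * c)) with (exp c * exp (p * c - c)) by (rewrite <- exp_plus; f_equal; ring).
  apply Rmult_le_compat_l. apply Rlt_le, exp_pos. apply exp_ineq1_le. }
assert (h2 : exp c * (1 - c) <= 1).
{ replace 1 with (exp c * exp (- c)) at 2 by (rewrite <- exp_plus, Rplus_opp_r; apply exp_0).
  apply Rmult_le_compat_l. apply Rlt_le, exp_pos. apply exp_ineq1_le. }
apply Rmult_le_compat_l with (r := p - 1) in h2; [|lra]. nra.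
Qed.

Lemma Bernoulli_rpow s p : 1 <= p -> 0 <= s -> 1 + p * (s - 1) <= rpow s p.
Proof.
intros hp [h|<-].
- rewrite rpow_pos_eq by trivial. rewrite <- (exp_ln s) at 1 by trivial.
  apply exp_convex; trivial.
- rewrite rpow_0. lra.
Qed.

(** Bernoulli at x / y, scaled by y^p. The slope is written p y^p / y, which keeps the exponent p -
    1 out of the calculus. Convexity and Jensen both come from this line. *)
Lemma rpow_tangent x y p : 1 <= p -> 0 <= x -> 0 < y ->
  rpow y p + p * (rpow y p / y) * (x - y) <= rpow x p.
Proof.
intros hp hx hy. assert (h := Bernoulli_rpow (x / y) p hp).
assert (hs : 0 <= x / y) by (apply Rdiv_le_0_compat; trivial). specialize (h hs).
apply Rmult_le_compat_l with (r := rpow y p) in h; [|apply rpow_ge0].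
rewrite <- rpow_mult in h by lra.
replace (y * (x / y)) with x in h by (field; lra).
apply Rle_trans with (2 := h). apply Req_le. field. lra.
Qed.

Lemma rpow_convex x y l p : 1 <= p -> 0 <= x -> 0 <= y -> 0 <= l <= 1 ->
  rpow (l * x + (1 - l) * y) p <= l * rpow x p + (1 - l) * rpow y p.
Proof.
intros hp hx hy hl. set (m := l * x + (1 - l) * y).
assert (hm : 0 <= m) by (unfold m; nra).
destruct hm as [hm|<-].
- assert (h1 := rpow_tangent x m p hp hx hm). assert (h2 := rpow_tangent y m p hp hy hm).
  set (k := p * (rpow m p / m)) in *.
  apply Rmult_le_compat_l with (r := l) in h1; [|lra].
  apply Rmult_le_compat_l with (r := 1 - l) in h2; [|lra].
  assert (E : l * (k * (x - m)) + (1 - l) * (k * (y - m)) = 0) by (unfold m; ring).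
  lra.
- rewrite rpow_0. assert (h1 := rpow_ge0 x p). assert (h2 := rpow_ge0 y p). nra.
Qed.

(** Integrate the tangent at the mean y against w: the linear term cancels since w has total mass 1.
    A zero mean is apart, as the tangent needs y > 0. *)
Lemma Jensen h w a b p : a <= b -> 1 <= p -> icont h a b -> icont w a b ->
  (forall x, a <= x <= b -> 0 <= h x) -> (forall x, a <= x <= b -> 0 <= w x) -> RInt w a b = 1 ->
  rpow (RInt (fun x => h x * w x) a b) p <= RInt (fun x => rpow (h x) p * w x) a b.
Proof.
intros hab hp hh hw h0 w0 w1.
assert (c1 : icont (fun x => h x * w x) a b) by (intros x hx; apply rcont_mult; auto).
assert (c2 : icont (fun x => rpow (h x) p * w x) a b).
{ intros x hx; apply rcont_mult; auto. apply rcont_rpow; auto. lra. }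
set (y := RInt (fun x => h x * w x) a b).
assert (hy : 0 <= y). { apply int_ge0; trivial. intros x hx. apply Rmult_le_pos; auto. }
destruct hy as [hy|<-].
- set (k := p * (rpow y p / y)).
  apply Rle_trans with (RInt (fun x => (rpow y p - k * y) * w x + k * (h x * w x)) a b).
  + rewrite int_plus, !int_scal by (trivial; intros x hx; apply rcont_mult; auto; apply continuous_const).
    rewrite w1. fold y. apply Req_le. ring.
  + apply int_le; trivial.
    * intros x hx. assert (k1 := hh x hx). assert (k2 := hw x hx). cont.
    * intros x hx. assert (t := rpow_tangent (h x) y p hp (h0 x hx) hy). fold k in t.
      apply Rmult_le_compat_r with (r := w x) in t; auto. lra.
- rewrite rpow_0. apply int_ge0; trivial. intros x hx. apply Rmult_le_pos; auto. apply rpow_ge0.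
Qed.

Lemma avg_Jensen h w p : 1 <= p -> tcont h -> tcont w ->
  (forall x, 0 <= x <= 2 * PI -> 0 <= h x) -> (forall x, 0 <= x <= 2 * PI -> 0 <= w x) -> avg w = 1 ->
  rpow (avg (fun x => h x * w x)) p <= avg (fun x => rpow (h x) p * w x).
Proof.
intros hp hh hw h0 w0 w1. assert (hpi := twoPI_le).
assert (hp0 : 0 < p) by lra.
unfold avg in *. set (c := / (2 * PI)) in *. assert (hc : 0 < c) by apply inv_twoPI_pos.
rewrite <- !int_scal; trivial.
2: intros x hx; apply rcont_mult; auto; now apply rcont_rpow; auto.
2: intros x hx; apply rcont_mult; auto.
rewrite (int_ext _ (fun x => h x * (c * w x))) by (trivial; intros; ring).
rewrite (int_ext (fun x => c * (rpow (h x) p * w x)) (fun x => rpow (h x) p * (c * w x))) by (trivial; intros; ring).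
apply Jensen; trivial.
- intros x hx; apply rcont_mult; auto; apply continuous_const.
- intros x hx; apply Rmult_le_pos; auto. lra.
- now rewrite int_scal.
Qed.

Lemma avg_Jensen1 h p : 1 <= p -> tcont h -> (forall x, 0 <= x <= 2 * PI -> 0 <= h x) ->
  rpow (avg h) p <= avg (fun x => rpow (h x) p).
Proof.
intros hp hh h0.
rewrite (avg_ext h (fun x => h x * 1)) by (intros; ring).
rewrite (avg_ext (fun x => rpow (h x) p) (fun x => rpow (h x) p * 1)) by (intros; ring).
apply avg_Jensen; trivial.
intros x _; apply continuous_const. intros; lra. apply avg_const.
Qed.

(** (u + v) / (A + B) is the convex combination of u / A and v / B with weights A / (A + B) and B /
    (A + B); apply convexity pointwise and average. *)
Lemma Minkowski u v p A B : 1 <= p -> tcont u -> tcont v ->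
  (forall x, 0 <= x <= 2 * PI -> 0 <= u x) -> (forall x, 0 <= x <= 2 * PI -> 0 <= v x) ->
  0 <= A -> 0 <= B ->
  avg (fun x => rpow (u x) p) <= rpow A p -> avg (fun x => rpow (v x) p) <= rpow B p ->
  avg (fun x => rpow (u x + v x) p) <= rpow (A + B) p.
Proof.
intros hp hu hv u0 v0 hA hB hAu hBv. assert (hp0 : 0 < p) by lra.
assert (cu : tcont (fun x => rpow (u x) p)) by (intros x hx; apply rcont_rpow; auto).
assert (cv : tcont (fun x => rpow (v x) p)) by (intros x hx; apply rcont_rpow; auto).
assert (strict : forall A B, 0 < A -> 0 < B ->
  avg (fun x => rpow (u x) p) <= rpow A p -> avg (fun x => rpow (v x) p) <= rpow B p ->
  avg (fun x => rpow (u x + v x) p) <= rpow (A + B) p).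
{ clear A B hA hB hAu hBv. intros A B hA hB hAu hBv. set (l := A / (A + B)).
  assert (hl : 0 <= l <= 1).
  { unfold l. split. apply Rdiv_le_0_compat; lra. apply Rmult_le_reg_r with (A + B). lra.
    unfold Rdiv; rewrite Rmult_assoc, Rinv_l; lra. }
  assert (hl' : 1 - l = B / (A + B)) by (unfold l; field; lra).
  apply Rle_trans with (avg (fun x => rpow (A + B) p * l / rpow A p * rpow (u x) p + rpow (A + B) p * (1 - l) / rpow B p * rpow (v x) p)).
  - apply avg_le.
    + intros x hx. apply rcont_rpow; trivial. apply rcont_plus; auto.
    + intros x hx. apply rcont_plus; apply rcont_mult; auto; apply continuous_const.
    + intros x hx.
      replace (u x + v x) with ((A + B) * (l * (u x / A) + (1 - l) * (v x / B))) by (rewrite hl'; unfold l; field; lra).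
      assert (hx1 : 0 <= u x / A) by (apply Rdiv_le_0_compat; auto).
      assert (hx2 : 0 <= v x / B) by (apply Rdiv_le_0_compat; auto).
      assert (pA := rpow_gt0 A p hA). assert (pB := rpow_gt0 B p hB).
      rewrite rpow_mult by nra.
      assert (k := rpow_convex (u x / A) (v x / B) l p hp hx1 hx2 hl).
      apply Rmult_le_compat_l with (r := rpow (A + B) p) in k; [|apply rpow_ge0].
      apply Rle_trans with (1 := k). apply Req_le.
      replace (rpow (u x) p) with (rpow (u x / A) p * rpow A p).
      replace (rpow (v x) p) with (rpow (v x / B) p * rpow B p).
      field; lra.
      rewrite <- rpow_mult by lra. f_equal. field. lra.
      rewrite <- rpow_mult by lra. f_equal. field. lra.
  - assert (pA := rpow_gt0 A p hA). assert (pB := rpow_gt0 B p hB). assert (pAB := rpow_gt0 (A + B) p ltac:(lra)).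
    rewrite avg_plus, !avg_scal; trivial.
    2,3: intros x hx; apply rcont_mult; auto; apply continuous_const.
    apply Rle_trans with (rpow (A + B) p * l / rpow A p * rpow A p + rpow (A + B) p * (1 - l) / rpow B p * rpow B p).
    + apply Rplus_le_compat; apply Rmult_le_compat_l; trivial; apply Rdiv_le_0_compat; trivial; apply Rmult_le_pos; lra.
    + apply Req_le. field. lra. }
(* A or B may be 0: both are enlarged by d / 4, and continuity of the power absorbs the change. *)
apply le_epsilon. intros eps he.
assert (hc := rpow_cont p (A + B) hp0).
destruct (rcont_locally _ _ eps hc he) as [d hd].
assert (hdp := cond_pos d).
assert (k := strict (A + d / 4) (B + d / 4) ltac:(lra) ltac:(lra)
  ltac:(apply Rle_trans with (1 := hAu); apply rpow_le; lra) ltac:(apply Rle_trans with (1 := hBv); apply rpow_le; lra)).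
apply Rle_trans with (1 := k).
specialize (hd (A + d / 4 + (B + d / 4))).
assert (hb : ball (A + B) d (A + d / 4 + (B + d / 4))).
{ change (Rabs (A + d / 4 + (B + d / 4) - (A + B)) < d). rewrite Rabs_pos_eq; lra. }
specialize (hd hb). apply Rabs_def2 in hd. lra.
Qed.

(** * Integral means and the Hardy norm *)

(** The p-th power of [integral_mean]. Being a plain average it is open to monotonicity, linearity
    and Fubini, so the estimates are made on it. *)
Definition mp (p : R) (f : C -> C) (r : R) : R :=
  avg (fun th => rpow (Cmod (f (circ r th))) p).

Lemma integral_mean_eq p f r : integral_mean p f r = rpow (mp p f r) (/ p).
Proof. reflexivity. Qed.

Lemma analytic_holo f : analytic f <-> holo 1 f.
Proof. split; intros h z hz; exact (h z hz). Qed.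

Lemma mp_tcont p f r : 0 < p -> holo 1 f -> 0 <= r < 1 ->
  tcont (fun th => rpow (Cmod (f (circ r th))) p).
Proof.
intros hp hf hr th hth. apply rcont_rpow; trivial. apply rcont_Cmod.
apply (holo_circ_cont 1 f r hf); lra.
Qed.

Lemma mp_ge0 p f r : 0 < p -> holo 1 f -> 0 <= r < 1 -> 0 <= mp p f r.
Proof.
intros. apply avg_ge0. now apply mp_tcont. intros; apply rpow_ge0.
Qed.

Lemma mean_le_iff p f r K : 0 < p -> holo 1 f -> 0 <= r < 1 -> 0 <= K ->
  integral_mean p f r <= K <-> mp p f r <= rpow K p.
Proof.
intros hp hf hr hK. rewrite integral_mean_eq. assert (h0 := mp_ge0 p f r hp hf hr).
assert (hp' := Rinv_0_lt_compat p hp). split; intros h.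
- rewrite <- (rpow_root' (mp p f r) p) by trivial. apply rpow_le; trivial. split; trivial. apply rpow_ge0.
- rewrite <- (rpow_root K p) by trivial. apply rpow_le; trivial. now split.
Qed.

Lemma mp_ext p f g r : 0 <= r < 1 -> (forall z, Cmod z < 1 -> f z = g z) -> mp p f r = mp p g r.
Proof. intros hr h. apply avg_ext. intros th _. rewrite h; trivial. rewrite circ_mod; lra. Qed.

Lemma integral_mean_ge0 p f r : 0 <= integral_mean p f r.
Proof. apply rpow_ge0. Qed.

Lemma hardy_bound p f K : (forall r, 0 <= r < 1 -> integral_mean p f r <= K) ->
  is_finite (hardy_norm p f) /\ real (hardy_norm p f) <= K.
Proof.
intros h. unfold hardy_norm.
set (S := fun x => exists r, 0 <= r < 1 /\ x = integral_mean p f r).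
destruct (Lub_Rbar_correct S) as [hub hlub].
assert (h1 : Rbar_le (Lub_Rbar S) K). { apply hlub. intros x [r [hr ->]]. exact (h r hr). }
(* The mean at r = 0 keeps the supremum from being minus infinity. *)
assert (h2 : Rbar_le (integral_mean p f 0) (Lub_Rbar S)). { apply hub. exists 0. split; trivial. lra. }
destruct (Lub_Rbar S); simpl in *; try easy. 
Qed.

Lemma hardy_mean_le p f r : is_finite (hardy_norm p f) -> 0 <= r < 1 ->
  integral_mean p f r <= real (hardy_norm p f).
Proof.
intros hf hr. unfold hardy_norm in *.
set (S := fun x => exists r, 0 <= r < 1 /\ x = integral_mean p f r) in *.
destruct (Lub_Rbar_correct S) as [hub _].
assert (h2 : Rbar_le (integral_mean p f r) (Lub_Rbar S)). { apply hub. now exists r. }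
rewrite <- hf in h2. exact h2.
Qed.

Lemma hardy_norm_ge0 p f : is_finite (hardy_norm p f) -> 0 <= real (hardy_norm p f).
Proof.
intros hf. apply Rle_trans with (integral_mean p f 0). apply integral_mean_ge0.
apply hardy_mean_le; trivial. lra.
Qed.

Lemma Hardy_bound p f K : 0 < p -> holo 1 f -> 0 <= K ->
  (forall r, 0 <= r < 1 -> mp p f r <= rpow K p) -> mem (Hardy p) f /\ nrm (Hardy p) f <= K.
Proof.
intros hp hf hK h. destruct (hardy_bound p f K) as [h1 h2].
{ intros r hr. now apply mean_le_iff, h. }
split; trivial. now split; [apply analytic_holo|].
Qed.

Lemma Hardy_mp_le p f r : 0 < p -> mem (Hardy p) f -> 0 <= r < 1 ->
  mp p f r <= rpow (nrm (Hardy p) f) p.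
Proof.
intros hp [hf hfin] hr. apply mean_le_iff; trivial. now apply hardy_norm_ge0. now apply hardy_mean_le.
Qed.

Lemma Hardy_norm_ge0 p f : mem (Hardy p) f -> 0 <= nrm (Hardy p) f.
Proof. intros [_ h]. now apply hardy_norm_ge0. Qed.

Lemma hardy_norm_ext p f g : (forall z, Cmod z < 1 -> f z = g z) -> hardy_norm p f = hardy_norm p g.
Proof.
intros h. apply Lub_Rbar_eqset. intros x.
assert (E : forall r, 0 <= r < 1 -> integral_mean p f r = integral_mean p g r).
{ intros r hr. rewrite !integral_mean_eq. f_equal. now apply mp_ext. }
split; intros [r [hr ->]]; exists r; split; trivial. now apply E. now rewrite E.
Qed.

Lemma holo_ext rho f g : (forall z, Cmod z < rho -> f z = g z) -> holo rho f -> holo rho g.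
Proof.
intros h hf z hz. destruct (hf z hz) as [l hl]. exists l.
apply (cder_ext_loc f g z l (rho - Cmod z)); trivial. lra.
intros w hw. exact (h w (near_lt rho z w hw)).
Qed.

Lemma Hardy_ext p f g : (forall z, Cmod z < 1 -> f z = g z) ->
  mem (Hardy p) f -> mem (Hardy p) g /\ nrm (Hardy p) g = nrm (Hardy p) f.
Proof.
intros h [hf hn]. simpl in *. rewrite <- (hardy_norm_ext p f g h). split; trivial. split; trivial.
apply analytic_holo. now apply (holo_ext 1 f), analytic_holo.
Qed.

Lemma holo_plus rho f g : holo rho f -> holo rho g -> holo rho (fun z => (f z + g z)%C).
Proof.
intros hf hg z hz. destruct (hf z hz) as [l hl]. destruct (hg z hz) as [m hm].
eexists. exact (cder_plus _ _ _ _ _ hl hm).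
Qed.

Lemma holo_minus rho f g : holo rho f -> holo rho g -> holo rho (fun z => (f z - g z)%C).
Proof.
intros hf hg z hz. destruct (hf z hz) as [l hl]. destruct (hg z hz) as [m hm].
eexists. exact (cder_minus _ _ _ _ _ hl hm).
Qed.

Lemma holo_mult rho f g : holo rho f -> holo rho g -> holo rho (fun z => (f z * g z)%C).
Proof.
intros hf hg z hz. destruct (hf z hz) as [l hl]. destruct (hg z hz) as [m hm].
eexists. exact (cder_mult _ _ _ _ _ hl hm).
Qed.

Lemma holo_div rho f g : holo rho f -> holo rho g -> (forall z, Cmod z < rho -> g z <> RtoC 0) ->
  holo rho (fun z => (f z / g z)%C).
Proof.
intros hf hg h z hz. destruct (hf z hz) as [l hl]. destruct (hg z hz) as [m hm].
eexists. exact (cder_div _ _ _ _ _ hl hm (h z hz)).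
Qed.

Lemma holo_const rho c : holo rho (fun _ => c).
Proof. intros z _. eexists. apply cder_const. Qed.

Lemma holo_id rho : holo rho (fun z => z).
Proof. intros z _. eexists. apply cder_id. Qed.

Lemma holo_pow rho n : holo rho (fun z => Cpow z n).
Proof. intros z _. eexists. apply cder_pow. Qed.

(** The inequality for c and the one for 1/c together give equality. *)
Lemma Hardy_scal p f c : 0 < p -> mem (Hardy p) f ->
  mem (Hardy p) (fun z => (c * f z)%C) /\ nrm (Hardy p) (fun z => (c * f z)%C) = Cmod c * nrm (Hardy p) f.
Proof.
intros hp hf.
assert (le : forall c f, mem (Hardy p) f ->
  mem (Hardy p) (fun z => (c * f z)%C) /\ nrm (Hardy p) (fun z => (c * f z)%C) <= Cmod c * nrm (Hardy p) f).
{ clear c f hf. intros c f hf. assert (hf' := proj1 hf). apply analytic_holo in hf'.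
  assert (hn := Hardy_norm_ge0 p f hf). assert (hc := Cmod_ge_0 c).
  apply Hardy_bound; trivial.
  - apply holo_mult; trivial. apply holo_const.
  - now apply Rmult_le_pos.
  - intros r hr. unfold mp.
    rewrite (avg_ext _ (fun th => rpow (Cmod c) p * rpow (Cmod (f (circ r th))) p)).
    2:{ intros th _. rewrite Cmod_mult, rpow_mult; trivial. apply Cmod_ge_0. }
    rewrite avg_scal by (now apply mp_tcont). rewrite rpow_mult by trivial.
    apply Rmult_le_compat_l. apply rpow_ge0. exact (Hardy_mp_le p f r hp hf hr). }
destruct (le c f hf) as [h1 h2]. split; trivial. apply Rle_antisym; trivial.
destruct (Ceq_dec c (RtoC 0)) as [->|n].
- rewrite Cmod_0, Rmult_0_l. now apply Hardy_norm_ge0.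
- destruct (le (/ c)%C _ h1) as [_ h3].
  destruct (Hardy_ext p (fun z => (/ c * (c * f z))%C) f) as [_ h4].
  { intros z _. field. trivial. }
  { apply (le (/ c)%C), h1. }
  rewrite <- h4 in h3. rewrite Cmod_inv in h3 by trivial.
  apply Cmod_gt_0 in n. apply Rmult_le_compat_l with (r := Cmod c) in h3; [|lra].
  rewrite <- Rmult_assoc, Rinv_r, Rmult_1_l in h3 by lra. trivial.
Qed.

Lemma Hardy_plus p f g : 1 <= p -> mem (Hardy p) f -> mem (Hardy p) g ->
  mem (Hardy p) (fun z => (f z + g z)%C) /\
  nrm (Hardy p) (fun z => (f z + g z)%C) <= nrm (Hardy p) f + nrm (Hardy p) g.
Proof.
intros hp hf hg. assert (hp0 : 0 < p) by lra.
assert (hf' := proj1 (analytic_holo f) (proj1 hf)). assert (hg' := proj1 (analytic_holo g) (proj1 hg)).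
assert (nf := Hardy_norm_ge0 p f hf). assert (ng := Hardy_norm_ge0 p g hg).
apply Hardy_bound; trivial; [now apply holo_plus | lra |].
intros r hr.
assert (cf : tcont (fun th => Cmod (f (circ r th)))) by (apply tcontC_mod, (holo_circ_cont 1); trivial; lra).
assert (cg : tcont (fun th => Cmod (g (circ r th)))) by (apply tcontC_mod, (holo_circ_cont 1); trivial; lra).
apply Rle_trans with (avg (fun th => rpow (Cmod (f (circ r th)) + Cmod (g (circ r th))) p)).
- apply avg_le.
  + exact (mp_tcont p (fun z => (f z + g z)%C) r hp0 (holo_plus 1 f g hf' hg') hr).
  + intros th hth. apply rcont_rpow; trivial. apply rcont_plus; auto.
  + intros th _. apply rpow_le; trivial. split. apply Cmod_ge_0. apply Cmod_triangle.
- apply Minkowski; trivial; try (intros; apply Cmod_ge_0).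
  exact (Hardy_mp_le p f r hp0 hf hr). exact (Hardy_mp_le p g r hp0 hg hr).
Qed.

Lemma Hardy_zero p : 0 < p -> mem (Hardy p) (fun _ => RtoC 0).
Proof.
intros hp. apply (Hardy_bound p _ 0); trivial. apply holo_const. lra.
intros r hr. unfold mp. rewrite rpow_0, Cmod_0, rpow_0, avg_const. lra.
Qed.

Lemma Hardy_minus p f g : 1 <= p -> mem (Hardy p) f -> mem (Hardy p) g ->
  mem (Hardy p) (fun z => (f z - g z)%C) /\
  nrm (Hardy p) (fun z => (f z - g z)%C) <= nrm (Hardy p) f + nrm (Hardy p) g.
Proof.
intros hp hf hg. assert (hp0 : 0 < p) by lra.
destruct (Hardy_scal p g (- RtoC 1)%C hp0 hg) as [h1 h2].
destruct (Hardy_plus p f _ hp hf h1) as [h3 h4].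
destruct (Hardy_ext p (fun z => (f z + (- RtoC 1) * g z)%C) (fun z => (f z - g z)%C)) as [h5 h6]; trivial.
{ intros z _. ring. }
split; trivial. rewrite h6. apply Rle_trans with (1 := h4). rewrite h2.
replace (Cmod (- RtoC 1)) with 1. lra. now rewrite Cmod_opp, Cmod_1.
Qed.

Lemma M1_le p f r : 1 <= p -> holo 1 f -> 0 <= r < 1 ->
  avg (fun th => Cmod (f (circ r th))) <= integral_mean p f r.
Proof.
intros hp hf hr. assert (hp0 : 0 < p) by lra. rewrite integral_mean_eq.
assert (cf : tcont (fun th => Cmod (f (circ r th)))) by (apply tcontC_mod, (holo_circ_cont 1); trivial; lra).
rewrite <- (rpow_root (avg _) p); trivial.
2:{ apply avg_ge0; trivial. intros; apply Cmod_ge_0. }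
apply rpow_le. now apply Rinv_0_lt_compat. split. apply rpow_ge0.
apply avg_Jensen1; trivial. intros; apply Cmod_ge_0.
Qed.

Lemma eval_bound p f z R0 : 1 <= p -> holo 1 f -> Cmod z < R0 -> R0 < 1 ->
  Cmod (f z) <= / (R0 - Cmod z) * integral_mean p f R0.
Proof.
intros hp hf hz hR. assert (kz := Cmod_ge_0 z).
assert (hr : 0 <= R0 < 1) by lra.
assert (cf : tcontC (fun th => f (circ R0 th))) by (apply (holo_circ_cont 1); trivial; lra).
assert (cu : tcontC (fun th => (f (circ R0 th) * circ R0 th)%C)).
{ intros th hth. apply ccont_mult; auto. apply circ_cont1. }
rewrite (Cauchy_formula 1 f R0 z) by trivial. unfold Kn.
assert (cK := Kn_cont R0 1 _ z hz cu).
apply Rle_trans with (1 := Cavg_mod _ cK).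
apply Rle_trans with (avg (fun th => / (R0 - Cmod z) * Cmod (f (circ R0 th)))).
- apply avg_le. now apply tcontC_mod.
  intros th hth. apply rcont_mult. apply continuous_const. now apply rcont_Cmod, cf.
  intros th _. assert (n := circ_neq R0 z th hz).
  rewrite Cpow_1_r, Cmod_div, Cmod_mult, circ_mod by (trivial; lra).
  assert (hd := circ_dist R0 z th hz).
  unfold Rdiv. rewrite Rmult_comm. apply Rmult_le_compat.
  apply Rlt_le, Rinv_0_lt_compat; lra.
  apply Rmult_le_pos. apply Cmod_ge_0. lra.
  apply Rinv_le_contravar; lra.
  assert (k := Cmod_ge_0 (f (circ R0 th))). nra.
- rewrite avg_scal by now apply tcontC_mod. apply Rmult_le_compat_l.
  apply Rlt_le, Rinv_0_lt_compat; lra. now apply M1_le.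
Qed.

(** Cauchy's formula on the circle halfway between |z| and 1. The bound is uniform on compact sets,
    so convergence in norm implies locally uniform convergence. *)
Lemma Hardy_eval p f z : 1 <= p -> mem (Hardy p) f -> Cmod z < 1 ->
  Cmod (f z) <= 2 / (1 - Cmod z) * nrm (Hardy p) f.
Proof.
intros hp hf hz. assert (kz := Cmod_ge_0 z).
assert (hf' := proj1 hf). apply analytic_holo in hf'.
apply Rle_trans with (1 := eval_bound p f z ((1 + Cmod z) / 2) hp hf' ltac:(lra) ltac:(lra)).
replace (/ ((1 + Cmod z) / 2 - Cmod z)) with (2 / (1 - Cmod z)) by (field; lra).
apply Rmult_le_compat_l. apply Rdiv_le_0_compat; lra.
apply hardy_mean_le. exact (proj2 hf). lra.
Qed.

(** * Locally uniform limits of analytic functions *)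

Definition lu_lim (u : nat -> C -> C) (f : C -> C) : Prop :=
  forall R0, R0 < 1 -> forall eps, 0 < eps -> exists N, forall n z, (N <= n)%nat -> Cmod z <= R0 ->
    Cmod (u n z - f z) < eps.

Lemma lu_lim_cts u f : (forall n, holo 1 (u n)) -> lu_lim u f -> ccball 1 f.
Proof.
intros hu hl z hz. apply ccont_eps. intros eps he.
destruct (hl ((1 + Cmod z) / 2) ltac:(lra) (eps / 3) ltac:(lra)) as [N hN].
destruct (proj1 (ccont_eps _ _) (holo_cts _ _ (hu N) z hz) (eps / 3) ltac:(lra)) as [d [hd Hd]].
exists (Rmin d ((1 - Cmod z) / 2)). split. apply Rmin_case; lra.
intros w hw.
assert (h1 := Hd w (Rlt_le_trans _ _ _ hw (Rmin_l _ _))). assert (h2 := Rlt_le_trans _ _ _ hw (Rmin_r _ _)).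
assert (hwz : Cmod w <= (1 + Cmod z) / 2).
{ replace w with (z + (w - z))%C by ring. apply Rle_trans with (1 := Cmod_triangle _ _). lra. }
assert (k1 := hN N w (le_n _) hwz). assert (k2 := hN N z (le_n _) ltac:(lra)).
replace (f w - f z)%C with (f w - u N w + (u N w - u N z) + (u N z - f z))%C by ring.
apply Rle_lt_trans with (1 := Cmod_triangle _ _). rewrite Cmod_sym in k1.
assert (k := Cmod_triangle (f w - u N w)%C (u N w - u N z)%C). lra.
Qed.

Lemma Cmod_small_0 z : (forall eps, 0 < eps -> Cmod z < eps) -> z = RtoC 0.
Proof.
intros h. apply Cmod_eq_0. destruct (Rle_lt_or_eq_dec 0 (Cmod z) (Cmod_ge_0 z)) as [k|k]; auto.
specialize (h _ k). lra.
Qed.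

(** Weierstrass's theorem: Cauchy's formula passes to the limit, so near a the limit is the
    Cauchy-type integral of its own continuous boundary values, and such an integral is
    differentiable. *)
Theorem lu_lim_holo u f : (forall n, holo 1 (u n)) -> lu_lim u f -> holo 1 f.
Proof.
intros hu hl a ha. assert (ka := Cmod_ge_0 a).
set (R0 := (1 + Cmod a) / 2). assert (h1 : Cmod a < R0) by (unfold R0; lra). assert (h2 : R0 < 1) by (unfold R0; lra).
assert (hc := lu_lim_cts u f hu hl).
set (v th := (f (circ R0 th) * circ R0 th)%C).
assert (cv : tcontC v).
{ intros th _. apply ccont_mult; [|apply circ_cont1]. apply (ccont_comp (circ R0)). apply circ_cont1.
  apply hc. rewrite circ_mod; lra. }
assert (cvn : forall n, tcontC (fun th => (u n (circ R0 th) * circ R0 th)%C)).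
{ intros n th hth. apply ccont_mult; [|apply circ_cont1]. apply (holo_circ_cont 1 (u n) R0); trivial; lra. }
exists (Kn R0 2 v a). apply (cder_ext_loc (Kn R0 1 v) f a _ (R0 - Cmod a)). lra.
2: now apply Kn_der1.
intros w hw.
assert (hwR := near_lt R0 a w hw).
apply Ceq_minus. apply Cmod_small_0. intros eps he.
set (K := 1 + R0 / (R0 - Cmod w)).
assert (hK1 : 0 <= R0 / (R0 - Cmod w)) by (apply Rdiv_le_0_compat; lra).
destruct (hl R0 h2 (eps / (2 * K)) ltac:(apply Rdiv_lt_0_compat; unfold K; lra)) as [N hN].
set (e := eps / (2 * K)) in *.
assert (he' : e * K = eps / 2) by (unfold e; field; unfold K; lra).
replace (Kn R0 1 v w - f w)%C with
  (Kn R0 1 v w - u N w + (u N w - f w))%C by ring.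
apply Rle_lt_trans with (1 := Cmod_triangle _ _).
assert (k1 := hN N w (le_n _) (Rlt_le _ _ hwR)).
rewrite (Cauchy_formula 1 (u N) R0 w) at 1 by trivial.
assert (k2 : Cmod (Kn R0 1 v w - Kn R0 1 (fun th => (u N (circ R0 th) * circ R0 th)%C) w) <= e * (R0 / (R0 - Cmod w))).
{ unfold Kn. assert (c1 := Kn_cont R0 1 v w hwR cv). assert (c2 := Kn_cont R0 1 _ w hwR (cvn N)).
  rewrite <- Cavg_minus by trivial. apply Cavg_bound.
  - intros th hth. apply ccont_minus; [now apply c1 | now apply c2].
  - intros th hth. assert (n := circ_neq R0 w th hwR). assert (hd := circ_dist R0 w th hwR).
    unfold v. rewrite !Cpow_1_r.
    match goal with |- Cmod ?X <= _ => replace X with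
      ((f (circ R0 th) - u N (circ R0 th)) * (circ R0 th / (circ R0 th - w)))%C by (field; trivial) end.
    rewrite Cmod_mult, Cmod_div, circ_mod by (trivial; lra).
    apply Rmult_le_compat; try apply Cmod_ge_0.
    apply Rdiv_le_0_compat; lra.
    rewrite Cmod_sym. apply Rlt_le, hN. trivial. rewrite circ_mod; lra.
    apply Rmult_le_compat_l. lra. apply Rinv_le_contravar; lra. }
unfold K in he'. nra.
Qed.

(** * Completeness of the Hardy spaces *)

Definition nrm_cauchy p (u : nat -> C -> C) := forall eps, 0 < eps -> exists N, forall n m, (N <= n)%nat -> (N <= m)%nat ->
  nrm (Hardy p) (fun z => (u n z - u m z)%C) < eps.

Lemma mp_le_sup p f g r K e : 1 <= p -> holo 1 f -> holo 1 g -> 0 <= r < 1 -> 0 <= K -> 0 <= e ->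
  mp p f r <= rpow K p -> (forall th, 0 <= th <= 2 * PI -> Cmod (g (circ r th) - f (circ r th)) <= e) ->
  mp p g r <= rpow (K + e) p.
Proof.
intros hp hf hg hr hK he hm hs. assert (hp0 : 0 < p) by lra.
assert (cf : tcont (fun th => Cmod (f (circ r th)))) by (apply tcontC_mod, (holo_circ_cont 1); trivial; lra).
apply Rle_trans with (avg (fun th => rpow (Cmod (f (circ r th)) + e) p)).
- apply avg_le.
  + exact (mp_tcont p g r hp0 hg hr).
  + intros th hth. apply rcont_rpow; trivial. apply rcont_plus; auto. apply continuous_const.
  + intros th hth. apply rpow_le; trivial. split. apply Cmod_ge_0.
    replace (g (circ r th)) with (f (circ r th) + (g (circ r th) - f (circ r th)))%C by ring.
    apply Rle_trans with (1 := Cmod_triangle _ _). specialize (hs th hth). lra.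
- apply (Minkowski (fun th => Cmod (f (circ r th))) (fun _ => e)); trivial.
  + intros th _. apply continuous_const.
  + intros; apply Cmod_ge_0.
  + rewrite avg_const. lra.
Qed.

Lemma mp_const_bound p f r e : 1 <= p -> holo 1 f -> 0 <= r < 1 -> 0 <= e ->
  (forall th, 0 <= th <= 2 * PI -> Cmod (f (circ r th)) <= e) -> mp p f r <= rpow e p.
Proof.
intros hp hf hr he hs. rewrite <- (avg_const (rpow e p)). apply avg_le.
- apply (mp_tcont p f r); trivial. lra.
- intros th _; apply continuous_const.
- intros th hth. apply rpow_le. lra. split. apply Cmod_ge_0. auto.
Qed.

(** Point evaluations produce a locally uniform limit f. On each circle u m is uniformly close to f
    for large m, so the Cauchy bound on u n - u m becomes one on u n - f, uniformly in the
    circle. *)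
Theorem Hardy_complete p u : 1 <= p -> (forall n, mem (Hardy p) (u n)) -> nrm_cauchy p u ->
  exists f, mem (Hardy p) f /\ is_lim_seq (fun n => nrm (Hardy p) (fun z => (u n z - f z)%C)) 0.
Proof.
intros hp hu hc. assert (hp0 : 0 < p) by lra.
assert (hh : forall n, holo 1 (u n)) by (intros n; apply analytic_holo, (hu n)).
assert (unif : forall R0, R0 < 1 -> forall eps, 0 < eps -> exists N, forall n m z, (N <= n)%nat -> (N <= m)%nat ->
  Cmod z <= R0 -> Cmod (u n z - u m z) < eps).
{ intros R0 hR eps he. destruct (hc (eps * ((1 - R0) / 2))) as [N hN].
  { apply Rmult_lt_0_compat; lra. }
  exists N. intros n m z hn hm hz. specialize (hN n m hn hm).
  destruct (Hardy_minus p (u n) (u m) hp (hu n) (hu m)) as [hmem _].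
  apply Rle_lt_trans with (1 := Hardy_eval p _ z hp hmem ltac:(lra)).
  apply Rle_lt_trans with (2 / (1 - R0) * nrm (Hardy p) (fun z => (u n z - u m z)%C)).
  - apply Rmult_le_compat_r. now apply Hardy_norm_ge0.
    apply Rmult_le_compat_l. lra. apply Rinv_le_contravar; lra.
  - apply Rmult_lt_reg_l with ((1 - R0) / 2). lra.
    rewrite <- Rmult_assoc. replace ((1 - R0) / 2 * (2 / (1 - R0))) with 1 by (field; lra). lra. }
assert (ptw : forall z, exists l, Cmod z < 1 -> forall eps, 0 < eps -> exists N, forall n, (N <= n)%nat -> Cmod (u n z - l) < eps).
{ intros z. destruct (Rlt_dec (Cmod z) 1) as [hz|hz].
  - destruct (C_cauchy (fun n => u n z)) as [l hl].
    { intros eps he. destruct (unif (Cmod z) hz eps he) as [N hN]. exists N. intros. apply hN; trivial. lra. }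
    now exists l.
  - now exists (RtoC 0). }
set (f z := proj1_sig (constructive_indefinite_description _ (ptw z))).
assert (hf : forall z, Cmod z < 1 -> forall eps, 0 < eps -> exists N, forall n, (N <= n)%nat -> Cmod (u n z - f z) < eps)
  by (intros z; exact (proj2_sig (constructive_indefinite_description _ (ptw z)))).
assert (lu : lu_lim u f).
{ intros R0 hR eps he. destruct (unif R0 hR (eps / 2) ltac:(lra)) as [N hN].
  exists N. intros n z hn hz. destruct (hf z ltac:(lra) (eps / 2) ltac:(lra)) as [N' hN'].
  set (m := max N N'). replace (u n z - f z)%C with (u n z - u m z + (u m z - f z))%C by ring.
  apply Rle_lt_trans with (1 := Cmod_triangle _ _).
  assert (k1 := hN n m z hn ltac:(unfold m; lia) hz). assert (k2 := hN' m ltac:(unfold m; lia)). lra. }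
assert (hfh : holo 1 f) by now apply (lu_lim_holo u).
assert (key : forall eps, 0 < eps -> exists N, forall n, (N <= n)%nat ->
  mem (Hardy p) (fun z => (u n z - f z)%C) /\ nrm (Hardy p) (fun z => (u n z - f z)%C) <= eps).
(* N depends on eps alone. The index m below depends on the circle as well, but it does not survive
   in the bound. *)
{ intros eps he. destruct (hc (eps / 2) ltac:(lra)) as [N hN]. exists N. intros n hn.
  apply Hardy_bound; [lra | now apply holo_minus | lra |].
  intros r hr. destruct (lu r (proj2 hr) (eps / 2) ltac:(lra)) as [N' hN'].
  set (m := max N N'). specialize (hN n m hn ltac:(unfold m; lia)).
  destruct (Hardy_minus p (u n) (u m) hp (hu n) (hu m)) as [hmem _].
  replace eps with (eps / 2 + eps / 2) by lra.
  apply (mp_le_sup p (fun z => (u n z - u m z)%C)); trivial; try lra; try now apply holo_minus.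
  - apply Rle_trans with (1 := Hardy_mp_le p _ r hp0 hmem hr). apply rpow_le; trivial.
    split. now apply Hardy_norm_ge0. lra.
  - intros th _. match goal with |- Cmod ?X <= _ => replace X with (u m (circ r th) - f (circ r th))%C by ring end.
    apply Rlt_le, hN'. unfold m; lia. rewrite circ_mod; lra. }
exists f. split.
- destruct (key 1 Rlt_0_1) as [N hN]. destruct (hN N (le_n _)) as [h1 _].
  destruct (Hardy_minus p _ _ hp (hu N) h1) as [h2 _].
  apply (Hardy_ext p (fun z => (u N z - (u N z - f z))%C) f); trivial. intros; ring.
- apply is_lim_seq_spec. intros eps. destruct (key (eps / 2)) as [N hN].
  { assert (k := cond_pos eps). lra. }
  exists N. intros n hn. destruct (hN n hn) as [h1 h2]. rewrite Rminus_0_r, Rabs_pos_eq by now apply Hardy_norm_ge0.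
  assert (k := cond_pos eps). lra.
Qed.

(** * The operators *)

Definition den (t : R) (z : C) : C := (1 - RtoC t * z)%C.

Lemma den_neq0 t z : 0 <= t <= 1 -> Cmod z < 1 -> den t z <> RtoC 0.
Proof.
intros ht hz e. apply Ceq_minus in e. apply (f_equal Cmod) in e.
rewrite Cmod_1, Cmod_mult, Cmod_R, Rabs_pos_eq in e by lra. assert (k := Cmod_ge_0 z). nra.
Qed.

Lemma den_holo rho t : holo rho (den t).
Proof. apply holo_minus. apply holo_const. apply holo_mult. apply holo_const. apply holo_id. Qed.

Lemma den_0 t : den t (RtoC 0) = RtoC 1.
Proof. unfold den. ring. Qed.

Definition prim (t : R) (f : C -> C) (z : C) : C := seg (fun xi => (f xi / den t xi)%C) (RtoC 0) z.

Lemma Cint0_seg h z : ccball 1 h -> Cmod z < 1 -> Cint0 h z = seg h (RtoC 0) z.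
Proof.
intros hc hz. unfold Cint0. rewrite CI_correct.
- apply CI_ext. lra. intros s hs. unfold seg_pt. f_equal. ring. f_equal. ring.
- lra.
- intros s hs. apply ccont_mult. apply continuous_const.
  apply (ccont_comp (fun s => (RtoC s * z)%C)). cont.
  apply hc. rewrite Cmod_mult, Cmod_R, Rabs_pos_eq by lra. assert (k := Cmod_ge_0 z). nra.
Qed.

Lemma quot_holo t f : 0 <= t <= 1 -> holo 1 f -> holo 1 (fun xi => (f xi / den t xi)%C).
Proof. intros ht hf. apply holo_div; trivial. apply den_holo. intros; now apply den_neq0. Qed.

Lemma prim_der t f z : 0 <= t <= 1 -> holo 1 f -> Cmod z < 1 -> cder (prim t f) z (f z / den t z)%C.
Proof.
intros ht hf hz. apply (holo_primitive 1 (fun xi => (f xi / den t xi)%C)); trivial.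
now apply quot_holo.
Qed.

Lemma prim_holo t f : 0 <= t <= 1 -> holo 1 f -> holo 1 (prim t f).
Proof. intros ht hf z hz. eexists. now apply prim_der. Qed.

Lemma prim_0 t f : prim t f (RtoC 0) = RtoC 0.
Proof.
unfold prim, seg. rewrite (CI_ext _ (fun _ => RtoC 0)). rewrite CI_const. ring. lra. intros; ring.
Qed.

Lemma C_op_nz t f z : 0 <= t <= 1 -> holo 1 f -> Cmod z < 1 -> z <> RtoC 0 ->
  C_op t f z = (prim t f z / z)%C.
Proof.
intros ht hf hz n. unfold C_op. destruct (Ceq_dec z (RtoC 0)) as [e|_]; [easy|].
f_equal. apply Cint0_seg; trivial.
exact (holo_cts 1 _ (quot_holo t f ht hf)).
Qed.

Lemma C_op_0 t f : C_op t f (RtoC 0) = f (RtoC 0).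
Proof. unfold C_op. now destruct (Ceq_dec (RtoC 0) (RtoC 0)). Qed.

Lemma C_op_prim t f z : 0 <= t <= 1 -> holo 1 f -> Cmod z < 1 -> prim t f z = (z * C_op t f z)%C.
Proof.
intros ht hf hz. destruct (Ceq_dec z (RtoC 0)) as [->|n].
- rewrite prim_0. ring.
- rewrite C_op_nz by trivial. field. trivial.
Qed.

(** The removable singularity at 0 needs no separate theory: subtracting Cauchy's formulas for F =
    [prim t f] at w and at 0 writes F(w) / w as a Cauchy-type integral, whose value at 0 is F'(0) =
    f(0), the value assigned by [C_op]. *)
Lemma C_op_holo t f : 0 <= t <= 1 -> holo 1 f -> holo 1 (C_op t f).
Proof.
intros ht hf a ha. set (F := prim t f). assert (hF : holo 1 F) by now apply prim_holo.
assert (ka := Cmod_ge_0 a).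
set (R0 := (1 + Cmod a) / 2). assert (h1 : Cmod a < R0) by (unfold R0; lra). assert (h2 : R0 < 1) by (unfold R0; lra).
set (u th := F (circ R0 th)).
assert (cu : tcontC u) by (apply (holo_circ_cont 1); trivial; lra).
assert (cv : tcontC (fun th => (u th * circ R0 th)%C)) by
  (intros th hth; apply ccont_mult; [now apply cu | apply circ_cont1]).
exists (Kn R0 2 u a). apply (cder_ext_loc (Kn R0 1 u) _ a _ (R0 - Cmod a)). lra.
2: now apply Kn_der1.
assert (h0 : Cmod (RtoC 0) < R0) by (rewrite Cmod_0; lra).
intros w hw.
assert (hwR := near_lt R0 a w hw).
destruct (Ceq_dec w (RtoC 0)) as [->|n].
- rewrite C_op_0.
  assert (E := C_derive_Cauchy 1 F R0 (RtoC 0) hF h0 h2).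
  rewrite (C_derive_eq F _ _ (prim_der t f (RtoC 0) ht hf ltac:(rewrite Cmod_0; lra))), den_0 in E.
  replace (f (RtoC 0) / 1)%C with (f (RtoC 0)) in E by field.
  rewrite E. apply Cavg_ext. intros th _. unfold u. simpl.
  assert (k := circ_neq R0 (RtoC 0) th h0). replace (circ R0 th - 0)%C with (circ R0 th) in * by ring. field. trivial.
- rewrite C_op_nz by (trivial; lra). fold F.
  assert (E := Cauchy_formula 1 F R0 w hF hwR h2). assert (E0 := Cauchy_formula 1 F R0 (RtoC 0) hF h0 h2).
  assert (F0 : F (RtoC 0) = RtoC 0) by apply prim_0.
  assert (c1 := Kn_cont R0 1 u w hwR cu).
  assert (c2 := Kn_cont R0 1 _ w hwR cv). assert (c3 := Kn_cont R0 1 _ _ h0 cv).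
  assert (D : (F w - F (RtoC 0))%C = (w * Kn R0 1 u w)%C).
  { rewrite E, E0. unfold Kn. rewrite <- Cavg_minus, <- Cavg_scal by trivial.
    apply Cavg_ext. intros th _. rewrite !Cpow_1_r. unfold u.
    assert (k := circ_neq R0 w th hwR). assert (k0 := circ_neq R0 (RtoC 0) th h0).
    replace (circ R0 th - 0)%C with (circ R0 th) in * by ring. field. split; trivial. }
  rewrite F0 in D. replace (F w - 0)%C with (F w) in D by ring. rewrite D. field. trivial.
Qed.

(** The solution f of (z h)' = f / (1 - tz), hence the inverse of C_t on H(D). *)
Definition C_inv (t : R) (h : C -> C) (z : C) : C :=
  (den t z * (h z + z * C_derive h z))%C.

Lemma C_inv_holo t h : holo 1 h -> holo 1 (C_inv t h).
Proof.
intros hh. apply holo_mult. apply den_holo. apply holo_plus; trivial. apply holo_mult. apply holo_id.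
now apply holo_derive.
Qed.

Lemma prim_FTC t f F : 0 <= t <= 1 -> holo 1 f ->
  (forall z, Cmod z < 1 -> cder F z (f z / den t z)%C) -> F (RtoC 0) = RtoC 0 ->
  forall z, Cmod z < 1 -> prim t f z = F z.
Proof.
intros ht hf hF h0 z hz. unfold prim. rewrite (seg_FTC 1 F); trivial.
rewrite h0. ring. exact (holo_cts 1 _ (quot_holo t f ht hf)). rewrite Cmod_0. lra.
Qed.

(** C_t f is characterized by the derivative of z C_t f; linearity and the inversion formula are
    checked through this. The value at 0 is read off by differentiating z h there. *)
Lemma C_op_FTC t f h : 0 <= t <= 1 -> holo 1 f -> holo 1 h ->
  (forall z, Cmod z < 1 -> cder (fun z => (z * h z)%C) z (f z / den t z)%C) ->
  forall z, Cmod z < 1 -> C_op t f z = h z.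
Proof.
intros ht hf hh hF z hz.
destruct (Ceq_dec z (RtoC 0)) as [->|n].
- rewrite C_op_0. destruct (hh (RtoC 0) hz) as [l hl].
  assert (E := cder_unique _ _ _ _ (hF _ hz) (cder_mult _ _ _ _ _ (cder_id _) hl)).
  rewrite den_0 in E. replace (f (RtoC 0)) with (f (RtoC 0) / 1)%C by field. rewrite E. ring.
- rewrite C_op_nz by trivial. rewrite (prim_FTC t f (fun z => (z * h z)%C)); trivial. field. trivial. ring.
Qed.

Lemma C_op_inv t h : 0 <= t <= 1 -> holo 1 h -> forall z, Cmod z < 1 -> C_op t (C_inv t h) z = h z.
Proof.
intros ht hh. apply C_op_FTC; trivial. now apply C_inv_holo.
intros z hz.
apply (cder_eq _ _ _ _ (cder_mult _ _ _ _ _ (cder_id z) (holo_cder 1 h z hh hz))).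
unfold C_inv. assert (n := den_neq0 t z ht hz). field. trivial.
Qed.

Lemma C_op_plus t f g z : 0 <= t <= 1 -> holo 1 f -> holo 1 g -> Cmod z < 1 ->
  C_op t (fun z => (f z + g z)%C) z = (C_op t f z + C_op t g z)%C.
Proof.
intros ht hf hg. apply (C_op_FTC t _ (fun z => (C_op t f z + C_op t g z)%C)); trivial.
now apply holo_plus. apply holo_plus; now apply C_op_holo.
clear z. intros z hz. assert (n := den_neq0 t z ht hz).
apply (cder_ext_loc (fun z => (prim t f z + prim t g z)%C) _ _ _ (1 - Cmod z)). lra.
- intros w hw. assert (hw1 := near_lt 1 z w hw). rewrite !C_op_prim by trivial. ring.
- apply (cder_eq _ _ _ _ (cder_plus _ _ _ _ _ (prim_der t f z ht hf hz) (prim_der t g z ht hg hz))). field. trivial.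
Qed.

Lemma C_op_scal t c f z : 0 <= t <= 1 -> holo 1 f -> Cmod z < 1 ->
  C_op t (fun z => (c * f z)%C) z = (c * C_op t f z)%C.
Proof.
intros ht hf. apply (C_op_FTC t _ (fun z => (c * C_op t f z)%C)); trivial.
apply holo_mult; trivial. apply holo_const. apply holo_mult. apply holo_const. now apply C_op_holo.
clear z. intros z hz. assert (n := den_neq0 t z ht hz).
apply (cder_ext_loc (fun z => (c * prim t f z)%C) _ _ _ (1 - Cmod z)). lra.
- intros w hw. assert (hw1 := near_lt 1 z w hw). rewrite !C_op_prim by trivial. ring.
- apply (cder_eq _ _ _ _ (cder_scal c _ _ _ (prim_der t f z ht hf hz))). field. trivial.
Qed.

Lemma C_op_inj t f : 0 <= t <= 1 -> holo 1 f -> (forall z, Cmod z < 1 -> C_op t f z = RtoC 0) ->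
  forall z, Cmod z < 1 -> f z = RtoC 0.
Proof.
intros ht hf h0 z hz. assert (n := den_neq0 t z ht hz).
assert (E : (f z / den t z)%C = RtoC 0).
{ apply (cder_unique (prim t f) z). now apply prim_der.
  apply (cder_ext_loc (fun _ => RtoC 0) _ _ _ (1 - Cmod z)). lra. 2: apply cder_const.
  intros w hw. assert (hw1 := near_lt 1 z w hw).
  rewrite C_op_prim, h0 by trivial. ring. }
replace (f z) with (f z / den t z * den t z)%C by (field; trivial). rewrite E. ring.
Qed.

(** * The logarithm as a primitive, and the Volterra operator *)

(** In the right half-plane cos(arg) > 0 confines the argument to (-pi/2, pi/2), where arctan
    recovers it. The right-hand side can be differentiated along a path. *)
Lemma Carg_atan z : 0 < Re z -> Carg z = atan (Im z / Re z).
Proof.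
intros hr. assert (hz : z <> RtoC 0) by (intros ->; simpl in hr; lra).
assert (hm := proj1 (Cmod_gt_0 z) hz).
destruct (Carg_spec z hz) as [hb [hc hs]].
assert (hcp : 0 < cos (Carg z)) by nra.
assert (h2 : - (PI / 2) < Carg z < PI / 2).
{ split; apply Rnot_le_lt; intros k.
  - assert (q := cos_le_0 (- Carg z) ltac:(lra) ltac:(lra)). rewrite cos_neg in q. lra.
  - assert (q := cos_le_0 (Carg z) k ltac:(lra)). lra. }
rewrite <- (atan_tan (Carg z)) by lra. f_equal. unfold tan. rewrite hc, hs. field. lra.
Qed.

(** Along the segment s z the point 1 - t s z stays in the right half-plane, so its logarithm is the
    explicit path [L], with derivative -tz / (1 - t s z). Integrate from s = 0, where [L] vanishes,
    to s = 1. *)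
Lemma CLog_den t z : 0 <= t <= 1 -> Cmod z < 1 ->
  CLog (den t z) = (- (RtoC t * prim t (fun _ => RtoC 1) z))%C.
Proof.
intros ht hz. set (x s := 1 - t * s * Re z). set (y s := - (t * s * Im z)).
assert (hden : forall s, den t (RtoC s * z)%C = (x s, y s)).
{ intros s. unfold den, x, y, Cminus, Cplus, Copp, Cmult, RtoC, Re, Im; simpl. f_equal; ring. }
assert (hx : forall s, 0 <= s <= 1 -> 0 < x s).
{ intros s hs. unfold x. assert (k := re_le_Cmod z). assert (k1 := Rle_abs (Re z)). assert (k2 := Cmod_ge_0 z).
  assert (t * s <= 1) by nra. assert (0 <= t * s) by nra.
  assert (t * s * Re z <= t * s * Cmod z) by (apply Rmult_le_compat_l; lra). nra. }
set (L s := (/ 2 * ln (x s * x s + y s * y s), atan (y s / x s)) : C).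
assert (hL : forall s, 0 <= s <= 1 -> CLog (den t (RtoC s * z)%C) = L s).
{ intros s hs. rewrite hden. unfold CLog, L. f_equal.
  - unfold Cmod; simpl. replace (x s * (x s * 1) + y s * (y s * 1)) with (x s * x s + y s * y s) by ring.
    assert (q : 0 < x s * x s + y s * y s) by (assert (k := hx s hs); nra).
    rewrite <- (sqrt_sqrt (x s * x s + y s * y s)) at 2 by lra.
    rewrite ln_mult by (now apply sqrt_lt_R0). field.
  - apply Carg_atan. now apply hx. }
replace z with (1 * z)%C at 1 by ring. rewrite hL by lra.
assert (L0 : L 0 = RtoC 0).
{ unfold L, x, y. rewrite !Rmult_0_r, !Rmult_0_l, Ropp_0, Rminus_0_r. unfold Rdiv. rewrite !Rmult_0_l, atan_0.
  replace (1 * 1 + 0) with 1 by ring. rewrite ln_1. unfold RtoC. f_equal. ring. }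
assert (hc : ccball 1 (fun xi => (1 / den t xi)%C)) by exact (holo_cts 1 _ (quot_holo t _ ht (holo_const 1 (RtoC 1)))).
assert (hi := seg_icont 1 _ (RtoC 0) z hc ltac:(rewrite Cmod_0; lra) hz).
unfold prim, seg.
transitivity (L 1 - L 0)%C. { rewrite L0. ring. }
replace (- (RtoC t * CI (fun s => ((z - 0) * (1 / den t (seg_pt (RtoC 0) z s)))%C) 0 1))%C
  with ((- RtoC t) * CI (fun s => ((z - 0) * (1 / den t (seg_pt (RtoC 0) z s)))%C) 0 1)%C by ring.
rewrite <- CI_scal by (trivial; lra).
symmetry. apply CI_FTC. lra.
2:{ intros s hs. apply ccont_mult. apply continuous_const. now apply hi. }
intros s hs. replace (seg_pt (RtoC 0) z s) with (RtoC s * z)%C by (unfold seg_pt; ring).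
rewrite hden. assert (q := hx s hs).
assert (q2 : 0 < x s * x s + y s * y s) by nra.
set (a := Re z) in *. set (b := Im z) in *.
assert (El : ((- RtoC t) * ((z - 0) * (1 / (x s, y s))))%C =
  (- t * (a * x s + b * y s) / (x s * x s + y s * y s), - t * (b * x s - a * y s) / (x s * x s + y s * y s))).
{ destruct z as [z1 z2]. unfold a, b. apply injective_projections; simpl; field; lra. }
rewrite El. split; simpl; unfold x, y in *.
- auto_derive. lra. field. lra.
- auto_derive. lra. field. split; lra.
Qed.

(** For t > 0, g_t coincides on D with a primitive of 1 / (1 - tz) by [CLog_den], so the complex
    derivative of the logarithm itself is never computed. *)
Lemma g_derive t z : 0 <= t <= 1 -> Cmod z < 1 -> C_derive (g t) z = (1 / den t z)%C.
Proof.
intros ht hz. apply C_derive_eq. unfold g. destruct (Req_dec_T t 0) as [->|n].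
- apply (cder_eq _ _ _ _ (cder_id z)).
  replace (den 0 z) with (RtoC 1) by (unfold den; ring). field.
- assert (n' : RtoC t <> RtoC 0) by (intros e; apply RtoC_inj in e; contradiction).
  apply (cder_ext_loc (prim t (fun _ => RtoC 1)) _ _ _ (1 - Cmod z)). lra.
  + intros w hw. assert (hw1 := near_lt 1 z w hw).
    fold (den t w). rewrite CLog_den by trivial. field. trivial.
  + apply prim_der; trivial. apply holo_const.
Qed.

Lemma V_op_prim t f z : 0 <= t <= 1 -> holo 1 f -> Cmod z < 1 -> V_op (g t) f z = prim t f z.
Proof.
intros ht hf hz. unfold prim. rewrite <- Cint0_seg; trivial.
2: exact (holo_cts 1 _ (quot_holo t f ht hf)).
unfold V_op, Cint0. apply (RInt_ext (V := C_R_CompleteNormedModule)). intros s hs.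
rewrite Rmin_left, Rmax_right in hs by lra. f_equal.
rewrite g_derive; trivial. unfold Cdiv. ring.
rewrite Cmod_mult, Cmod_R, Rabs_pos_eq by lra. assert (k := Cmod_ge_0 z). nra.
Qed.

Lemma V_op_C_op t f z : 0 <= t <= 1 -> holo 1 f -> Cmod z < 1 -> V_op (g t) f z = (z * C_op t f z)%C.
Proof. intros. rewrite V_op_prim, C_op_prim; trivial. Qed.

Lemma C_op_zero t z : 0 <= t <= 1 -> Cmod z < 1 -> C_op t (fun _ => RtoC 0) z = RtoC 0.
Proof.
intros ht. apply (C_op_FTC t _ (fun _ => RtoC 0)); trivial; try apply holo_const.
clear z. intros z hz. assert (n := den_neq0 t z ht hz).
apply (cder_eq _ _ _ _ (cder_mult _ _ _ _ _ (cder_id z) (cder_const (RtoC 0) z))). field. trivial.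
Qed.

Lemma C_op_minus t f g z : 0 <= t <= 1 -> holo 1 f -> holo 1 g -> Cmod z < 1 ->
  C_op t (fun z => (f z - g z)%C) z = (C_op t f z - C_op t g z)%C.
Proof.
intros ht hf hg. apply (C_op_FTC t _ (fun z => (C_op t f z - C_op t g z)%C)); trivial.
now apply holo_minus. apply holo_minus; now apply C_op_holo.
clear z. intros z hz. assert (n := den_neq0 t z ht hz).
apply (cder_ext_loc (fun z => (prim t f z - prim t g z)%C) _ _ _ (1 - Cmod z)). lra.
- intros w hw. assert (hw1 := near_lt 1 z w hw). rewrite !C_op_prim by trivial. ring.
- apply (cder_eq _ _ _ _ (cder_minus _ _ _ _ _ (prim_der t f z ht hf hz) (prim_der t g z ht hg hz))). field. trivial.
Qed.

Lemma Hardy_linear p : 1 <= p -> linear_subspace (mem (Hardy p)).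
Proof.
intros hp. assert (hp0 : 0 < p) by lra. repeat split.
- now intros f [h _].
- apply analytic_holo, holo_const.
- apply (Hardy_zero p hp0).
- apply (Hardy_plus p f g hp H H0).
- apply (Hardy_plus p f g hp H H0).
- apply (Hardy_scal p f c hp0 H).
- apply (Hardy_scal p f c hp0 H).
Qed.

Lemma dom_holo T p f : mem (opt_dom T (Hardy p)) f -> holo 1 f.
Proof. intros [h _]. now apply analytic_holo. Qed.

(** Linearity on D for analytic arguments, the setting in which both operators have it; Hardy norms
    do not see values outside D. It lets the optimal domains of V and C be handled together. *)
Definition lin_op (T : (C -> C) -> C -> C) : Prop :=
  (forall z, Cmod z < 1 -> T (fun _ => RtoC 0) z = RtoC 0) /\
  (forall f g, holo 1 f -> holo 1 g -> forall z, Cmod z < 1 ->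
     T (fun z => (f z + g z)%C) z = (T f z + T g z)%C) /\
  (forall c f, holo 1 f -> forall z, Cmod z < 1 -> T (fun z => (c * f z)%C) z = (c * T f z)%C) /\
  (forall f g, holo 1 f -> holo 1 g -> forall z, Cmod z < 1 ->
     T (fun z => (f z - g z)%C) z = (T f z - T g z)%C).

Lemma dom_plus T p f g : lin_op T -> 1 <= p -> mem (opt_dom T (Hardy p)) f -> mem (opt_dom T (Hardy p)) g ->
  mem (opt_dom T (Hardy p)) (fun z => (f z + g z)%C) /\
  nrm (opt_dom T (Hardy p)) (fun z => (f z + g z)%C) <= nrm (opt_dom T (Hardy p)) f + nrm (opt_dom T (Hardy p)) g.
Proof.
intros [_ [hT _]] hp hf hg. assert (hf' := dom_holo _ _ _ hf). assert (hg' := dom_holo _ _ _ hg).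
destruct hf as [_ hf], hg as [_ hg].
destruct (Hardy_plus p _ _ hp hf hg) as [h1 h2].
destruct (Hardy_ext p (fun z => (T f z + T g z)%C) (T (fun z => (f z + g z)%C))) as [h3 h4]; trivial.
{ intros; symmetry; now apply hT. }
split. split; trivial. now apply analytic_holo, holo_plus.
change (nrm (Hardy p) (T (fun z => (f z + g z)%C)) <= nrm (Hardy p) (T f) + nrm (Hardy p) (T g)).
now rewrite h4.
Qed.

Lemma dom_minus T p f g : lin_op T -> 1 <= p -> mem (opt_dom T (Hardy p)) f -> mem (opt_dom T (Hardy p)) g ->
  mem (opt_dom T (Hardy p)) (fun z => (f z - g z)%C) /\
  nrm (opt_dom T (Hardy p)) (fun z => (f z - g z)%C) = nrm (Hardy p) (fun z => (T f z - T g z)%C).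
Proof.
intros [_ [_ [_ hT]]] hp hf hg. assert (hf' := dom_holo _ _ _ hf). assert (hg' := dom_holo _ _ _ hg).
destruct hf as [_ hf], hg as [_ hg].
destruct (Hardy_minus p _ _ hp hf hg) as [h1 _].
destruct (Hardy_ext p (fun z => (T f z - T g z)%C) (T (fun z => (f z - g z)%C))) as [h3 h4]; trivial.
{ intros; symmetry; now apply hT. }
split; [split|]; trivial. now apply analytic_holo, holo_minus.
Qed.

Lemma dom_scal T p c f : lin_op T -> 1 <= p -> mem (opt_dom T (Hardy p)) f ->
  mem (opt_dom T (Hardy p)) (fun z => (c * f z)%C) /\
  nrm (opt_dom T (Hardy p)) (fun z => (c * f z)%C) = Cmod c * nrm (opt_dom T (Hardy p)) f.
Proof.
intros [_ [_ [hT _]]] hp hf. assert (hf' := dom_holo _ _ _ hf).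
destruct hf as [_ hf].
destruct (Hardy_scal p (T f) c ltac:(lra) hf) as [h1 h2].
destruct (Hardy_ext p (fun z => (c * T f z)%C) (T (fun z => (c * f z)%C))) as [h3 h4]; trivial.
{ intros; symmetry; now apply hT. }
split. split; trivial. apply analytic_holo, holo_mult; trivial. apply holo_const.
change (nrm (Hardy p) (T (fun z => (c * f z)%C)) = Cmod c * nrm (Hardy p) (T f)).
now rewrite h4.
Qed.

Lemma dom_linear T p : lin_op T -> 1 <= p -> linear_subspace (mem (opt_dom T (Hardy p))).
Proof.
intros hT hp. split; [|split; [|split]].
- now intros f [h _].
- split. apply analytic_holo, holo_const.
  apply (Hardy_ext p (fun _ => RtoC 0)). intros z hz; symmetry; now apply hT. apply Hardy_zero; lra.
- intros f g hf hg. now apply dom_plus.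
- intros c f hf. now apply dom_scal.
Qed.

Lemma C_op_lin t : 0 <= t <= 1 -> lin_op (C_op t).
Proof.
intros ht. repeat split; intros.
now apply C_op_zero. now apply C_op_plus. now apply C_op_scal. now apply C_op_minus.
Qed.

Lemma V_op_lin t : 0 <= t <= 1 -> lin_op (V_op (g t)).
Proof.
intros ht. split; [|split; [|split]].
- intros z hz. rewrite (V_op_C_op t _ z ht (holo_const 1 (RtoC 0)) hz), C_op_zero by trivial. ring.
- intros f g0 hf hg z hz. rewrite (V_op_C_op t _ z ht (holo_plus 1 f g0 hf hg) hz).
  rewrite !V_op_C_op, C_op_plus by trivial. ring.
- intros c f hf z hz. rewrite (V_op_C_op t _ z ht (holo_mult 1 _ f (holo_const 1 c) hf) hz).
  rewrite V_op_C_op, C_op_scal by trivial. ring.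
- intros f g0 hf hg z hz. rewrite (V_op_C_op t _ z ht (holo_minus 1 f g0 hf hg) hz).
  rewrite !V_op_C_op, C_op_minus by trivial. ring.
Qed.

Lemma Hardy_norm0 p f : 1 <= p -> mem (Hardy p) f -> nrm (Hardy p) f = 0 -> forall z, Cmod z < 1 -> f z = RtoC 0.
Proof.
intros hp hf h0 z hz. apply Cmod_eq_0. apply Rle_antisym; [|apply Cmod_ge_0].
assert (k := Hardy_eval p f z hp hf hz). rewrite h0, Rmult_0_r in k. trivial.
Qed.

(** C_t is injective on H(D) with right inverse [C_inv t], so it carries the optimal domain
    isometrically onto H^p: definiteness and completeness are pulled back from there. *)
Lemma C_banach t p : 0 <= t <= 1 -> 1 <= p -> is_banach (opt_dom (C_op t) (Hardy p)).
Proof.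
intros ht hp. assert (hT := C_op_lin t ht). split; [|split].
- now apply dom_linear.
- split; [|split].
  + intros f g hf hg. now apply dom_plus.
  + intros c f hf. now apply dom_scal.
  + intros f hf h0. apply (C_op_inj t f ht (dom_holo _ _ _ hf)).
    apply (Hardy_norm0 p); trivial. exact (proj2 hf).
- intros u hu hc.
  assert (hh : forall n, holo 1 (u n)) by (intros n; exact (dom_holo _ _ _ (hu n))).
  destruct (Hardy_complete p (fun n => C_op t (u n)) hp (fun n => proj2 (hu n))) as [h [hm hl]].
  { intros eps he. destruct (hc eps he) as [N hN]. exists N. intros n m hn hm.
    rewrite <- (proj2 (dom_minus (C_op t) p (u n) (u m) hT hp (hu n) (hu m))). now apply hN. }
  assert (hhh : holo 1 h) by (apply analytic_holo, hm).
  assert (hf : mem (opt_dom (C_op t) (Hardy p)) (C_inv t h)).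
  { split. now apply analytic_holo, C_inv_holo. apply (Hardy_ext p h); trivial.
    intros; symmetry; now apply C_op_inv. }
  exists (C_inv t h). split; trivial.
  apply (is_lim_seq_ext (fun n => nrm (Hardy p) (fun z => (C_op t (u n) z - h z)%C))); trivial.
  intros n. rewrite (proj2 (dom_minus (C_op t) p (u n) _ hT hp (hu n) hf)).
  apply (f_equal real). apply hardy_norm_ext. intros z hz. now rewrite C_op_inv.
Qed.

(** * Multiplication and division by z in the Hardy space *)

Lemma mp_shift p h r : 0 < p -> holo 1 h -> 0 <= r < 1 ->
  mp p (fun z => (z * h z)%C) r = rpow r p * mp p h r.
Proof.
intros hp hh hr. unfold mp. rewrite <- avg_scal by exact (mp_tcont p h r hp hh hr).
apply avg_ext. intros th _. rewrite Cmod_mult, circ_mod, rpow_mult; trivial; try lra. apply Cmod_ge_0.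
Qed.

Lemma Hardy_shift p h : 1 <= p -> mem (Hardy p) h ->
  mem (Hardy p) (fun z => (z * h z)%C) /\ nrm (Hardy p) (fun z => (z * h z)%C) <= nrm (Hardy p) h.
Proof.
intros hp hh. assert (hh' := proj1 (analytic_holo h) (proj1 hh)).
assert (hp0 : 0 < p) by lra.
apply Hardy_bound; trivial. apply holo_mult; trivial. apply holo_id. now apply Hardy_norm_ge0.
intros r hr. rewrite mp_shift by trivial.
apply Rle_trans with (2 := Hardy_mp_le p h r hp0 hh hr).
assert (k := mp_ge0 p h r hp0 hh' hr).
assert (rpow r p <= 1). { rewrite <- (rpow_1_l p). apply rpow_le; lra. }
nra.
Qed.

(** On circles of radius at least 1/2, dividing by z costs at most a factor 2. On smaller ones
    Cauchy's formula from the circle of radius 3/4 bounds h pointwise by 4 times its mean there,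
    hence by 8 K. *)
Lemma Hardy_unshift p h : 1 <= p -> holo 1 h -> mem (Hardy p) (fun z => (z * h z)%C) ->
  mem (Hardy p) h /\ nrm (Hardy p) h <= 8 * nrm (Hardy p) (fun z => (z * h z)%C).
Proof.
intros hp hh hm. assert (hp0 : 0 < p) by lra.
assert (K0 := Hardy_norm_ge0 p _ hm). set (K := nrm (Hardy p) (fun z => (z * h z)%C)) in *.
assert (big : forall r, / 2 <= r < 1 -> mp p h r <= rpow (2 * K) p).
{ intros r hr. assert (k := Hardy_mp_le p _ r hp0 hm ltac:(lra)).
  rewrite mp_shift in k by (trivial; lra). fold K in k.
  assert (hr0 : 0 < rpow r p) by (apply rpow_gt0; lra).
  replace K with (r * (K / r)) in k by (field; lra).
  rewrite rpow_mult in k by (try lra; apply Rdiv_le_0_compat; lra).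
  apply Rmult_le_reg_l in k; trivial.
  apply Rle_trans with (1 := k). apply rpow_le; trivial. split. apply Rdiv_le_0_compat; lra.
  apply Rmult_le_reg_r with r. lra. unfold Rdiv. rewrite Rmult_assoc, Rinv_l by lra. nra. }
apply Hardy_bound; trivial. lra.
intros r hr. destruct (Rle_dec (/ 2) r) as [h1|h1].
- apply Rle_trans with (1 := big r (conj h1 (proj2 hr))). apply rpow_le; lra.
- apply (mp_const_bound p h r (8 * K)); trivial. lra.
  intros th _.
  apply Rle_trans with (1 := eval_bound p h (circ r th) (3 / 4) hp hh ltac:(rewrite circ_mod; lra) ltac:(lra)).
  assert (hi : integral_mean p h (3 / 4) <= 2 * K).
  { apply mean_le_iff; trivial; try lra. apply big. lra. }
  assert (h0 := integral_mean_ge0 p h (3 / 4)).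
  rewrite circ_mod by lra.
  apply Rle_trans with (4 * (2 * K)); [|lra].
  apply Rmult_le_compat; trivial. apply Rlt_le, Rinv_0_lt_compat; lra.
  replace 4 with (/ (/ 4)) by field. apply Rinv_le_contravar; lra.
Qed.

Lemma V_C_equiv t p f : 0 <= t <= 1 -> 1 <= p ->
  (mem (opt_dom (V_op (g t)) (Hardy p)) f <-> mem (opt_dom (C_op t) (Hardy p)) f) /\
  (mem (opt_dom (V_op (g t)) (Hardy p)) f ->
    nrm (opt_dom (V_op (g t)) (Hardy p)) f <= nrm (opt_dom (C_op t) (Hardy p)) f <=
    8 * nrm (opt_dom (V_op (g t)) (Hardy p)) f).
Proof.
intros ht hp.
assert (VC : mem (opt_dom (V_op (g t)) (Hardy p)) f -> mem (opt_dom (C_op t) (Hardy p)) f /\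
  nrm (opt_dom (C_op t) (Hardy p)) f <= 8 * nrm (opt_dom (V_op (g t)) (Hardy p)) f).
{ intros hf. assert (hh := dom_holo _ _ _ hf). destruct hf as [ha hf].
  destruct (Hardy_ext p _ (fun z => (z * C_op t f z)%C) (fun z hz => V_op_C_op t f z ht hh hz) hf) as [h1 h2].
  destruct (Hardy_unshift p _ hp (C_op_holo t f ht hh) h1) as [h3 h4].
  split. now split. rewrite h2 in h4. exact h4. }
assert (CV : mem (opt_dom (C_op t) (Hardy p)) f -> mem (opt_dom (V_op (g t)) (Hardy p)) f /\
  nrm (opt_dom (V_op (g t)) (Hardy p)) f <= nrm (opt_dom (C_op t) (Hardy p)) f).
{ intros hf. assert (hh := dom_holo _ _ _ hf). destruct hf as [ha hf].
  destruct (Hardy_shift p _ hp hf) as [h1 h2].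
  destruct (Hardy_ext p (fun z => (z * C_op t f z)%C) (V_op (g t) f) (fun z hz => eq_sym (V_op_C_op t f z ht hh hz)) h1) as [h3 h4].
  split. now split. rewrite <- h4 in h2. exact h2. }
split; [split; intros h; [apply VC | apply CV]; trivial |].
intros h. destruct (VC h) as [h1 h2]. destruct (CV h1) as [h3 h4]. split; trivial.
Qed.

(** The constants 1 and 8 come from [Hardy_shift] and [Hardy_unshift]. Definiteness and completeness
    are known for C_t and transported along these bounds. *)
Theorem optimal_domains_equal p t : 1 <= p -> 0 <= t <= 1 ->
  equal_as_banach (opt_dom (V_op (g t)) (Hardy p)) (opt_dom (C_op t) (Hardy p)).
Proof.
intros hp ht. assert (hV := V_op_lin t ht). assert (hC := C_op_lin t ht).
assert (iff := fun f => proj1 (V_C_equiv t p f ht hp)).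
assert (bd := fun f => proj2 (V_C_equiv t p f ht hp)).
destruct (C_banach t p ht hp) as [Cl [Cn Cc]].
set (X := opt_dom (V_op (g t)) (Hardy p)) in *. set (Y := opt_dom (C_op t) (Hardy p)) in *.
split; [|split; [|split]].
- split; [|split].
  + exact (dom_linear _ p hV hp).
  + split; [|split].
    * intros f g0 hf hg. exact (proj2 (dom_plus _ p f g0 hV hp hf hg)).
    * intros c f hf. exact (proj2 (dom_scal _ p c f hV hp hf)).
    * intros f hf h0. apply (proj2 (proj2 Cn) f (proj1 (iff f) hf)).
      destruct (bd f hf) as [h1 h2]. rewrite h0 in h1, h2. lra.
  + intros u hu hc. destruct (Cc u) as [f [hf hl]].
    * intros n. exact (proj1 (iff (u n)) (hu n)).
    * intros eps he. destruct (hc (eps / 8) ltac:(lra)) as [N hN]. exists N. intros n m hn hm.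
      specialize (hN n m hn hm).
      destruct (dom_minus _ p (u n) (u m) hV hp (hu n) (hu m)) as [h1 _].
      destruct (bd _ h1) as [_ h2]. lra.
    * exists f. assert (hf' : mem X f) by exact (proj2 (iff f) hf). split; trivial.
      apply (is_lim_seq_le_le (fun _ => 0) _ (fun n => nrm Y (fun z => (u n z - f z)%C))); trivial.
      2: apply is_lim_seq_const.
      intros n. destruct (dom_minus _ p (u n) f hV hp (hu n) hf') as [h1 _].
      split. exact (Hardy_norm_ge0 p _ (proj2 h1)). exact (proj1 (bd _ h1)).
- exact (conj Cl (conj Cn Cc)).
- exact iff.
- exists 1, 8. split; [lra|]. split; [lra|]. intros f hf. rewrite Rmult_1_l. exact (bd f hf).
Qed.

(** * Functions of H^1 for t < 1 *)

Lemma mp_1 f r : mp 1 f r = avg (fun th => Cmod (f (circ r th))).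
Proof. apply avg_ext. intros th _. apply rpow_1_r, Cmod_ge_0. Qed.

Lemma Hardy_M1_le p f r : 1 <= p -> mem (Hardy p) f -> 0 <= r < 1 ->
  avg (fun th => Cmod (f (circ r th))) <= nrm (Hardy p) f.
Proof.
intros hp hf hr. apply Rle_trans with (integral_mean p f r).
apply M1_le; trivial. apply analytic_holo, hf.
exact (hardy_mean_le p f r (proj2 hf) hr).
Qed.

Lemma Hardy_subset_1 p f : 1 <= p -> mem (Hardy p) f -> mem (Hardy 1) f.
Proof.
intros hp hf. assert (hn := Hardy_norm_ge0 p f hf).
apply (Hardy_bound 1 f (nrm (Hardy p) f)); trivial. lra. apply analytic_holo, hf.
intros r hr. rewrite mp_1, rpow_1_r by trivial. now apply Hardy_M1_le.
Qed.

(** The increment is the integral of i z q(z) over the arc from ph to th; the modulus of the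
    integrand is at most |q|, and the arc is then enlarged to the full circle. *)
Lemma osc_bound F q r th ph : holo 1 q -> (forall z, Cmod z < 1 -> cder F z (q z)) -> 0 <= r < 1 ->
  0 <= ph <= th -> th <= 2 * PI ->
  Cmod (F (circ r th) - F (circ r ph)) <= 2 * PI * avg (fun th => Cmod (q (circ r th))).
Proof.
intros hq hF hr h1 h2.
assert (cq : tcontC (fun th => q (circ r th))) by (apply (holo_circ_cont 1); trivial; lra).
assert (cm : tcont (fun th => Cmod (q (circ r th)))) by now apply tcontC_mod.
assert (c0 : icontC (fun th => (Ci * circ r th * q (circ r th))%C) ph th).
{ intros x hx. assert (k := circ_cont1 r x). assert (k' := cq x ltac:(lra)). cont. }
rewrite <- (CI_FTC (fun th => F (circ r th)) (fun th => (Ci * circ r th * q (circ r th))%C));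
  trivial; try lra.
2:{ intros x hx. apply (pder_comp F (circ r)). apply hF. rewrite circ_mod; lra. apply circ_pder. }
apply Rle_trans with (1 := CI_mod _ ph th ltac:(lra) c0).
unfold avg. rewrite <- Rmult_assoc, Rinv_r, Rmult_1_l by apply Rgt_not_eq, twoPI_pos.
assert (sub : forall a b, 0 <= a -> b <= 2 * PI -> icont (fun th => Cmod (q (circ r th))) a b) by
  (intros a b ha hb x hx; apply cm; lra).
apply Rle_trans with (RInt (fun th => Cmod (q (circ r th))) ph th).
- apply int_le; try lra.
  + intros x hx. now apply rcont_Cmod, c0.
  + apply sub; lra.
  + intros x hx. rewrite !Cmod_mult, Cmod_Ci, circ_mod by lra. assert (k := Cmod_ge_0 (q (circ r x))). nra.
- rewrite <- (RInt_Chasles (V := R_CompleteNormedModule) (fun th => Cmod (q (circ r th))) 0 ph (2 * PI)) by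
    (apply icont_ex; [lra | apply sub; lra]).
  rewrite <- (RInt_Chasles (V := R_CompleteNormedModule) (fun th => Cmod (q (circ r th))) ph th (2 * PI)) by
    (apply icont_ex; [lra | apply sub; lra]).
  change (RInt (fun th => Cmod (q (circ r th))) ph th <= RInt (fun th => Cmod (q (circ r th))) 0 ph +
    (RInt (fun th => Cmod (q (circ r th))) ph th + RInt (fun th => Cmod (q (circ r th))) th (2 * PI))).
  assert (k1 : 0 <= RInt (fun th => Cmod (q (circ r th))) 0 ph).
  { apply int_ge0; try lra. apply sub; lra. intros; apply Cmod_ge_0. }
  assert (k2 : 0 <= RInt (fun th => Cmod (q (circ r th))) th (2 * PI)).
  { apply int_ge0; try lra. apply sub; lra. intros; apply Cmod_ge_0. }
  lra.
Qed.

(* The oscillation of F on a circle is at most the length of its image, and its mean there is F 0 = 0. *)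
Lemma primitive_bounded F q B r th : holo 1 q -> (forall z, Cmod z < 1 -> cder F z (q z)) -> F (RtoC 0) = RtoC 0 ->
  0 <= r < 1 -> 0 <= th <= 2 * PI -> avg (fun th => Cmod (q (circ r th))) <= B ->
  Cmod (F (circ r th)) <= 2 * PI * B.
Proof.
intros hq hF h0 hr hth hB. assert (hp := twoPI_pos).
assert (hFh : holo 1 F) by (intros z hz; exists (q z); now apply hF).
assert (cF : tcontC (fun th => F (circ r th))) by (apply (holo_circ_cont 1); trivial; lra).
assert (E : F (circ r th) = Cavg (fun ph => (F (circ r th) - F (circ r ph))%C)).
{ rewrite Cavg_minus, Cavg_const by (trivial; intros x _; apply continuous_const).
  destruct (Req_dec r 0) as [->|n].
  - rewrite (Cavg_ext _ (fun _ => RtoC 0)). rewrite Cavg_const. ring.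
    intros x _. rewrite <- h0. f_equal. unfold circ, RtoC. f_equal; ring.
  - rewrite (mean_value 1) by (trivial; lra). rewrite h0. ring. }
rewrite E. apply Cavg_bound.
- intros x hx. apply ccont_minus. apply continuous_const. now apply cF.
- intros ph hph. apply Rle_trans with (2 * PI * avg (fun th => Cmod (q (circ r th)))).
  + destruct (Rle_dec ph th). apply osc_bound; trivial; lra.
    rewrite Cmod_sym. apply osc_bound; trivial; lra.
  + apply Rmult_le_compat_l; lra.
Qed.

Lemma den_lower t z : 0 <= t < 1 -> Cmod z < 1 -> 1 - t <= Cmod (den t z).
Proof.
intros ht hz. unfold den.
assert (h := Cmod_triangle (1 - RtoC t * z)%C (RtoC t * z)%C).
replace (1 - RtoC t * z + RtoC t * z)%C with (RtoC 1) in h by ring.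
rewrite Cmod_1, Cmod_mult, Cmod_R, Rabs_pos_eq in h by lra. assert (k := Cmod_ge_0 z). nra.
Qed.

Lemma prim_mem_C_op t p f : 1 <= p -> 0 <= t <= 1 -> holo 1 f -> mem (Hardy p) (prim t f) ->
  mem (opt_dom (C_op t) (Hardy p)) f.
Proof.
intros hp ht hf hm. split. now apply analytic_holo.
apply Hardy_unshift; trivial. now apply C_op_holo.
apply (Hardy_ext p (prim t f)); trivial. intros z hz. now apply C_op_prim.
Qed.

Lemma C_op_mem_prim t p f : 1 <= p -> 0 <= t <= 1 -> mem (opt_dom (C_op t) (Hardy p)) f ->
  mem (Hardy p) (prim t f).
Proof.
intros hp ht hf. assert (hh := dom_holo _ _ _ hf).
destruct (Hardy_shift p (C_op t f) hp (proj2 hf)) as [h _].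
apply (Hardy_ext p (fun z => (z * C_op t f z)%C)); trivial.
intros z hz. symmetry. now apply C_op_prim.
Qed.

Theorem H1_subset t p f : 1 <= p -> 0 <= t < 1 -> mem (Hardy 1) f ->
  mem (opt_dom (C_op t) (Hardy p)) f.
Proof.
intros hp ht hf. assert (hh := proj1 (analytic_holo f) (proj1 hf)).
assert (ht' : 0 <= t <= 1) by lra. assert (hp0 : 0 < p) by lra.
apply prim_mem_C_op; trivial.
assert (N0 := Hardy_norm_ge0 1 f hf).
(* 1 / (1 - t) bounds 1 / |1 - tz| on D; this is where t < 1 enters. *)
set (B := / (1 - t) * nrm (Hardy 1) f).
assert (hB0 : 0 <= B). { apply Rmult_le_pos; trivial. apply Rlt_le, Rinv_0_lt_compat; lra. }
assert (hq := quot_holo t f ht' hh).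
apply (Hardy_bound p _ (2 * PI * B)); trivial.
- now apply prim_holo.
- assert (k := twoPI_pos). nra.
- intros r hr. apply mp_const_bound; trivial. now apply prim_holo.
  assert (k := twoPI_pos). nra.
  intros th hth. apply (primitive_bounded _ (fun z => (f z / den t z)%C)); trivial.
  + intros z hz. now apply prim_der.
  + apply prim_0.
  + assert (cq : tcontC (fun th => (f (circ r th) / den t (circ r th))%C)) by
      (apply (holo_circ_cont 1 (fun z => (f z / den t z)%C)); trivial; lra).
    assert (cf : tcontC (fun th => f (circ r th))) by (apply (holo_circ_cont 1); trivial; lra).
    apply Rle_trans with (avg (fun th => / (1 - t) * Cmod (f (circ r th)))).
    * apply avg_le. now apply tcontC_mod.
      intros x hx. apply rcont_mult. apply continuous_const. now apply rcont_Cmod, cf.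
      intros x _. assert (hz : Cmod (circ r x) < 1) by (rewrite circ_mod; lra).
      rewrite Cmod_div by now apply den_neq0.
      unfold Rdiv. rewrite Rmult_comm. apply Rmult_le_compat_r. apply Cmod_ge_0.
      apply Rinv_le_contravar. lra. now apply den_lower.
    * rewrite avg_scal by now apply tcontC_mod. apply Rmult_le_compat_l.
      apply Rlt_le, Rinv_0_lt_compat; lra. apply Hardy_M1_le; trivial. lra.
Qed.

(** * The classical Cesaro operator *)

(** The mean at r = 0 is |f(0)|, which the mean value property bounds by the mean at r = 1/2. The
    estimates with Poisson and Herglotz kernels are made on circles of positive radius. *)
Lemma Hardy_bound_pos p f K : 1 <= p -> holo 1 f -> 0 <= K ->
  (forall r, 0 < r < 1 -> mp p f r <= rpow K p) -> mem (Hardy p) f /\ nrm (Hardy p) f <= K.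
Proof.
intros hp hf hK h. apply Hardy_bound; trivial. lra.
intros r hr. destruct (Req_dec r 0) as [->|n]. 2: apply h; lra.
apply mp_const_bound; trivial.
intros th _. replace (circ 0 th) with (RtoC 0) by (unfold circ, RtoC; f_equal; ring).
assert (hr' : 0 <= / 2 < 1) by lra.
rewrite <- (mean_value 1 f (/ 2)) by (trivial; lra).
apply Rle_trans with (1 := Cavg_mod _ (holo_circ_cont 1 f (/ 2) hf ltac:(lra) ltac:(lra))).
apply Rle_trans with (1 := M1_le p f (/ 2) hp hf hr').
apply mean_le_iff; trivial; try lra. apply h. lra.
Qed.

Definition psi (u : R) (z : C) : C := (RtoC u / den (1 - u) z)%C.
Definition phi (u : R) (z : C) : C := (z * psi u z)%C.

Lemma den_ge u z : 0 <= u <= 1 -> Cmod z < 1 -> 1 - (1 - u) * Cmod z <= Cmod (den (1 - u) z).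
Proof.
intros hu hz. unfold den.
assert (h := Cmod_triangle (1 - RtoC (1 - u) * z)%C (RtoC (1 - u) * z)%C).
replace (1 - RtoC (1 - u) * z + RtoC (1 - u) * z)%C with (RtoC 1) in h by ring.
rewrite Cmod_1, Cmod_mult, Cmod_R, Rabs_pos_eq in h by lra. lra.
Qed.

Lemma psi_le u z : 0 <= u <= 1 -> Cmod z < 1 -> Cmod (psi u z) <= 1.
Proof.
intros hu hz. assert (hd := den_ge u z hu hz). assert (k := Cmod_ge_0 z).
assert (n := den_neq0 (1 - u) z ltac:(lra) hz). assert (n' := proj1 (Cmod_gt_0 _) n).
unfold psi. rewrite Cmod_div, Cmod_R, Rabs_pos_eq by (trivial; lra).
apply Rmult_le_reg_r with (1 := n'). unfold Rdiv. rewrite Rmult_assoc, Rinv_l by lra. nra.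
Qed.

Lemma phi_le u z : 0 <= u <= 1 -> Cmod z < 1 -> Cmod (phi u z) <= Cmod z.
Proof.
intros hu hz. unfold phi. rewrite Cmod_mult. assert (h := psi_le u z hu hz). assert (k := Cmod_ge_0 z). nra.
Qed.

Lemma psi_holo u : 0 <= u <= 1 -> holo 1 (psi u).
Proof.
intros hu. apply holo_div. apply holo_const. apply den_holo. intros z hz. apply den_neq0; trivial. lra.
Qed.

Lemma phi_holo u : 0 <= u <= 1 -> holo 1 (phi u).
Proof. intros hu. apply holo_mult. apply holo_id. now apply psi_holo. Qed.

Lemma holo_sub rho rho' f : rho' <= rho -> holo rho f -> holo rho' f.
Proof. intros h hf z hz. apply hf. lra. Qed.

(* Herglotz kernel of the disc of radius |b| composed with phi; its real part is the Poisson kernel. *)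
Definition herg (u : R) (b z : C) : C := ((b + phi u z) / (b - phi u z))%C.

Lemma herg_Re R0 a th : Cmod a < R0 -> Re ((circ R0 th + a) / (circ R0 th - a)) = Pk R0 a th.
Proof.
intros ha. assert (n := circ_neq R0 a th ha). assert (k := Cmod_ge_0 a).
assert (E : ((circ R0 th + a) / (circ R0 th - a))%C =
  (RtoC (/ (Cmod (circ R0 th - a) * Cmod (circ R0 th - a))) * ((circ R0 th + a) * Cconj (circ R0 th - a)))%C).
{ rewrite RtoC_inv, Cmod_sqr_conj. assert (n' := Cconj_neq0 _ n). field. now split.
  apply Cmod_gt_0 in n. nra. }
rewrite E. unfold Pk, Rdiv.
replace (R0 * R0) with (Cmod (circ R0 th) * Cmod (circ R0 th)) by (rewrite circ_mod; lra).
rewrite (Cmod_sqr (circ R0 th)), (Cmod_sqr a).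
generalize (/ (Cmod (circ R0 th - a) * Cmod (circ R0 th - a))).
intros q. destruct (circ R0 th) as [x y]. destruct a as [a1 a2]. unfold Re, Im; simpl. ring.
Qed.

Lemma herg_holo u R0 eta : 0 <= u <= 1 -> 0 < R0 < 1 -> holo R0 (herg u (circ R0 eta)).
Proof.
intros hu hR. assert (hph := holo_sub 1 R0 _ ltac:(lra) (phi_holo u hu)).
apply holo_div.
- apply holo_plus; trivial. apply holo_const.
- apply holo_minus; trivial. apply holo_const.
- intros z hz. apply circ_neq. apply Rle_lt_trans with (2 := hz). apply phi_le; trivial. lra.
Qed.

(** The average of Re [herg] over a circle is its value at z = 0, where phi = 0 and the Poisson
    kernel equals 1. *)
Lemma kernel_avg1 u r R0 eta : 0 <= u <= 1 -> 0 < r < R0 -> R0 < 1 ->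
  avg (fun th => Pk R0 (phi u (circ r th)) eta) = 1.
Proof.
intros hu hr hR. assert (hg := herg_holo u R0 eta hu ltac:(lra)).
assert (E := mean_value R0 _ r hg ltac:(lra) ltac:(lra)).
apply (f_equal Re) in E. rewrite Re_Cavg in E.
transitivity (Re (herg u (circ R0 eta) (RtoC 0))).
- rewrite <- E. apply avg_ext. intros th _. symmetry. apply herg_Re.
  apply Rle_lt_trans with r. 2: lra. rewrite <- (circ_mod r th) at 2 by lra. apply phi_le; trivial. rewrite circ_mod; lra.
- unfold herg. rewrite herg_Re.
  + unfold phi. rewrite Cmult_0_l. unfold Pk. rewrite Cmod_0.
    replace (circ R0 eta - 0)%C with (circ R0 eta) by ring. rewrite circ_mod by lra. field. lra.
  + unfold phi. rewrite Cmult_0_l, Cmod_0. lra.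
Qed.

(* On |z| = r, 1 / |1 - c z|^2 = z / ((1 - c z) (z - c r^2)): Cauchy's formula at c r^2 evaluates the average. *)
Lemma kernel_avg2 u r R0 eta : 0 < u <= 1 -> 0 < r < R0 -> 3 / 4 <= R0 < 1 ->
  avg (fun th => Cmod (psi u (circ r th)) * Cmod (psi u (circ r th)) * Pk R0 (phi u (circ r th)) eta) <= 5 * u.
Proof.
intros hu hr hR. assert (hu' : 0 <= u <= 1) by lra. set (c := 1 - u). assert (hc : 0 <= c < 1) by (unfold c; lra).
set (b := circ R0 eta). assert (hg := herg_holo u R0 eta hu' ltac:(lra)). fold b in hg.
set (a := RtoC (c * (r * r))).
assert (ha0 : 0 <= c * (r * r)) by (apply Rmult_le_pos; nra).
assert (har : c * (r * r) < r) by (assert (c * r < 1) by nra; nra).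
assert (ham : Cmod a = c * (r * r)) by (unfold a; rewrite Cmod_R, Rabs_pos_eq; trivial).
assert (hq : holo R0 (fun z => (herg u b z / den c z)%C)).
{ apply holo_div; trivial. apply den_holo. intros z hz. apply den_neq0; lra. }
assert (E := Cauchy_formula R0 _ r a hq ltac:(lra) ltac:(lra)).
assert (hD : 0 < 1 - c * (c * (r * r))) by nra.
assert (hda : den c a = RtoC (1 - c * (c * (r * r)))).
{ unfold den, a. now rewrite <- RtoC_mult, <- RtoC_minus. }
assert (hz : forall th, Cmod (circ r th) < 1) by (intros th; rewrite circ_mod; lra).
assert (E2 : avg (fun th => Cmod (psi u (circ r th)) * Cmod (psi u (circ r th)) * Pk R0 (phi u (circ r th)) eta) =
  u * u * (Pk R0 (phi u a) eta / (1 - c * (c * (r * r))))).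
{ transitivity (avg (fun th => u * u * Re (herg u b (circ r th) / den c (circ r th) * circ r th / Cpow (circ r th - a) 1))).
  - apply avg_ext. intros th _.
    assert (n1 := den_neq0 c (circ r th) ltac:(lra) (hz th)).
    assert (n2 := circ_neq r a th ltac:(lra)).
    assert (n3 : circ r th <> RtoC 0).
    { intros e. assert (k := circ_mod r th ltac:(lra)). rewrite e, Cmod_0 in k. lra. }
    assert (hph : Cmod (phi u (circ r th)) < R0).
    { apply Rle_lt_trans with (1 := phi_le u _ hu' (hz th)). rewrite circ_mod; lra. }
    rewrite <- herg_Re by trivial. fold b. fold (herg u b (circ r th)).
    set (w := circ r th) in *. set (G := herg u b w).
    assert (Hm : Cmod (psi u w) * Cmod (psi u w) = u * u * / (Cmod (den c w) * Cmod (den c w))).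
    { unfold psi. fold c. rewrite Cmod_div, Cmod_R, Rabs_pos_eq by (trivial; lra).
      apply Cmod_gt_0 in n1. field. lra. }
    rewrite Hm, Rmult_assoc. f_equal.
    assert (Hq : (G / den c w * w / Cpow (w - a) 1)%C =
      (RtoC (/ (Cmod (den c w) * Cmod (den c w))) * G)%C).
    { rewrite Cpow_1_r, RtoC_inv, Cmod_sqr_conj.
      2:{ apply Cmod_gt_0 in n1. nra. }
      assert (Hd : (w * Cconj (den c w))%C = (w - a)%C).
      { unfold den. rewrite Cconj_minus. unfold a.
        replace (RtoC (c * (r * r))) with (RtoC c * (w * Cconj w))%C.
        2:{ unfold w. rewrite circ_conj. symmetry. apply RtoC_mult. }
        replace (Cconj (RtoC 1)) with (RtoC 1) by (unfold Cconj, RtoC; simpl; f_equal; ring).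
        replace (Cconj (RtoC c * w)) with (RtoC c * Cconj w)%C. ring.
        destruct w as [w1 w2]. unfold Cconj, RtoC, Cmult; simpl. f_equal; ring. }
      rewrite <- Hd. field. repeat split; trivial. now apply Cconj_neq0. }
    rewrite Hq. unfold Re, Cmult, RtoC; simpl. ring.
  - rewrite avg_scal.
    2:{ apply tcontC_Re. apply (Kn_cont r 1 (fun th => (herg u b (circ r th) / den c (circ r th) * circ r th)%C)). lra.
        intros th hth. apply ccont_mult; [|apply circ_cont1].
        apply (holo_circ_cont R0 (fun z => (herg u b z / den c z)%C)); trivial; lra. }
    f_equal. rewrite <- Re_Cavg. unfold Kn in E. rewrite <- E, hda.
    rewrite <- (herg_Re R0 (phi u a) eta). fold b. fold (herg u b a).
    unfold Cdiv at 1. rewrite <- RtoC_inv by lra. unfold Re, Cmult, RtoC; simpl. unfold Rdiv. ring.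
    apply Rle_lt_trans with (1 := phi_le u a hu' ltac:(lra)). lra. }
rewrite E2.
(* |phi_u(a)| = c(1 - c) r^2 / (1 - c^2 r^2) <= c / (1 + c) <= 1/2. With R0 >= 3/4 the Poisson
   kernel is then at most (R0 + 1/2) / (R0 - 1/2) <= 5, and 1 - c^2 r^2 >= u turns u^2 into u. *)
assert (hpa : Cmod (phi u a) <= / 2).
{ unfold phi, psi. fold c. rewrite hda, Cmod_mult, ham, <- RtoC_div, Cmod_R, Rabs_pos_eq.
  2:{ apply Rdiv_le_0_compat; lra. } 2: lra.
  apply Rmult_le_reg_r with (1 := hD). unfold Rdiv. rewrite <- !Rmult_assoc, Rmult_assoc, Rinv_l, Rmult_1_r by lra.
  replace u with (1 - c) by (unfold c; lra). assert (0 <= r * r <= 1) by nra. nra. }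
assert (hPk : Pk R0 (phi u a) eta <= 5).
{ apply Rle_trans with (1 := Pk_le R0 (phi u a) eta ltac:(lra)).
  assert (k := Cmod_ge_0 (phi u a)).
  apply Rmult_le_reg_r with (R0 - Cmod (phi u a)). lra. unfold Rdiv. rewrite Rmult_assoc, Rinv_l by lra. lra. }
assert (hPk0 := Pk_pos R0 (phi u a) eta ltac:(lra)).
assert (hDu : u <= 1 - c * (c * (r * r))). { unfold c in *. assert (r * r <= 1) by nra. nra. }
apply Rle_trans with (u * u * (5 / u)).
- apply Rmult_le_compat_l. nra. apply Rmult_le_compat; trivial. apply Rlt_le, Rinv_0_lt_compat; lra.
  apply Rinv_le_contravar; lra.
- apply Req_le. field. lra.
Qed.

Lemma pphi_cont {T : UniformSpace} (u : T -> R) (z : T -> C) x : rcont u x -> ccont z x ->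
  0 <= u x <= 1 -> Cmod (z x) < 1 -> ccont (fun y => psi (u y) (z y)) x /\ ccont (fun y => phi (u y) (z y)) x.
Proof.
intros hu hz h1 h2.
assert (n := den_neq0 (1 - u x) (z x) ltac:(lra) h2).
assert (hp : ccont (fun y => psi (u y) (z y)) x).
{ unfold psi, den in *. cont. }
split; trivial. unfold phi. cont.
Qed.

Lemma Pk_cont2 {T : UniformSpace} R0 (a : T -> C) (th : T -> R) x : ccont a x -> rcont th x -> Cmod (a x) < R0 ->
  rcont (fun y => Pk R0 (a y) (th y)) x.
Proof.
intros ha hth h. assert (n := circ_neq R0 (a x) (th x) h).
assert (k : ccont (fun y => circ R0 (th y)) x) by (apply circ_cont; cont).
unfold Pk. cont. apply Cmod_gt_0 in n. nra.
Qed.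

(* AM-GM: |psi| <= |psi|^2 / (2 sqrt u) + sqrt u / 2. *)
Lemma kernel_avg u r R0 eta : 0 < u <= 1 -> 0 < r < R0 -> 3 / 4 <= R0 < 1 ->
  avg (fun th => Cmod (psi u (circ r th)) * Pk R0 (phi u (circ r th)) eta) <= 3 * sqrt u.
Proof.
intros hu hr hR. assert (hu' : 0 <= u <= 1) by lra.
assert (hs : 0 < sqrt u) by (apply sqrt_lt_R0; lra).
assert (hss : sqrt u * sqrt u = u) by (apply sqrt_sqrt; lra).
assert (hz : forall th, Cmod (circ r th) < 1) by (intros th; rewrite circ_mod; lra).
assert (hph : forall th, Cmod (phi u (circ r th)) < R0).
{ intros th. apply Rle_lt_trans with (1 := phi_le u _ hu' (hz th)). rewrite circ_mod; lra. }
assert (cps : forall th, ccont (fun th => psi u (circ r th)) th /\ ccont (fun th => phi u (circ r th)) th).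
{ intros th. apply (pphi_cont (fun _ => u)); trivial. cont. apply circ_cont1. }
assert (c1 : tcont (fun th => Pk R0 (phi u (circ r th)) eta)).
{ intros th _. apply (Pk_cont2 R0 (fun th => phi u (circ r th)) (fun _ => eta)); trivial. exact (proj2 (cps th)). cont. }
assert (c0 : tcont (fun th => Cmod (psi u (circ r th)))) by (intros th _; exact (rcont_Cmod _ _ (proj1 (cps th)))).
assert (c2 : tcont (fun th => Cmod (psi u (circ r th)) * Cmod (psi u (circ r th)) * Pk R0 (phi u (circ r th)) eta)).
{ intros th hth. apply rcont_mult; auto. apply rcont_mult; auto. }
apply Rle_trans with (avg (fun th => / (2 * sqrt u) * (Cmod (psi u (circ r th)) * Cmod (psi u (circ r th)) * Pk R0 (phi u (circ r th)) eta)
  + sqrt u / 2 * Pk R0 (phi u (circ r th)) eta)).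
- apply avg_le.
  + intros th hth. apply rcont_mult; auto.
  + intros th hth. apply rcont_plus; apply rcont_mult; auto; apply continuous_const.
  + intros th _. rewrite <- Rmult_assoc, <- Rmult_plus_distr_r. apply Rmult_le_compat_r. now apply Pk_pos.
    set (s := Cmod (psi u (circ r th))).
    apply Rmult_le_reg_l with (2 * sqrt u). lra.
    replace (2 * sqrt u * (/ (2 * sqrt u) * (s * s) + sqrt u / 2)) with (s * s + sqrt u * sqrt u) by (field; lra).
    assert (k := Rle_0_sqr (s - sqrt u)). unfold Rsqr in k. lra.
- rewrite avg_plus, !avg_scal; trivial.
  2,3: intros th hth; apply rcont_mult; auto; apply continuous_const.
  rewrite kernel_avg1 by (trivial; lra).
  (* 5/2 sqrt u from the quadratic average and 1/2 sqrt u from [kernel_avg1] add up to 3 sqrt u. *)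
  assert (k := kernel_avg2 u r R0 eta hu hr hR).
  apply Rmult_le_compat_l with (r := / (2 * sqrt u)) in k. 2: apply Rlt_le, Rinv_0_lt_compat; lra.
  replace (/ (2 * sqrt u) * (5 * u)) with (5 / 2 * sqrt u) in k by (rewrite <- hss at 3; field; lra). lra.
Qed.

Lemma rpow_le_self x p : 1 <= p -> 0 <= x <= 1 -> rpow x p <= x.
Proof.
intros hp hx. assert (k := rpow_convex 1 0 x p hp Rle_0_1 (Rle_refl 0) hx).
rewrite rpow_1_l, rpow_0 in k. replace (x * 1 + (1 - x) * 0) with x in k by ring. trivial.
Qed.

(** Poisson's formula on |w| = R0 and Jensen bound |f(phi)|^p by the Poisson average of |f|^p, and
    |psi|^p <= |psi| because |psi| <= 1. Exchanging the averages leaves the kernel average in th, at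
    most kap. The gap r < R0 keeps the values of phi strictly inside the circle. *)
Lemma weighted_comp_bound p f u r R0 kap : 1 <= p -> holo 1 f -> 0 <= u <= 1 -> 0 < r < R0 -> R0 < 1 ->
  (forall eta, avg (fun th => Cmod (psi u (circ r th)) * Pk R0 (phi u (circ r th)) eta) <= kap) ->
  avg (fun th => rpow (Cmod (psi u (circ r th) * f (phi u (circ r th)))) p) <= kap * mp p f R0.
Proof.
intros hp hf hu' hr hR hk. assert (hp0 : 0 < p) by lra.
assert (hz : forall th, Cmod (circ r th) < 1) by (intros th; rewrite circ_mod; lra).
assert (hph : forall th, Cmod (phi u (circ r th)) < R0).
{ intros th. apply Rle_lt_trans with (1 := phi_le u _ hu' (hz th)). rewrite circ_mod; lra. }
assert (cps : forall th, ccont (fun th => psi u (circ r th)) th /\ ccont (fun th => phi u (circ r th)) th).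
{ intros th. apply (pphi_cont (fun _ => u)); trivial. cont. apply circ_cont1. }
assert (cfc : forall th, ccont (fun th => f (circ R0 th)) th).
{ intros th. apply (ccont_comp (circ R0)). apply circ_cont1. apply (holo_cts 1); trivial. rewrite circ_mod; lra. }
assert (cU : tcont (fun eta => rpow (Cmod (f (circ R0 eta))) p)).
{ intros eta _. apply rcont_rpow; trivial. now apply rcont_Cmod. }
set (F th eta := Cmod (psi u (circ r th)) * (rpow (Cmod (f (circ R0 eta))) p * Pk R0 (phi u (circ r th)) eta)).
assert (cF : forall th eta, rcont (fun q : R * R => F (fst q) (snd q)) (th, eta)).
{ intros th eta. unfold F.
  assert (k : ccont (fun q : R * R => psi u (circ r (fst q))) (th, eta) /\ ccont (fun q : R * R => phi u (circ r (fst q))) (th, eta)).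
  { apply (pphi_cont (fun _ => u)); trivial. cont. apply circ_cont; cont. }
  destruct k as [k1 k2].
  assert (k3 : rcont (fun q : R * R => Pk R0 (phi u (circ r (fst q))) (snd q)) (th, eta)).
  { apply (Pk_cont2 R0 (fun q : R * R => phi u (circ r (fst q))) (fun q : R * R => snd q)); trivial. cont. }
  assert (k4 : ccont (fun q : R * R => f (circ R0 (snd q))) (th, eta)).
  { apply (ccont_comp (fun q : R * R => circ R0 (snd q))). apply circ_cont; cont. apply (holo_cts 1); trivial. simpl. rewrite circ_mod; lra. }
  apply rcont_mult. cont. apply rcont_mult; trivial. apply rcont_rpow; trivial. cont. }
apply Rle_trans with (avg (fun th => avg (fun eta => F th eta))).
- apply avg_le.
  + intros th _. apply rcont_rpow; trivial. apply rcont_Cmod, ccont_mult. exact (proj1 (cps th)).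
    apply (ccont_comp (fun th => phi u (circ r th))). exact (proj2 (cps th)). apply (holo_cts 1); trivial. specialize (hph th). lra.
  + intros th hth. unfold avg. apply rcont_mult. apply continuous_const.
    apply (RInt_param_cont F). apply twoPI_le. apply filter_forall. intros th' eta _. now apply cont_slice. intros; apply cF.
  + intros th _. unfold F. rewrite avg_scal.
    2:{ intros eta heta. apply rcont_mult; auto. apply (Pk_cont R0 (phi u (circ r th)) (hph th) eta heta). }
    rewrite Cmod_mult, rpow_mult by apply Cmod_ge_0.
    apply Rmult_le_compat; try apply rpow_ge0.
    * assert (k := psi_le u (circ r th) hu' (hz th)). assert (k' := Cmod_ge_0 (psi u (circ r th))).
      now apply rpow_le_self.
    * apply Rle_trans with (rpow (avg (fun eta => Cmod (f (circ R0 eta)) * Pk R0 (phi u (circ r th)) eta)) p).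
      -- apply rpow_le; trivial. split. apply Cmod_ge_0.
         rewrite (Poisson_formula 1 f R0 (phi u (circ r th))) at 1 by (trivial; lra).
         apply Rle_trans with (1 := Cavg_mod _ ltac:(intros eta heta; apply ccont_mult;
           [apply cfc | apply ccont_RtoC, (Pk_cont R0 (phi u (circ r th)) (hph th) eta heta)])).
         apply Req_le, avg_ext. intros eta _. rewrite Cmod_mult, Cmod_R, Rabs_pos_eq; trivial. now apply Pk_pos.
      -- apply avg_Jensen; trivial.
         intros eta _; now apply rcont_Cmod. now apply Pk_cont. intros; apply Cmod_ge_0.
         intros; now apply Pk_pos. now apply avg_Pk.
- rewrite avg_Fubini by (intros; apply cF).
  apply Rle_trans with (avg (fun eta => kap * rpow (Cmod (f (circ R0 eta))) p)).
  + apply avg_le.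
    * intros eta heta. unfold avg. apply rcont_mult. apply continuous_const.
      apply RInt_cont_r. apply twoPI_le. intros; apply cF.
    * intros eta heta. apply rcont_mult; auto. apply continuous_const.
    * intros eta _. unfold F.
      rewrite (avg_ext _ (fun th => rpow (Cmod (f (circ R0 eta))) p * (Cmod (psi u (circ r th)) * Pk R0 (phi u (circ r th)) eta))) by
        (intros; ring).
      rewrite avg_scal.
      2:{ intros th _. apply rcont_mult. exact (rcont_Cmod _ _ (proj1 (cps th))). apply (Pk_cont2 R0 (fun th => phi u (circ r th)) (fun _ => eta)); trivial. exact (proj2 (cps th)). cont. }
      rewrite Rmult_comm. apply Rmult_le_compat_r. apply rpow_ge0. apply hk.
  + rewrite avg_scal by trivial. apply Rle_refl.
Qed.

(* The factor m v^(m-1) / (1 - (1-v^m) z) is (m/v) psi (v^m) z; taking m >= 2p makes up for (m/v)^p. *)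
Definition flow (f : C -> C) (m : nat) (v : R) (z : C) : C :=
  (RtoC (INR m * v ^ (pred m)) / den (1 - v ^ m) z * f (phi (v ^ m) z))%C.

Lemma pow_01 v m : 0 <= v <= 1 -> 0 <= v ^ m <= 1.
Proof. intros hv. split. apply pow_le; lra. rewrite <- (pow1 m). apply pow_incr; lra. Qed.

Lemma flow_cont f m v z {T : UniformSpace} (V : T -> R) (Z : T -> C) x : holo 1 f ->
  rcont V x -> ccont Z x -> V x = v -> Z x = z -> 0 <= v <= 1 -> Cmod z < 1 ->
  ccont (fun y => flow f m (V y) (Z y)) x.
Proof.
intros hf hV hZ eV eZ hv hz. unfold flow. subst v z. assert (hm := pow_01 (V x) m hv).
assert (n := den_neq0 (1 - V x ^ m) (Z x) ltac:(lra) hz).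
assert (hvm : rcont (fun y => V y ^ m) x) by cont.
destruct (pphi_cont (fun y => V y ^ m) Z x hvm hZ hm hz) as [_ h2].
apply ccont_mult.
- unfold den in *. cont.
- apply (ccont_comp (fun y => phi (V y ^ m) (Z y))); trivial.
  apply (holo_cts 1); trivial. apply Rle_lt_trans with (2 := hz). now apply phi_le.
Qed.

(* Integrate along xi = phi (v^m) z, which joins 0 to z inside the disc, instead of along the segment. *)
Lemma flow_formula f m z : holo 1 f -> (0 < m)%nat -> Cmod z < 1 ->
  C_op 1 f z = CI (fun v => flow f m v z) 0 1.
Proof.
intros hf hm hz. assert (ht : 0 <= 1 <= 1) by lra.
(* At z = 0 the path is constant and [flow] reduces to m v^(m-1) f(0), the derivative of v^m
   f(0). *)
destruct (Ceq_dec z (RtoC 0)) as [->|n0].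
{ rewrite C_op_0.
  rewrite (CI_FTC (fun v => (RtoC (v ^ m) * f (RtoC 0))%C)).
  - rewrite pow1, pow_i by trivial. ring.
  - lra.
  - intros v hv. assert (k := pder_comp (fun w => (Cpow w m * f (RtoC 0))%C) (fun v => RtoC v) v _ (RtoC 1)
      (cder_mult _ _ _ _ _ (cder_pow (RtoC v) m) (cder_const _ _))
      (conj (is_derive_id (K := R_AbsRing) v) (is_derive_const (K := R_AbsRing) (V := R_NormedModule) 0 v))).
    assert (pw : forall v n, Cpow (RtoC v) n = RtoC (v ^ n)).
    { intros w n. induction n; simpl; trivial. rewrite IHn. now rewrite RtoC_mult. }
    apply (pder_eq _ _ _ (flow f m v (RtoC 0))) in k.
    + destruct k as [k1 k2]. split.
      * apply (is_derive_ext (fun u => Re (Cpow (RtoC u) m * f (RtoC 0)))); trivial. intros; now rewrite pw.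
      * apply (is_derive_ext (fun u => Im (Cpow (RtoC u) m * f (RtoC 0)))); trivial. intros; now rewrite pw.
    + unfold flow, phi. rewrite pw, Cmult_0_l, den_0, RtoC_mult. field.
  - intros v hv. apply (flow_cont f m v (RtoC 0) (fun v => v) (fun _ => RtoC 0)); trivial; cont. }
rewrite C_op_nz by trivial.
assert (E : (z * CI (fun v => flow f m v z) 0 1)%C = prim 1 f z).
{ assert (cfl : icontC (fun v => flow f m v z) 0 1).
  { intros v hv. apply (flow_cont f m v z (fun v => v) (fun _ => z)); trivial; cont. }
  rewrite <- CI_scal by (trivial; lra).
  rewrite (CI_FTC (fun v => prim 1 f (phi (v ^ m) z))).
  - rewrite pow1, pow_i by trivial.
    replace (phi 1 z) with z. replace (phi 0 z) with (RtoC 0). rewrite prim_0. ring.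
    unfold phi, psi, Cdiv. ring.
    unfold phi, psi, den. rewrite Rminus_diag.
    replace (1 - 0 * z)%C with (RtoC 1) by ring. field.
  - lra.
  - intros v hv. assert (hvm := pow_01 v m hv).
    assert (hph : Cmod (phi (v ^ m) z) < 1) by (apply Rle_lt_trans with (2 := hz); now apply phi_le).
    assert (pw : forall v n, Cpow (RtoC v) n = RtoC (v ^ n)).
    { intros w n. induction n; simpl; trivial. rewrite IHn. now rewrite RtoC_mult. }
    set (Q w := (z * (Cpow w m / (1 - (1 - Cpow w m) * z)))%C).
    assert (QE : forall v, Q (RtoC v) = phi (v ^ m) z).
    { intros w. unfold Q, phi, psi, den. now rewrite pw, RtoC_minus. }
    assert (n := den_neq0 (1 - v ^ m) z ltac:(lra) hz).
    assert (nd : (1 - (1 - Cpow (RtoC v) m) * z)%C <> RtoC 0).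
    { unfold den in n. now rewrite pw, <- RtoC_minus. }
    assert (dw := cder_pow (RtoC v) m).
    set (dm := (RtoC (INR m) * Cpow (RtoC v) (pred m))%C) in *.
    assert (dden : cder (fun w => (1 - (1 - Cpow w m) * z)%C) (RtoC v) (dm * z)%C).
    { apply (cder_eq _ _ _ _ (cder_minus _ _ _ _ _ (cder_const (RtoC 1) _)
        (cder_mult _ _ _ _ _ (cder_minus _ _ _ _ _ (cder_const (RtoC 1) _) dw) (cder_const z _)))). ring. }
    assert (dQ := cder_scal z _ _ _ (cder_div _ _ _ _ _ dw dden nd)). fold (Q) in dQ.
    assert (dP : cder (prim 1 f) (Q (RtoC v)) (f (Q (RtoC v)) / den 1 (Q (RtoC v)))%C).
    { apply prim_der; trivial. now rewrite QE. }
    assert (k := pder_comp _ (fun v => RtoC v) v _ (RtoC 1) (cder_comp _ Q _ _ _ dP dQ)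
      (conj (is_derive_id (K := R_AbsRing) v) (is_derive_const (K := R_AbsRing) (V := R_NormedModule) 0 v))).
    apply (pder_eq _ _ _ (z * flow f m v z)%C) in k.
    + destruct k as [k1 k2]. split.
      * apply (is_derive_ext (fun u => Re (prim 1 f (Q (RtoC u))))); trivial. intros; now rewrite QE.
      * apply (is_derive_ext (fun u => Im (prim 1 f (Q (RtoC u))))); trivial. intros; now rewrite QE.
    + assert (n1 := den_neq0 1 (phi (v ^ m) z) ht hph).
      unfold flow. rewrite QE.
      (* 1 - phi_u(z) = (1 - z) / (1 - (1 - u) z): the factor 1 - z cancels against the one in the
         u-derivative of phi, which leaves the weight of [flow]. *)
      assert (e1 : den 1 (phi (v ^ m) z) = ((1 - z) / den (1 - v ^ m) z)%C).
      { unfold phi, psi. unfold den at 1. replace (RtoC (v ^ m)) with (1 - RtoC (1 - v ^ m))%C by (rewrite RtoC_minus; ring).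
        unfold den in *. field. trivial. }
      assert (nz : (1 - z)%C <> RtoC 0).
      { intros e. apply n1. rewrite e1, e. unfold Cdiv. ring. }
      rewrite e1. unfold dm. rewrite !pw, RtoC_mult.
      set (A := RtoC (v ^ m)). set (B := RtoC (v ^ pred m)).
      assert (eD : den (1 - v ^ m) z = (1 - (1 - A) * z)%C).
      { unfold den, A. now rewrite RtoC_minus. }
      rewrite eD in n |- *. field. repeat split; trivial.
  - intros v hv. apply ccont_mult. apply continuous_const. now apply cfl. }
rewrite <- E. field. trivial.
Qed.

Theorem Cesaro_bounded p f : 1 <= p -> mem (Hardy p) f -> mem (opt_dom (C_op 1) (Hardy p)) f.
Proof.
intros hp hf. assert (hp0 : 0 < p) by lra. assert (ht : 0 <= 1 <= 1) by lra.
assert (hh := proj1 (analytic_holo f) (proj1 hf)).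
split. exact (proj1 hf).
destruct (nfloor_ex p ltac:(lra)) as [k0 hk0]. set (k := S k0).
assert (hk : p <= INR k) by (unfold k; rewrite S_INR; lra).
(* Even, so that sqrt(v^m) is the integer power v^k, with k >= p. *)
set (m := (2 * k)%nat). assert (hm : (0 < m)%nat) by (unfold m, k; lia).
assert (hm0 : 0 < INR m) by now apply lt_0_INR.
assert (N0 := Hardy_norm_ge0 p f hf). set (N := nrm (Hardy p) f) in *.
set (B := 3 * rpow (INR m) p * rpow N p).
assert (hB : 0 <= B). { apply Rmult_le_pos. apply Rmult_le_pos. lra. apply rpow_ge0. apply rpow_ge0. }
apply (Hardy_bound_pos p _ (rpow B (/ p))); trivial.
now apply C_op_holo. apply rpow_ge0.
intros r hr. rewrite rpow_root' by trivial.
(* Strictly between r and 1, and at least 3/4 as [kernel_avg] requires. *)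
set (R0 := Rmax (3 / 4) ((1 + r) / 2)).
assert (hR1 : 3 / 4 <= R0) by apply Rmax_l. assert (hR2 : (1 + r) / 2 <= R0) by apply Rmax_r.
assert (hR3 : R0 < 1) by (apply Rmax_case; lra).
assert (hM : mp p f R0 <= rpow N p) by (exact (Hardy_mp_le p f R0 hp0 hf ltac:(lra))).
assert (hz : forall th, Cmod (circ r th) < 1) by (intros th; rewrite circ_mod; lra).
assert (cfl : forall v th, 0 <= v <= 1 -> ccont (fun q : R * R => flow f m (fst q) (circ r (snd q))) (v, th)).
{ intros v th hv. apply (flow_cont f m v (circ r th) (fun q : R * R => fst q) (fun q : R * R => circ r (snd q))); trivial.
  cont. apply circ_cont; cont. }
assert (cF : forall v th, 0 <= v <= 1 -> rcont (fun q : R * R => rpow (Cmod (flow f m (fst q) (circ r (snd q)))) p) (v, th)).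
{ intros v th hv. apply rcont_rpow; trivial. now apply rcont_Cmod, cfl. }
apply Rle_trans with (avg (fun th => RInt (fun v => rpow (Cmod (flow f m v (circ r th))) p) 0 1)).
- apply avg_le.
  + apply (mp_tcont p (C_op 1 f) r); trivial. now apply C_op_holo. lra.
  + intros th hth. apply (RInt_cont_r (fun v th => rpow (Cmod (flow f m v (circ r th))) p)). lra. intros; now apply cF.
  + intros th hth.
    assert (cc : icontC (fun v => flow f m v (circ r th)) 0 1).
    { intros v hv. apply (flow_cont f m v (circ r th) (fun v => v) (fun _ => circ r th)); trivial; cont. }
    assert (ccm : icont (fun v => Cmod (flow f m v (circ r th))) 0 1) by (intros v hv; now apply rcont_Cmod, cc).
    rewrite (flow_formula f m) by trivial.
    apply Rle_trans with (rpow (RInt (fun v => Cmod (flow f m v (circ r th))) 0 1) p).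
    { apply rpow_le; trivial. split. apply Cmod_ge_0. apply CI_mod; trivial. lra. }
    (* The weight for [Jensen] is the constant 1, of total mass 1 on [0, 1]. *)
    rewrite (int_ext (fun v => Cmod (flow f m v (circ r th))) (fun v => Cmod (flow f m v (circ r th)) * 1)) by (try lra; intros; ring).
    rewrite (int_ext (fun v => rpow (Cmod (flow f m v (circ r th))) p) (fun v => rpow (Cmod (flow f m v (circ r th))) p * 1)) by (try lra; intros; ring).
    apply Jensen; trivial; try lra.
    intros v _; apply continuous_const. intros; apply Cmod_ge_0. intros; lra.
    rewrite int_const. apply Rmult_1_r || lra.
- rewrite <- (RInt_avg_Fubini (fun v th => rpow (Cmod (flow f m v (circ r th))) p)) by (try lra; trivial).
  apply Rle_trans with (RInt (fun _ => B) 0 1).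
  2:{ rewrite int_const. lra. }
  (* [flow] is controlled for v in [0, 1] only, while continuity at the end points is two-sided;
     clamping v settles this. *)
  rewrite (int_ext _ (fun v => avg (fun th => rpow (Cmod (flow f m (clamp 0 1 v) (circ r th))) p))) by
    (try lra; intros v hv; now rewrite clamp_id).
  apply int_le; try lra.
  + assert (cc : forall v th, rcont (fun q : R * R => rpow (Cmod (flow f m (clamp 0 1 (fst q)) (circ r (snd q)))) p) (v, th)).
    { intros v th. apply rcont_rpow; trivial. apply rcont_Cmod.
      apply (flow_cont f m (clamp 0 1 v) (circ r th) (fun q : R * R => clamp 0 1 (fst q)) (fun q : R * R => circ r (snd q))); trivial.
      apply clamp_cont; [lra | cont]. apply circ_cont; cont. apply clamp_in; lra. }
    intros v hv. unfold avg. apply rcont_mult. apply continuous_const.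
    apply (RInt_param_cont (fun v th => rpow (Cmod (flow f m (clamp 0 1 v) (circ r th))) p)).
    apply twoPI_le. apply filter_forall. intros v' th _.
    apply (cont_slice (fun v th => rpow (Cmod (flow f m (clamp 0 1 v) (circ r th))) p)). apply cc.
    intros; apply cc.
  + intros v _; apply continuous_const.
  (* v = 0 is apart because of the factor m / v; there [flow] vanishes since m >= 2. *)
  + intros v hv. rewrite clamp_id by trivial. destruct (Req_dec v 0) as [->|nv].
    { rewrite (avg_ext _ (fun _ => 0)). rewrite avg_const. trivial.
      intros th _. unfold flow. rewrite (pow_i (pred m)) by (unfold m, k; lia).
      rewrite Rmult_0_r. unfold Cdiv. rewrite !Cmult_0_l, Cmod_0. apply rpow_0. }
    assert (hv0 : 0 < v) by lra. assert (hvm : 0 < v ^ m) by now apply pow_lt.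
    assert (hvm1 := pow_01 v m hv).
    assert (E : forall th, rpow (Cmod (flow f m v (circ r th))) p =
      rpow (INR m / v) p * rpow (Cmod (psi (v ^ m) (circ r th) * f (phi (v ^ m) (circ r th)))) p).
    { intros th. rewrite <- rpow_mult. 2: apply Rdiv_le_0_compat; lra. 2: apply Cmod_ge_0.
      f_equal. rewrite <- (Rabs_pos_eq (INR m / v)) by (apply Rdiv_le_0_compat; lra).
      rewrite <- Cmod_R, <- Cmod_mult. f_equal. unfold flow, psi.
      assert (n := den_neq0 (1 - v ^ m) (circ r th) ltac:(lra) (hz th)).
      replace (RtoC (INR m * v ^ pred m)) with (RtoC (INR m / v) * RtoC (v ^ m))%C. field. trivial.
      rewrite <- RtoC_mult. f_equal. replace (v ^ m) with (v * v ^ pred m). field. trivial.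
      change (v ^ S (pred m) = v ^ m). reflexivity. }
    rewrite (avg_ext _ _ (fun th _ => E th)).
    rewrite avg_scal.
    2:{ intros th _. apply rcont_rpow; trivial. apply rcont_Cmod.
        destruct (pphi_cont (fun _ => v ^ m) (circ r) th ltac:(cont) (circ_cont1 r th) hvm1 (hz th)) as [p1 p2].
        apply ccont_mult; trivial. apply (ccont_comp (fun th => phi (v ^ m) (circ r th))); trivial.
        apply (holo_cts 1); trivial. apply Rle_lt_trans with (1 := phi_le _ _ hvm1 (hz th)). apply hz. }
    apply Rle_trans with (rpow (INR m / v) p * (3 * sqrt (v ^ m) * rpow N p)).
    { apply Rmult_le_compat_l. apply rpow_ge0.
      apply Rle_trans with (1 := weighted_comp_bound p f (v ^ m) r R0 _ hp hh hvm1 ltac:(lra) hR3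
        (fun eta => kernel_avg (v ^ m) r R0 eta ltac:(lra) ltac:(lra) ltac:(lra))).
      apply Rmult_le_compat_l; trivial. assert (q := sqrt_pos (v ^ m)). lra. }
    (* v^k <= v^p since v <= 1 and k >= p. Multiplied by (m / v)^p this leaves the m^p of [B]. *)
    assert (hsq : sqrt (v ^ m) <= rpow v p).
    { unfold m. replace (v ^ (2 * k)) with (v ^ k * v ^ k) by (rewrite <- pow_add; f_equal; lia).
      rewrite sqrt_square by (apply pow_le; lra).
      rewrite rpow_pos_eq, <- Rpower_pow by trivial. unfold Rpower.
      destruct (Req_dec v 1) as [->|n1]. rewrite ln_1, !Rmult_0_r. lra.
      assert (ln v < 0). { rewrite <- ln_1. apply ln_increasing; lra. }
      assert (hl : INR k * ln v <= p * ln v) by nra.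
      destruct hl as [hl| ->]; [|lra]. now apply Rlt_le, exp_increasing. }
    unfold B. replace (INR m) with (INR m / v * v) at 2 by (field; lra).
    rewrite (rpow_mult (INR m / v) v) by (try lra; apply Rdiv_le_0_compat; lra).
    assert (q1 := rpow_ge0 (INR m / v) p). assert (q2 := rpow_ge0 N p).
    replace (rpow (INR m / v) p * (3 * sqrt (v ^ m) * rpow N p)) with (3 * rpow (INR m / v) p * rpow N p * sqrt (v ^ m)) by ring.
    replace (3 * (rpow (INR m / v) p * rpow v p) * rpow N p) with (3 * rpow (INR m / v) p * rpow N p * rpow v p) by ring.
    apply Rmult_le_compat_l; trivial. apply Rmult_le_pos; trivial. lra.
Qed.

(** * Uniform convexity *)

(** Bernoulli with exponent 1/q >= 1, applied to v^q. *)
Lemma Bernoulli_concave v q : 0 < q <= 1 -> 0 <= v -> rpow v q <= 1 + q * (v - 1).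
Proof.
intros hq hv. assert (h : 1 <= / q) by (rewrite <- Rinv_1; apply Rinv_le_contravar; lra).
assert (k := Bernoulli_rpow (rpow v q) (/ q) h (rpow_ge0 v q)).
rewrite rpow_root in k by lra.
apply Rmult_le_compat_l with (r := q) in k; [|lra].
replace (q * (1 + / q * (rpow v q - 1))) with (q + (rpow v q - 1)) in k by (field; lra). lra.
Qed.

Lemma rpow_plus_exp x a b : rpow x (a + b) = rpow x a * rpow x b.
Proof.
destruct (Rlt_dec 0 x). rewrite !rpow_pos_eq by trivial. apply Rpower_plus.
rewrite !rpow_npos by lra. ring.
Qed.

Lemma rpow_2 x : 0 <= x -> rpow x 2 = x * x.
Proof. intros h. replace 2 with (1 + 1) by ring. now rewrite rpow_plus_exp, rpow_1_r. Qed.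

(* (1+e)^p = (1+e)^2 / (1+e)^(2-p), and (1+e)^(2-p) <= 1 + (2-p) e by concavity. *)
Lemma Bernoulli_second_order e p : 1 < p <= 2 -> 0 <= e <= 1 ->
  1 + p * e + (p - 1) * (p - 1) / 2 * (e * e) <= rpow (1 + e) p.
Proof.
intros hp he.
assert (K : rpow (1 + e) (2 - p) <= 1 + (2 - p) * e).
{ destruct (Req_dec p 2) as [->|n].
  - replace (2 - 2) with 0 by ring. rewrite rpow_pos_eq by lra. unfold Rpower. rewrite Rmult_0_l, exp_0. lra.
  - assert (k := Bernoulli_concave (1 + e) (2 - p) ltac:(lra) ltac:(lra)). lra. }
assert (E : rpow (1 + e) p * rpow (1 + e) (2 - p) = (1 + e) * (1 + e)).
{ rewrite <- rpow_plus_exp. replace (p + (2 - p)) with 2 by ring. apply rpow_2. lra. }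
assert (P := rpow_ge0 (1 + e) p).
assert (L : (1 + e) * (1 + e) <= rpow (1 + e) p * (1 + (2 - p) * e)) by (rewrite <- E; apply Rmult_le_compat_l; trivial).
apply Rmult_le_reg_r with (1 + (2 - p) * e). nra.
apply Rle_trans with (2 := L).
assert (I1 : (1 + e) * (1 + e) - (1 + p * e) * (1 + (2 - p) * e) = (p - 1) * (p - 1) * (e * e)) by ring.
assert (I2 : 0 <= (p - 1) * (p - 1) * (e * e)).
{ apply Rmult_le_pos. assert (k := Rle_0_sqr (p - 1)). exact k. nra. }
assert (I3 : (2 - p) * e <= 1) by nra.
assert (I4 : (p - 1) * (p - 1) / 2 * (e * e) * (1 + (2 - p) * e) <= (p - 1) * (p - 1) * (e * e)).
{ replace ((p - 1) * (p - 1) / 2 * (e * e) * (1 + (2 - p) * e)) with ((p - 1) * (p - 1) * (e * e) * ((1 + (2 - p) * e) / 2)) by field.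
  rewrite <- (Rmult_1_r ((p - 1) * (p - 1) * (e * e))) at 2. apply Rmult_le_compat_l; trivial. lra. }
lra.
Qed.

Lemma parallelogram a b :
  Cmod (a + b) * Cmod (a + b) + Cmod (a - b) * Cmod (a - b) = 2 * (Cmod a * Cmod a + Cmod b * Cmod b).
Proof. rewrite !Cmod_sqr. unfold Re, Im; simpl. ring. Qed.

(** The fractions u / (u + v) and v / (u + v) lie in [0, 1], where the q-th power does not increase
    them, and they add up to 1. *)
Lemma rpow_superadd u v q : 1 <= q -> 0 <= u -> 0 <= v -> rpow u q + rpow v q <= rpow (u + v) q.
Proof.
intros hq hu hv. destruct (Req_dec (u + v) 0) as [e|n].
{ rewrite (rpow_npos u), (rpow_npos v) by lra. rewrite Rplus_0_l. apply rpow_ge0. }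
assert (hs : 0 < u + v) by lra.
assert (d1 : 0 <= u / (u + v)) by (apply Rdiv_le_0_compat; lra).
assert (d2 : 0 <= v / (u + v)) by (apply Rdiv_le_0_compat; lra).
assert (d3 : u / (u + v) + v / (u + v) = 1) by (field; lra).
assert (k1 := rpow_le_self (u / (u + v)) q hq ltac:(lra)).
assert (k2 := rpow_le_self (v / (u + v)) q hq ltac:(lra)).
replace (rpow u q) with (rpow (u + v) q * rpow (u / (u + v)) q) by (rewrite <- rpow_mult by lra; f_equal; field; lra).
replace (rpow v q) with (rpow (u + v) q * rpow (v / (u + v)) q) by (rewrite <- rpow_mult by lra; f_equal; field; lra).
assert (P := rpow_ge0 (u + v) q). nra.
Qed.

(** The defect of midpoint convexity of |z|^p. A lower bound for it in terms of |a - b| is what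
    uniform convexity means here. *)
Definition gap p (a b : C) : R :=
  (rpow (Cmod a) p + rpow (Cmod b) p) / 2 - rpow (Cmod (a + b) / 2) p.

Lemma rpow_sqr x p : 0 <= x -> rpow (x * x) (p / 2) = rpow x p.
Proof.
intros hx. rewrite <- rpow_2, rpow_rpow by trivial. f_equal. field.
Qed.

(** Clarkson's inequality. Everything is a power p/2 >= 1 of a squared modulus: superadditivity
    joins the squares of half sum and half difference, the parallelogram law evaluates their sum,
    and convexity splits it. *)
Lemma Clarkson_gap p a b : 2 <= p -> rpow (Cmod (a - b) / 2) p <= gap p a b.
Proof.
intros hp. assert (ha := Cmod_ge_0 a). assert (hb := Cmod_ge_0 b).
assert (h1 := Cmod_ge_0 (a + b)%C). assert (h2 := Cmod_ge_0 (a - b)%C).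
unfold gap. rewrite <- (rpow_sqr (Cmod a)), <- (rpow_sqr (Cmod b)), <- (rpow_sqr (Cmod (a + b) / 2)),
  <- (rpow_sqr (Cmod (a - b) / 2)) by lra.
assert (k1 := rpow_convex (Cmod a * Cmod a) (Cmod b * Cmod b) (/ 2) (p / 2) ltac:(lra) ltac:(nra) ltac:(nra) ltac:(lra)).
assert (k2 := rpow_superadd (Cmod (a + b) / 2 * (Cmod (a + b) / 2)) (Cmod (a - b) / 2 * (Cmod (a - b) / 2)) (p / 2)
  ltac:(lra) ltac:(nra) ltac:(nra)).
assert (E := parallelogram a b).
replace (Cmod (a + b) / 2 * (Cmod (a + b) / 2) + Cmod (a - b) / 2 * (Cmod (a - b) / 2))
  with (/ 2 * (Cmod a * Cmod a) + (1 - / 2) * (Cmod b * Cmod b)) in k2 by lra.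
lra.
Qed.

(* The difference of the moduli is controlled by the second-order Bernoulli inequality, the angle between
   a and b by concavity of x^(p/2). *)
Lemma gap_lt2 p a b : 1 < p <= 2 -> 0 < Cmod a + Cmod b ->
  (p - 1) * (p - 1) / 4 * rpow ((Cmod a + Cmod b) / 2) p *
    ((Cmod (a - b) / (Cmod a + Cmod b)) * (Cmod (a - b) / (Cmod a + Cmod b))) <= gap p a b.
Proof.
intros hp hpos.
assert (wl : forall x y, 0 <= y <= x -> 0 < x + y ->
  rpow ((x + y) / 2) p * (1 + (p - 1) * (p - 1) / 4 * (((x - y) / (x + y)) * ((x - y) / (x + y)))) <= (rpow x p + rpow y p) / 2).
{ intros x y hxy hs. set (s := (x + y) / 2). set (e := (x - y) / (x + y)).
  assert (he : 0 <= e <= 1).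
  { unfold e. split. apply Rdiv_le_0_compat; lra. apply Rmult_le_reg_r with (x + y); trivial.
    unfold Rdiv. rewrite Rmult_assoc, Rinv_l; lra. }
  replace x with (s * (1 + e)) by (unfold s, e; field; lra).
  replace y with (s * (1 - e)) by (unfold s, e; field; lra).
  assert (hs0 : 0 < s) by (unfold s; lra).
  rewrite !rpow_mult by lra.
  assert (k1 := Bernoulli_second_order e p hp he).
  assert (k2 := Bernoulli_rpow (1 - e) p ltac:(lra) ltac:(lra)).
  assert (P := rpow_gt0 s p hs0).
  replace ((rpow s p * rpow (1 + e) p + rpow s p * rpow (1 - e) p) / 2) with (rpow s p * ((rpow (1 + e) p + rpow (1 - e) p) / 2)) by field.
  apply Rmult_le_compat_l; lra. }
set (x := Cmod a) in *. set (y := Cmod b) in *. set (D := Cmod (a - b)). set (M := Cmod (a + b)).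
assert (hx : 0 <= x) by apply Cmod_ge_0. assert (hy : 0 <= y) by apply Cmod_ge_0.
assert (hD : 0 <= D) by apply Cmod_ge_0. assert (hM : 0 <= M) by apply Cmod_ge_0.
assert (E : M * M + D * D = 2 * (x * x + y * y)) by apply parallelogram.
assert (hMs : M <= x + y) by apply Cmod_triangle.
assert (wl' : rpow ((x + y) / 2) p * (1 + (p - 1) * (p - 1) / 4 * (((x - y) / (x + y)) * ((x - y) / (x + y)))) <= (rpow x p + rpow y p) / 2).
{ destruct (Rle_dec y x). apply wl; lra.
  assert (k := wl y x ltac:(lra) ltac:(lra)). rewrite (Rplus_comm y x), (Rplus_comm (rpow y p)) in k.
  replace ((x - y) / (x + y) * ((x - y) / (x + y))) with ((y - x) / (x + y) * ((y - x) / (x + y))) by (field; lra). trivial. }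
set (s := (x + y) / 2) in *. assert (hs : 0 < s) by (unfold s; lra).
set (v := (M / (x + y)) * (M / (x + y))).
assert (hv0 : 0 <= M / (x + y)) by (apply Rdiv_le_0_compat; lra).
assert (Em : rpow (M / 2) p = rpow s p * rpow v (p / 2)).
{ unfold v. rewrite rpow_sqr by trivial. rewrite <- rpow_mult by lra. f_equal. unfold s. field. lra. }
assert (kv := Bernoulli_concave v (p / 2) ltac:(lra) ltac:(unfold v; nra)).
assert (P := rpow_gt0 s p hs).
apply Rmult_le_compat_l with (r := rpow s p) in kv; [|lra]. rewrite <- Em in kv.
unfold gap. fold x y M.
set (h := (x - y) / (x + y) * ((x - y) / (x + y))) in *. set (d := D / (x + y) * (D / (x + y))).
assert (Ev : v = 1 - (d - h)).
{ unfold v, h, d. replace (M / (x + y) * (M / (x + y))) with (M * M / ((x + y) * (x + y))) by (field; lra).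
  replace (M * M) with (2 * (x * x + y * y) - D * D) by lra. field. lra. }
assert (hdh : h <= d).
{ assert (v <= 1).
  { unfold v. assert (M / (x + y) <= 1).
    { apply Rmult_le_reg_r with (x + y); trivial. unfold Rdiv. rewrite Rmult_assoc, Rinv_l; lra. }
    nra. }
  lra. }
rewrite Ev in kv.
set (c := (p - 1) * (p - 1) / 4) in *.
(* The target c d is split along d = h + (d - h): the part h from the moduli is covered with
   coefficient c, the nonnegative angular part d - h by the larger p/2. *)
assert (hc : c <= p / 2) by (unfold c; nra).
assert (G : rpow s p * (c * d) <= rpow s p * (c * h + p / 2 * (d - h))).
{ apply Rmult_le_compat_l. lra. nra. }
lra.
Qed.

(** An additive form that can be averaged over a circle. Either |a - b| is small relative to |a| +
    |b| and the eps term suffices, or the gap is bounded below. For p >= 2 the gap alone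
    suffices. *)
Lemma uniform_convexity p eps : 1 < p -> 0 < eps -> exists K, 0 < K /\ forall a b,
  rpow (Cmod (a - b)) p <= eps * (rpow (Cmod a) p + rpow (Cmod b) p) + K * gap p a b.
Proof.
intros hp he. assert (hp0 : 0 < p) by lra. assert (P2 := rpow_gt0 2 p ltac:(lra)).
destruct (Rle_dec 2 p) as [h2|h2].
- exists (rpow 2 p). split; trivial. intros a b.
  assert (k := Clarkson_gap p a b h2). assert (hm := Cmod_ge_0 (a - b)%C).
  replace (Cmod (a - b)) with (2 * (Cmod (a - b) / 2)) by field. rewrite rpow_mult by lra.
  apply Rmult_le_compat_l with (r := rpow 2 p) in k; [|lra].
  assert (q1 := rpow_ge0 (Cmod a) p). assert (q2 := rpow_ge0 (Cmod b) p).
  assert (0 <= eps * (rpow (Cmod a) p + rpow (Cmod b) p)) by (apply Rmult_le_pos; lra). lra.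
(* 2^p del^p = eps: if |a - b| <= del (|a| + |b|), then |a - b|^p is at most eps times the p-th
   power of (|a| + |b|) / 2. *)
- set (del := rpow (eps / rpow 2 p) (/ p)).
  assert (hdel : 0 < del) by (apply rpow_gt0, Rdiv_lt_0_compat; trivial).
  assert (edel : rpow del p = eps / rpow 2 p).
  { apply rpow_root'; trivial. apply Rlt_le, Rdiv_lt_0_compat; trivial. }
  set (c := (p - 1) * (p - 1) / 4). assert (hc : 0 < c) by (unfold c; nra).
  (* In the other case [gap_lt2] gives a gap of at least c del^2 times that p-th power, and |a -
     b|^p is at most 2^p times it. *)
  set (K := rpow 2 p / (c * (del * del))).
  assert (hcd : 0 < c * (del * del)) by (apply Rmult_lt_0_compat; trivial; now apply Rmult_lt_0_compat).
  exists K. split. now apply Rdiv_lt_0_compat.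
  intros a b. assert (ha := Cmod_ge_0 a). assert (hb := Cmod_ge_0 b). assert (hm := Cmod_ge_0 (a - b)%C).
  assert (hms : Cmod (a - b) <= Cmod a + Cmod b).
  { unfold Cminus. rewrite <- (Cmod_opp b). apply Cmod_triangle. }
  destruct (Req_dec (Cmod a + Cmod b) 0) as [e|n].
  { unfold gap. assert (hq := Cmod_triangle a b).
    rewrite (rpow_npos (Cmod (a - b))), (rpow_npos (Cmod a)), (rpow_npos (Cmod b)), (rpow_npos (Cmod (a + b) / 2)) by lra. lra. }
  assert (hs : 0 < Cmod a + Cmod b) by lra.
  assert (k := gap_lt2 p a b ltac:(lra) hs). fold c in k.
  set (s := Cmod a + Cmod b) in *. set (w := Cmod (a - b) / s) in *.
  assert (hw : 0 <= w <= 1).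
  { unfold w. split. now apply Rdiv_le_0_compat. apply Rmult_le_reg_r with s; trivial.
    unfold Rdiv. rewrite Rmult_assoc, Rinv_l; lra. }
  assert (PS := rpow_gt0 (s / 2) p ltac:(lra)).
  assert (Ed : rpow (Cmod (a - b)) p = rpow 2 p * rpow (s / 2) p * rpow w p).
  { rewrite <- !rpow_mult by lra. f_equal. unfold w. field. lra. }
  assert (cv := rpow_convex (Cmod a) (Cmod b) (/ 2) p ltac:(lra) ha hb ltac:(lra)).
  replace (/ 2 * Cmod a + (1 - / 2) * Cmod b) with (s / 2) in cv by (unfold s; field).
  assert (gp : 0 <= gap p a b).
  { apply Rle_trans with (2 := k). apply Rmult_le_pos. apply Rmult_le_pos; lra. nra. }
  assert (q1 := rpow_ge0 (Cmod a) p). assert (q2 := rpow_ge0 (Cmod b) p).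
  rewrite Ed. destruct (Rle_dec w del) as [h|h].
  + assert (kw : rpow w p <= eps / rpow 2 p) by (rewrite <- edel; apply rpow_le; lra).
    assert (0 <= K * gap p a b) by (apply Rmult_le_pos; trivial; apply Rlt_le, Rdiv_lt_0_compat; trivial).
    apply Rmult_le_compat_l with (r := rpow 2 p * rpow (s / 2) p) in kw; [|nra].
    replace (rpow 2 p * rpow (s / 2) p * (eps / rpow 2 p)) with (eps * rpow (s / 2) p) in kw by (field; lra).
    assert (eps * rpow (s / 2) p <= eps * (rpow (Cmod a) p + rpow (Cmod b) p)) by (apply Rmult_le_compat_l; lra). lra.
  + assert (kw := rpow_le_self w p ltac:(lra) hw).
    assert (rw1 : rpow w p <= 1) by lra.
    assert (dd : del * del <= w * w) by nra.
    assert (0 <= eps * (rpow (Cmod a) p + rpow (Cmod b) p)) by (apply Rmult_le_pos; lra).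
    assert (L : rpow 2 p * rpow (s / 2) p * rpow w p <= K * (c * rpow (s / 2) p * (w * w))).
    { apply Rle_trans with (rpow 2 p * rpow (s / 2) p * 1). apply Rmult_le_compat_l; nra.
      replace (K * (c * rpow (s / 2) p * (w * w))) with (rpow 2 p * rpow (s / 2) p * (w * w / (del * del))) by (unfold K; field; lra).
      apply Rmult_le_compat_l. nra. apply Rmult_le_reg_r with (del * del). nra.
      unfold Rdiv. rewrite Rmult_assoc, Rinv_l; nra. }
    assert (K * (c * rpow (s / 2) p * (w * w)) <= K * gap p a b).
    { apply Rmult_le_compat_l; trivial. apply Rlt_le, Rdiv_lt_0_compat; trivial. }
    lra.
Qed.

(** * Dilations converge in the Hardy norm *)

Lemma psi_1 z : psi 1 z = RtoC 1.
Proof.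
unfold psi, den. rewrite Rminus_diag. replace (1 - 0 * z)%C with (RtoC 1) by ring. field.
Qed.

Lemma phi_1 z : phi 1 z = z.
Proof. unfold phi. rewrite psi_1. ring. Qed.

(** The case u = 1 of [weighted_comp_bound], in which psi is 1 and phi the identity. *)
Lemma mp_mono p f r R0 : 1 <= p -> holo 1 f -> 0 < r < R0 -> R0 < 1 -> mp p f r <= mp p f R0.
Proof.
intros hp hf hr hR.
assert (hk : forall eta, avg (fun th => Cmod (psi 1 (circ r th)) * Pk R0 (phi 1 (circ r th)) eta) <= 1).
{ intros eta. apply Rle_trans with (avg (fun th => Pk R0 (phi 1 (circ r th)) eta)).
  - apply Req_le, avg_ext. intros th _. rewrite psi_1, Cmod_1. ring.
  - apply Req_le, kernel_avg1; trivial; lra. }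
assert (k := weighted_comp_bound p f 1 r R0 1 hp hf ltac:(lra) hr hR hk).
rewrite Rmult_1_l in k. apply Rle_trans with (2 := k).
apply Req_le, avg_ext. intros th _. rewrite psi_1, phi_1. do 2 f_equal. ring.
Qed.

Definition dil (rho : R) (f : C -> C) (z : C) : C := f (RtoC rho * z)%C.

Lemma dil_circ rho f r th : dil rho f (circ r th) = f (circ (rho * r) th).
Proof. unfold dil. f_equal. rewrite (circ_scal r), (circ_scal (rho * r)), RtoC_mult. ring. Qed.

Lemma dil_mod rho z : 0 <= rho <= 1 -> Cmod (RtoC rho * z) <= rho * Cmod z.
Proof. intros h. rewrite Cmod_mult, Cmod_R, Rabs_pos_eq; lra. Qed.

Lemma dil_der rho f z : 0 <= rho <= 1 -> holo 1 f -> Cmod z < 1 ->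
  cder (dil rho f) z (RtoC rho * C_derive f (RtoC rho * z))%C.
Proof.
intros hr hf hz. apply (cder_comp f (fun z => (RtoC rho * z)%C)).
- apply (holo_cder 1); trivial. assert (k := dil_mod rho z hr). assert (k' := Cmod_ge_0 z). nra.
- apply (cder_eq _ _ _ _ (cder_scal (RtoC rho) _ _ _ (cder_id z))). ring.
Qed.

Lemma dil_holo rho f : 0 <= rho <= 1 -> holo 1 f -> holo 1 (dil rho f).
Proof. intros hr hf z hz. eexists. now apply dil_der. Qed.

Lemma dil_mp p rho f r : mp p (dil rho f) r = mp p f (rho * r).
Proof. apply avg_ext. intros th _. now rewrite dil_circ. Qed.

(** Otherwise all p-th power means would stay below N^p - g0, which would bound the norm by less
    than N. *)
Lemma mp_near_sup p f g0 : 1 <= p -> mem (Hardy p) f -> 0 < g0 ->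
  exists r, 0 < r < 1 /\ rpow (nrm (Hardy p) f) p - g0 < mp p f r.
Proof.
intros hp hf hg. assert (hp0 : 0 < p) by lra. apply NNPP. intros hn.
assert (hh := proj1 (analytic_holo f) (proj1 hf)).
assert (N0 := Hardy_norm_ge0 p f hf). set (N := nrm (Hardy p) f) in *.
assert (H : forall r, 0 < r < 1 -> mp p f r <= rpow N p - g0).
{ intros r hr. apply Rnot_lt_le. intros k. apply hn. now exists r. }
assert (hpos : 0 <= rpow N p - g0).
{ apply Rle_trans with (2 := H (/ 2) ltac:(lra)). apply mp_ge0; trivial. lra. }
destruct (Hardy_bound_pos p f (rpow (rpow N p - g0) (/ p)) hp hh (rpow_ge0 _ _)) as [_ k].
{ intros r hr. rewrite rpow_root' by trivial. now apply H. }
fold N in k.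
assert (k2 : rpow N p <= rpow (rpow (rpow N p - g0) (/ p)) p) by (apply rpow_le; trivial; lra).
rewrite rpow_root' in k2 by trivial. lra.
Qed.

(** Joint continuity of (rho, th) -> f(circ (rho r) th) along the compact circle rho = 1, by
    [tube]. *)
Lemma dil_circ_close f r eps : holo 1 f -> 0 < r < 1 -> 0 < eps ->
  exists rho, 0 < rho < 1 /\ forall th, 0 <= th <= 2 * PI -> Cmod (dil rho f (circ r th) - f (circ r th)) < eps.
Proof.
intros hf hr he.
set (F rho th := Cmod (f (circ (rho * r) th) - f (circ r th))).
assert (hF : forall th, 0 <= th <= 2 * PI -> rcont (fun q : R * R => F (fst q) (snd q)) (1, th)).
{ intros th _. unfold F. apply rcont_Cmod, ccont_minus.
  - apply (ccont_comp (fun q : R * R => circ (fst q * r) (snd q))). apply circ_cont; cont.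
    apply (holo_cts 1); trivial. simpl. rewrite circ_mod; lra.
  - apply (ccont_comp (fun q : R * R => circ r (snd q))). apply circ_cont; cont.
    apply (holo_cts 1); trivial. simpl. rewrite circ_mod; lra. }
destruct (tube F 1 0 (2 * PI) hF eps he) as [d hd].
set (rho := Rmax (/ 2) (1 - d / 2)). assert (dp := cond_pos d).
assert (h1 : / 2 <= rho) by apply Rmax_l. assert (h2 : 1 - d / 2 <= rho) by apply Rmax_r.
assert (h3 : rho < 1) by (apply Rmax_case; lra).
exists rho. split. lra. intros th hth.
assert (hb : ball 1 d rho).
{ change (Rabs (rho - 1) < d). rewrite Rabs_left; lra. }
assert (k := hd rho hb th hth). unfold F in k. rewrite Rmult_1_l in k.
replace (f (circ r th) - f (circ r th))%C with (RtoC 0) in k by ring.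
rewrite Cmod_0, Rminus_0_r, Rabs_pos_eq in k by apply Cmod_ge_0.
now rewrite dil_circ.
Qed.

Definition half_sum (f g : C -> C) (z : C) : C := (RtoC (/ 2) * (f z + g z))%C.

(* Half sums of f and its dilations have means close to the norm, which forces convergence by uniform
   convexity; no boundary values are needed. *)
Theorem dil_converges p f eta : 1 < p -> mem (Hardy p) f -> 0 < eta ->
  exists rho, 0 < rho < 1 /\ mem (Hardy p) (fun z => (f z - dil rho f z)%C) /\
    nrm (Hardy p) (fun z => (f z - dil rho f z)%C) <= eta.
Proof.
intros hp hf heta. assert (hp0 : 0 < p) by lra. assert (hp1 : 1 <= p) by lra.
assert (hh := proj1 (analytic_holo f) (proj1 hf)).
assert (N0 := Hardy_norm_ge0 p f hf). set (N := nrm (Hardy p) f) in *.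
assert (PN := rpow_ge0 N p). assert (Pe := rpow_gt0 eta p heta).
(* The budget eta^p is halved: the first term of [uniform_convexity] will cost at most 2 eps N^p <=
   eta^p / 2, the gap term K gam = eta^p / 2. The [+ 1] guards against N = 0. *)
set (eps := rpow eta p / (4 * (rpow N p + 1))).
assert (he : 0 < eps) by (apply Rdiv_lt_0_compat; lra).
assert (he2 : 2 * eps * rpow N p <= rpow eta p / 2).
{ unfold eps. apply Rmult_le_reg_r with (4 * (rpow N p + 1)). lra.
  replace (2 * (rpow eta p / (4 * (rpow N p + 1))) * rpow N p * (4 * (rpow N p + 1))) with (2 * rpow eta p * rpow N p) by (field; lra). nra. }
destruct (uniform_convexity p eps hp he) as [K [hK UC]].
set (gam := rpow eta p / (2 * K)).
assert (hgam : 0 < gam) by (apply Rdiv_lt_0_compat; lra).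
assert (hKg : K * gam = rpow eta p / 2) by (unfold gam; field; lra).
(* Half of gam is spent on a circle where the mean of f is nearly N^p, the other half on passing
   from f to the half sum on this circle ([low]). *)
destruct (mp_near_sup p f (gam / 2) hp1 hf ltac:(lra)) as [r0 [hr0 Hr0]]. fold N in Hr0.
destruct (rcont_locally (fun y => rpow y p) (integral_mean p f r0) (gam / 2) (rpow_cont p _ hp0) ltac:(lra)) as [d Hd].
assert (dp := cond_pos d).
destruct (dil_circ_close f r0 d hh hr0 dp) as [rho [hrho Hrho]].
exists rho. split; trivial.
assert (hdh := dil_holo rho f ltac:(lra) hh).
assert (hm := holo_minus 1 _ _ hh hdh).
assert (hhs : holo 1 (half_sum f (dil rho f))).
{ apply holo_mult. apply holo_const. now apply holo_plus. }
assert (low : rpow N p - gam <= mp p (half_sum f (dil rho f)) r0).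
{ set (Kh := integral_mean p (half_sum f (dil rho f)) r0).
  assert (hKh : 0 <= Kh) by apply integral_mean_ge0.
  assert (k1 : mp p (half_sum f (dil rho f)) r0 = rpow Kh p).
  { unfold Kh. rewrite integral_mean_eq, rpow_root'; trivial. apply mp_ge0; trivial; lra. }
  assert (k2 : mp p f r0 <= rpow (Kh + d / 2) p).
  { apply (mp_le_sup p (half_sum f (dil rho f))); trivial; try lra.
    intros th hth. unfold half_sum.
    replace (f (circ r0 th) - RtoC (/ 2) * (f (circ r0 th) + dil rho f (circ r0 th)))%C
      with (RtoC (/ 2) * (- (dil rho f (circ r0 th) - f (circ r0 th))))%C.
    2:{ replace (f (circ r0 th)) with ((RtoC (/ 2) + RtoC (/ 2)) * f (circ r0 th))%C at 2 by (rewrite RtoC_half; ring). ring. }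
    rewrite Cmod_half, Cmod_opp. specialize (Hrho th hth). lra. }
  assert (k3 : integral_mean p f r0 <= Kh + d / 2).
  { apply mean_le_iff; trivial; lra. }
  assert (M0 := integral_mean_ge0 p f r0).
  assert (E0 : rpow (integral_mean p f r0) p = mp p f r0).
  { rewrite integral_mean_eq, rpow_root'; trivial. apply mp_ge0; trivial; lra. }
  rewrite k1.
  destruct (Rle_dec (integral_mean p f r0) Kh) as [c|c].
  { assert (q := rpow_le (integral_mean p f r0) Kh p hp0 (conj M0 c)). lra. }
  assert (hb : ball (integral_mean p f r0) d Kh).
  { change (Rabs (Kh - integral_mean p f r0) < d). rewrite Rabs_left; lra. }
  specialize (Hd Kh hb). apply Rabs_def2 in Hd. lra. }
assert (cmp : forall g r, holo 1 g -> 0 <= r < 1 -> tcont (fun th => rpow (Cmod (g (circ r th))) p)) by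
  (intros g r hg hr; exact (mp_tcont p g r hp0 hg hr)).
(* Means increase with r, so [low] persists on larger circles, where N still bounds f and its
   dilation: the averaged gap is at most gam. Circles of radius at most r0 follow by monotonicity
   afterwards. *)
assert (main : forall r, r0 < r < 1 -> mp p (fun z => (f z - dil rho f z)%C) r <= rpow eta p).
{ intros r hr. assert (hr' : 0 <= r < 1) by lra.
  assert (c1 := cmp f r hh hr'). assert (c2 := cmp _ r hdh hr'). assert (c3 := cmp _ r hhs hr').
  assert (low' : rpow N p - gam <= mp p (half_sum f (dil rho f)) r).
  { apply Rle_trans with (1 := low). apply mp_mono; trivial; lra. }
  assert (m1 : mp p f r <= rpow N p) by exact (Hardy_mp_le p f r hp0 hf hr').
  assert (m2 : mp p (dil rho f) r <= rpow N p).
  { rewrite dil_mp. apply (Hardy_mp_le p f (rho * r) hp0 hf). nra. }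
  apply Rle_trans with (avg (fun th => (eps + K / 2) * (rpow (Cmod (f (circ r th))) p + rpow (Cmod (dil rho f (circ r th))) p) +
     (- K) * rpow (Cmod (half_sum f (dil rho f) (circ r th))) p)).
  - apply avg_le.
    + exact (cmp _ r hm hr').
    + intros th hth. apply rcont_plus; apply rcont_mult; try apply continuous_const; auto. apply rcont_plus; auto.
    + intros th hth. assert (k := UC (f (circ r th)) (dil rho f (circ r th))). unfold gap in k.
      unfold half_sum. rewrite Cmod_half. lra.
  - rewrite avg_plus, !avg_scal, avg_plus; trivial.
    2: intros th hth; apply rcont_plus; auto.
    2: intros th hth; apply rcont_mult; [apply continuous_const | apply rcont_plus; auto].
    2: intros th hth; apply rcont_mult; [apply continuous_const | auto].
    fold (mp p f r). fold (mp p (dil rho f) r). fold (mp p (half_sum f (dil rho f)) r).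
    set (m3 := mp p (half_sum f (dil rho f)) r) in *.
    assert (q1 : (eps + K / 2) * (mp p f r + mp p (dil rho f) r) <= (eps + K / 2) * (2 * rpow N p)) by (apply Rmult_le_compat_l; lra).
    assert (q2 : K * (rpow N p - gam) <= K * m3) by (apply Rmult_le_compat_l; lra). lra. }
apply Hardy_bound_pos; trivial; try lra.
intros r hr. destruct (Rlt_dec r0 r) as [c|c]. apply main; lra.
set (r1 := (r0 + 1) / 2).
apply Rle_trans with (2 := main r1 ltac:(unfold r1; lra)). apply mp_mono; trivial; unfold r1; lra.
Qed.

(** * Growth of the derivative *)

(** In Cauchy's formula for f' the modulus of the kernel, R0 / |w - z|^2, is R0 / (R0^2 - |z|^2)
    times the Poisson kernel, so Jensen applies. With R0 halfway between |z| and 1, the Poisson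
    kernel is at most 4 / (1 - |z|) and the prefactor at most 2 / (1 - |z|); finally 2 times 4^(1/p)
    is at most 8. *)
Lemma derivative_growth p f z : 1 <= p -> mem (Hardy p) f -> Cmod z < 1 ->
  Rpower (1 - Cmod z) (1 / p + 1) * Cmod (C_derive f z) <= 8 * nrm (Hardy p) f.
Proof.
intros hp hf hz. assert (hp0 : 0 < p) by lra. assert (hip := Rinv_0_lt_compat p hp0).
assert (hh := proj1 (analytic_holo f) (proj1 hf)). assert (kz := Cmod_ge_0 z).
assert (N0 := Hardy_norm_ge0 p f hf). set (N := nrm (Hardy p) f) in *.
set (R0 := (1 + Cmod z) / 2). set (w := 1 - Cmod z). assert (hw : 0 < w <= 1) by (unfold w; lra).
assert (h1 : Cmod z < R0) by (unfold R0; lra). assert (h2 : R0 < 1) by (unfold R0; lra).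
assert (cf : tcontC (fun th => f (circ R0 th))) by (apply (holo_circ_cont 1); trivial; lra).
assert (cu : tcontC (fun th => (f (circ R0 th) * circ R0 th)%C)).
{ intros th hth. apply ccont_mult; auto. apply circ_cont1. }
assert (cP := Pk_cont R0 z h1).
assert (cm := tcontC_mod _ cf). simpl in cm.
assert (D : Cmod (C_derive f z) <= R0 / (R0 * R0 - Cmod z * Cmod z) * avg (fun th => Cmod (f (circ R0 th)) * Pk R0 z th)).
{ rewrite (C_derive_Cauchy 1 f R0 z) by trivial. unfold Kn.
  apply Rle_trans with (1 := Cavg_mod _ (Kn_cont R0 2 _ z h1 cu)).
  rewrite <- avg_scal by (intros th hth; apply rcont_mult; auto).
  apply Req_le, avg_ext. intros th _. assert (n := circ_neq R0 z th h1).
  rewrite Cmod_div, Cmod_mult, circ_mod, Cmod_pow by (try lra; now apply Cpow_nz).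
  unfold Pk. apply Cmod_gt_0 in n. field. split; nra. }
assert (J : avg (fun th => Cmod (f (circ R0 th)) * Pk R0 z th) <= rpow (4 / w) (/ p) * N).
{ rewrite <- (rpow_root (avg _) p); trivial.
  2:{ apply avg_ge0. intros th hth; apply rcont_mult; auto. intros th _. apply Rmult_le_pos. apply Cmod_ge_0. now apply Pk_pos. }
  rewrite <- (rpow_root N p) by trivial. assert (hw4 : 0 <= 4 / w) by (apply Rdiv_le_0_compat; lra).
  rewrite <- rpow_mult by (trivial; apply rpow_ge0). apply rpow_le; trivial. split. apply rpow_ge0.
  apply Rle_trans with (avg (fun th => rpow (Cmod (f (circ R0 th))) p * Pk R0 z th)).
  - apply avg_Jensen; trivial. intros; apply Cmod_ge_0. intros; now apply Pk_pos. now apply avg_Pk.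
  - apply Rle_trans with (avg (fun th => 4 / w * rpow (Cmod (f (circ R0 th))) p)).
    + apply avg_le.
      * intros th hth. apply rcont_mult; auto. apply rcont_rpow; auto.
      * intros th hth. apply rcont_mult. apply continuous_const. apply rcont_rpow; auto.
      * intros th _. rewrite Rmult_comm. apply Rmult_le_compat_r. apply rpow_ge0.
        apply Rle_trans with (1 := Pk_le R0 z th h1).
        replace (R0 - Cmod z) with (w / 2) by (unfold R0, w; field).
        replace (4 / w) with (2 / (w / 2)) by (field; lra).
        apply Rmult_le_compat_r. apply Rlt_le, Rinv_0_lt_compat; lra. lra.
    + rewrite avg_scal by (intros th hth; apply rcont_rpow; auto).
      apply Rmult_le_compat_l; trivial. exact (Hardy_mp_le p f R0 hp0 hf ltac:(lra)). }
assert (J0 : 0 <= avg (fun th => Cmod (f (circ R0 th)) * Pk R0 z th)).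
{ apply avg_ge0. intros th hth; apply rcont_mult; auto. intros th _. apply Rmult_le_pos. apply Cmod_ge_0. now apply Pk_pos. }
assert (hq : R0 / (R0 * R0 - Cmod z * Cmod z) <= 2 / w).
{ replace (R0 * R0 - Cmod z * Cmod z) with (w / 2 * (R0 + Cmod z)) by (unfold R0, w; field).
  apply Rmult_le_reg_r with (w / 2 * (R0 + Cmod z)). apply Rmult_lt_0_compat; lra.
  replace (R0 / (w / 2 * (R0 + Cmod z)) * (w / 2 * (R0 + Cmod z))) with R0 by (field; lra).
  replace (2 / w * (w / 2 * (R0 + Cmod z))) with (R0 + Cmod z) by (field; lra). lra. }
assert (T : Cmod (C_derive f z) <= 2 / w * (rpow (4 / w) (/ p) * N)).
{ apply Rle_trans with (1 := D). apply Rmult_le_compat; trivial. apply Rdiv_le_0_compat. lra. nra. }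
rewrite <- rpow_pos_eq by lra.
apply Rmult_le_compat_l with (r := rpow w (1 / p + 1)) in T; [|apply rpow_ge0].
apply Rle_trans with (1 := T).
rewrite rpow_plus_exp, rpow_1_r by lra. replace (1 / p) with (/ p) by (field; lra).
replace (rpow w (/ p) * w * (2 / w * (rpow (4 / w) (/ p) * N))) with (2 * (rpow w (/ p) * rpow (4 / w) (/ p)) * N) by (field; lra).
rewrite <- rpow_mult by (try lra; apply Rdiv_le_0_compat; lra).
replace (w * (4 / w)) with 4 by (field; lra).
apply Rmult_le_compat_r; trivial.
assert (rpow 4 (/ p) <= 4).
{ assert (hi1 : / p <= 1) by (rewrite <- Rinv_1; apply Rinv_le_contravar; lra).
  assert (k := Bernoulli_concave 4 (/ p) (conj hip hi1) ltac:(lra)). lra. }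
lra.
Qed.

(** Split F' into the derivatives of F - F_rho, small in the weighted sense since its norm is small,
    and of the dilation F_rho, bounded on D, which the weight makes negligible near the circle. *)
Theorem dom_growth0 t p f : 1 < p -> 0 <= t <= 1 -> mem (opt_dom (C_op t) (Hardy p)) f ->
  growth0 (1 / p + 1) f.
Proof.
intros hp ht hf. assert (hp1 : 1 <= p) by lra. assert (hp0 : 0 < p) by lra. assert (hip := Rinv_0_lt_compat p hp0).
assert (hh := dom_holo _ _ _ hf). split. exact (proj1 hf).
set (F := prim t f). assert (hF : mem (Hardy p) F) by now apply C_op_mem_prim.
assert (hFh := proj1 (analytic_holo F) (proj1 hF)).
set (gam := 1 / p + 1). assert (hgam : 0 < gam) by (unfold gam, Rdiv; lra).
intros eps he.
(* With the factor 8 of [derivative_growth] and |1 - tz| <= 2 this part costs eps / 4. *)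
destruct (dil_converges p F (eps / 64) hp hF ltac:(lra)) as [rho [hrho [hm hn]]].
set (B := 8 * nrm (Hardy p) F / Rpower (1 - rho) gam).
assert (N0 := Hardy_norm_ge0 p F hF). assert (P1 : 0 < Rpower (1 - rho) gam) by apply exp_pos.
assert (hB : 0 <= B) by (apply Rdiv_le_0_compat; lra).
(* B bounds F' on |z| <= rho. Where the weight is below x, the bounded part costs at most 2 times
   eps / 4. *)
set (x := eps / (4 * (B + 1))). assert (hx : 0 < x) by (apply Rdiv_lt_0_compat; lra).
exists (rpow x (/ gam)). split. now apply rpow_gt0.
intros z [hz1 hz2]. set (w := 1 - Cmod z). assert (hw : 0 < w) by (unfold w; lra).
assert (Pw : Rpower w gam < x).
{ rewrite <- rpow_pos_eq by trivial. rewrite <- (rpow_root' x gam) by lra. apply rpow_lt; trivial. unfold w; lra. }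
assert (Pw0 : 0 < Rpower w gam) by apply exp_pos.
assert (Ef : f z = (den t z * C_derive F z)%C).
{ unfold F. rewrite (C_derive_eq _ _ _ (prim_der t f z ht hh hz2)). field. now apply den_neq0. }
assert (hden : Cmod (den t z) <= 2).
{ unfold den, Cminus. apply Rle_trans with (1 := Cmod_triangle _ _).
  rewrite Cmod_1, Cmod_opp, Cmod_mult, Cmod_R, Rabs_pos_eq by lra. assert (k := Cmod_ge_0 z). nra. }
assert (dF := holo_cder 1 F z hFh hz2).
assert (dG := cder_minus _ _ _ _ _ dF (dil_der rho F z ltac:(lra) hFh hz2)).
apply C_derive_eq in dG.
assert (k1 := derivative_growth p _ z hp1 hm hz2). rewrite dG in k1. fold gam w in k1.
set (zr := (RtoC rho * z)%C) in *.
assert (hzr : Cmod zr <= rho) by (assert (q := dil_mod rho z ltac:(lra)); assert (q' := Cmod_ge_0 z); unfold zr; nra).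
assert (k2 := derivative_growth p F zr hp1 hF ltac:(lra)). fold gam in k2.
assert (k3 : Cmod (C_derive F zr) <= B).
{ unfold B. apply Rmult_le_reg_r with (Rpower (1 - rho) gam); trivial.
  replace (8 * nrm (Hardy p) F / Rpower (1 - rho) gam * Rpower (1 - rho) gam) with (8 * nrm (Hardy p) F) by (field; lra).
  apply Rle_trans with (2 := k2). rewrite Rmult_comm. apply Rmult_le_compat_r. apply Cmod_ge_0.
  apply Rle_Rpower_l; lra. }
assert (k4 : Cmod (C_derive F z) <= Cmod (C_derive F z - RtoC rho * C_derive F zr) + B).
{ replace (C_derive F z) with (C_derive F z - RtoC rho * C_derive F zr + RtoC rho * C_derive F zr)%C at 1 by ring.
  apply Rle_trans with (1 := Cmod_triangle _ _). apply Rplus_le_compat_l.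
  rewrite Cmod_mult, Cmod_R, Rabs_pos_eq by lra. assert (q := Cmod_ge_0 (C_derive F zr)). nra. }
rewrite Ef, Cmod_mult.
assert (q0 := Cmod_ge_0 (C_derive F z)). assert (q1 := Cmod_ge_0 (den t z)).
apply Rle_lt_trans with (2 * (Rpower w gam * Cmod (C_derive F z))).
{ replace (Rpower w gam * (Cmod (den t z) * Cmod (C_derive F z))) with (Cmod (den t z) * (Rpower w gam * Cmod (C_derive F z))) by ring.
  apply Rmult_le_compat_r; trivial. apply Rmult_le_pos; lra. }
apply Rmult_le_compat_l with (r := Rpower w gam) in k4; [|lra].
rewrite Rmult_plus_distr_l in k4.
assert (k5 : Rpower w gam * B <= x * (B + 1)) by (apply Rmult_le_compat; lra).
replace (x * (B + 1)) with (eps / 4) in k5 by (unfold x; field; lra).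
lra.
Qed.

(** * Lacunary series *)

Fixpoint csum (c : nat -> C) (K : nat) : C :=
  match K with O => RtoC 0 | S k => (csum c k + c k)%C end.

Lemma half_pow_pos k : 0 < (/ 2) ^ k.
Proof. apply pow_lt. lra. Qed.

Lemma csum_tail c D K j : 0 <= D -> (forall k, Cmod (c k) <= D * (/ 2) ^ k) ->
  Cmod (csum c (j + K) - csum c K) <= 2 * D * ((/ 2) ^ K - (/ 2) ^ (j + K)).
Proof.
intros hD hc. induction j as [|j IH]; simpl.
- replace (csum c K - csum c K)%C with (RtoC 0) by ring. rewrite Cmod_0. lra.
- replace (csum c (j + K) + c (j + K)%nat - csum c K)%C
    with (csum c (j + K) - csum c K + c (j + K)%nat)%C by ring.
  apply Rle_trans with (1 := Cmod_triangle _ _). assert (h := hc (j + K)%nat). lra.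
Qed.

Lemma csum_bound c D K : 0 <= D -> (forall k, Cmod (c k) <= D * (/ 2) ^ k) -> Cmod (csum c K) <= 2 * D.
Proof.
intros hD hc. assert (h := csum_tail c D 0 K hD hc). rewrite Nat.add_0_r in h. simpl in h.
replace (csum c K - 0)%C with (csum c K) in h by ring.
assert (k := half_pow_pos K). nra.
Qed.

Lemma csum_lim c D : 0 <= D -> (forall k, Cmod (c k) <= D * (/ 2) ^ k) ->
  exists s, forall K, Cmod (csum c K - s) <= 2 * D * (/ 2) ^ K.
Proof.
intros hD hc.
assert (tl : forall K L, (K <= L)%nat -> Cmod (csum c L - csum c K) <= 2 * D * (/ 2) ^ K).
{ intros K L hKL. replace L with ((L - K) + K)%nat by lia.
  apply Rle_trans with (1 := csum_tail c D K (L - K) hD hc).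
  assert (k := half_pow_pos (L - K + K)). nra. }
destruct (C_cauchy (csum c)) as [s hs].
{ intros eps he. destruct (pow_half_small (eps / 2) (2 * D)) as [N hN]; [lra | lra |].
  unfold Rdiv in hN at 1. rewrite <- pow_inv in hN.
  exists N. intros n m hn hm.
  replace (csum c n - csum c m)%C with (csum c n - csum c N - (csum c m - csum c N))%C by ring.
  unfold Cminus at 1. apply Rle_lt_trans with (1 := Cmod_triangle _ _). rewrite Cmod_opp.
  assert (k1 := tl N n hn). assert (k2 := tl N m hm). lra. }
exists s. intros K. apply le_epsilon. intros eps he. destruct (hs eps he) as [N hN].
specialize (hN (max K N) ltac:(lia)). assert (k := tl K (max K N) ltac:(lia)).
replace (csum c K - s)%C with (csum c K - csum c (max K N) + (csum c (max K N) - s))%C by ring.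
apply Rle_trans with (1 := Cmod_triangle _ _). rewrite Cmod_sym in k. lra.
Qed.

(** From ln s < s at s = y / q. *)
Lemma pow_exp_bound y q : 0 < q -> 0 <= y -> rpow y q <= rpow q q * exp y.
Proof.
intros hq [hy|<-].
2:{ rewrite rpow_0. apply Rmult_le_pos. apply rpow_ge0. apply Rlt_le, exp_pos. }
replace y with (q * (y / q)) at 1 by (field; lra).
assert (hd : 0 < y / q) by (apply Rdiv_lt_0_compat; trivial).
rewrite rpow_mult by lra. apply Rmult_le_compat_l. apply rpow_ge0.
rewrite rpow_pos_eq by trivial. unfold Rpower. apply Rlt_le, exp_increasing.
assert (k : ln (y / q) < y / q).
{ apply exp_lt_inv. rewrite exp_ln by trivial. assert (h := exp_ineq1 (y / q)). lra. }
apply Rmult_lt_compat_l with (r := q) in k; trivial. replace (q * (y / q)) with y in k by (field; lra). trivial.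
Qed.

(** With x = 1 - r one has r^(n-1) <= e^(-nx) e^x and e^x <= 3, while (nx)^q <= q^q e^(nx). The
    bound depends on neither n nor r. *)
Lemma monomial_growth n q r : 0 < q -> (1 <= n)%nat -> 0 <= r < 1 ->
  rpow (INR n) q * r ^ (pred n) * rpow (1 - r) q <= 3 * rpow q q.
Proof.
intros hq hn hr. set (x := 1 - r).
assert (hx : 0 < x <= 1) by (unfold x; lra). assert (hn0 : 0 <= INR n) by apply pos_INR.
assert (k1 : r <= exp (- x)). { assert (h := exp_ineq1_le (- x)). unfold x in *. lra. }
assert (k2 : r ^ pred n <= exp (- x) ^ pred n) by (apply pow_incr; lra).
assert (k3 : exp (- x) ^ pred n = exp (- (INR n * x)) * exp x).
{ rewrite <- exp_plus. replace (- (INR n * x) + x) with (INR (pred n) * - x).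
  - clear k2. induction (pred n) as [|m IH]. simpl. rewrite Rmult_0_l, exp_0. trivial.
    rewrite S_INR. simpl. rewrite IH, <- exp_plus. f_equal. ring.
  - destruct n as [|j]. lia. rewrite S_INR. simpl. ring. }
assert (k4 : exp x <= 3). { apply Rle_trans with (exp 1). destruct (Req_dec x 1) as [->|]. lra. apply Rlt_le, exp_increasing; lra. apply exp_le_3. }
assert (k5 := pow_exp_bound (INR n * x) q hq ltac:(apply Rmult_le_pos; lra)).
rewrite rpow_mult in k5 by lra.
assert (p0 : 0 <= rpow (INR n) q) by apply rpow_ge0. assert (p1 : 0 <= rpow x q) by apply rpow_ge0.
assert (p2 := rpow_ge0 q q).
replace (rpow (INR n) q * r ^ pred n * rpow x q) with (rpow (INR n) q * rpow x q * r ^ pred n) by ring.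
apply Rle_trans with (rpow q q * exp (INR n * x) * (exp (- (INR n * x)) * exp x)).
- rewrite <- k3. apply Rmult_le_compat; trivial. now apply Rmult_le_pos. apply pow_le; lra.
- replace (rpow q q * exp (INR n * x) * (exp (- (INR n * x)) * exp x)) with (rpow q q * (exp (INR n * x) * exp (- (INR n * x))) * exp x) by ring.
  rewrite <- exp_plus, Rplus_opp_r, exp_0, Rmult_1_r, Rmult_comm. apply Rmult_le_compat_r; trivial.
Qed.

(** By [monomial_growth], [lac_le] makes the k-th term of the differentiated series, times (1 -
    |z|)^q, at most a constant times 2^-k. The gaps come from the exponents N^k used later. *)
Record lacunary (b : nat -> R) (n : nat -> nat) (q : R) : Prop := {
  lac_b : forall k, 0 <= b k;
  lac_n : forall k, (1 <= n k)%nat;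
  lac_q : 0 < q;
  lac_le : forall k, b k * INR (n k) <= (/ 2) ^ k * rpow (INR (n k)) q }.

Definition Psum (b : nat -> R) (n : nat -> nat) (K : nat) (z : C) : C :=
  csum (fun k => (RtoC (b k) * Cpow z (n k))%C) K.
Definition Ssum (b : nat -> R) (n : nat -> nat) (K : nat) (z : C) : C :=
  csum (fun k => (RtoC (b k * INR (n k)) * Cpow z (pred (n k)))%C) K.

Lemma Psum_der b n K z : cder (Psum b n K) z (Ssum b n K z).
Proof.
unfold Psum, Ssum. induction K as [|K IH]; simpl. apply cder_const.
apply (cder_eq _ _ _ _ (cder_plus _ _ _ _ _ IH (cder_scal (RtoC (b K)) _ _ _ (cder_pow z (n K))))).
rewrite RtoC_mult. ring.
Qed.

Lemma Ssum_holo b n K rho : holo rho (Ssum b n K).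
Proof.
unfold Ssum. induction K as [|K IH]; simpl. apply holo_const.
apply holo_plus; trivial. apply holo_mult. apply holo_const. apply holo_pow.
Qed.

Lemma Psum_holo b n K rho : holo rho (Psum b n K).
Proof. intros z _. eexists. apply Psum_der. Qed.

Lemma Cpow_0_pos m : (1 <= m)%nat -> Cpow (RtoC 0) m = RtoC 0.
Proof. intros h. destruct m as [|m]. lia. simpl. ring. Qed.

Lemma Psum_0 b n K : (forall k, (1 <= n k)%nat) -> Psum b n K (RtoC 0) = RtoC 0.
Proof.
intros hn. unfold Psum. induction K as [|K IH]; simpl; trivial.
rewrite IH, Cpow_0_pos by trivial. ring.
Qed.

Lemma Sterm_bound b n q z k : lacunary b n q -> Cmod z < 1 ->
  Cmod (RtoC (b k * INR (n k)) * Cpow z (pred (n k))) <= 3 * rpow q q / rpow (1 - Cmod z) q * (/ 2) ^ k.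
Proof.
intros [hb hn hq hl] hz. assert (kz := Cmod_ge_0 z).
assert (hx : 0 < rpow (1 - Cmod z) q) by (apply rpow_gt0; lra).
assert (hbn : 0 <= b k * INR (n k)) by (apply Rmult_le_pos; [apply hb | apply pos_INR]).
rewrite Cmod_mult, Cmod_R, Rabs_pos_eq, Cmod_pow by trivial.
assert (g := monomial_growth (n k) q (Cmod z) hq (hn k) (conj kz hz)).
apply Rle_trans with ((/ 2) ^ k * rpow (INR (n k)) q * Cmod z ^ pred (n k)).
- apply Rmult_le_compat_r; auto. now apply pow_le.
- apply Rmult_le_reg_r with (1 := hx).
  replace (3 * rpow q q / rpow (1 - Cmod z) q * (/ 2) ^ k * rpow (1 - Cmod z) q) with ((/ 2) ^ k * (3 * rpow q q)) by (field; lra).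
  rewrite !Rmult_assoc. apply Rmult_le_compat_l. apply Rlt_le, half_pow_pos. lra.
Qed.

Lemma lac_limit b n q : lacunary b n q -> exists S : C -> C, forall z K, Cmod z < 1 ->
  Cmod (Ssum b n K z - S z) <= 6 * rpow q q / rpow (1 - Cmod z) q * (/ 2) ^ K.
Proof.
intros hl.
assert (H : forall z, exists s, Cmod z < 1 -> forall K, Cmod (Ssum b n K z - s) <= 6 * rpow q q / rpow (1 - Cmod z) q * (/ 2) ^ K).
{ intros z. destruct (Rlt_dec (Cmod z) 1) as [hz|hz]. 2: now exists (RtoC 0).
  assert (hD : 0 <= 3 * rpow q q / rpow (1 - Cmod z) q).
  { apply Rdiv_le_0_compat. assert (k := rpow_ge0 q q). lra. apply rpow_gt0. lra. }
  destruct (csum_lim _ _ hD (fun k => Sterm_bound b n q z k hl hz)) as [s hs].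
  exists s. intros _ K. apply Rle_trans with (1 := hs K). apply Req_le. unfold Rdiv. ring. }
exists (fun z => proj1_sig (constructive_indefinite_description _ (H z))).
intros z K hz. exact (proj2_sig (constructive_indefinite_description _ (H z)) hz K).
Qed.

Lemma lac_lu b n q S : lacunary b n q ->
  (forall z K, Cmod z < 1 -> Cmod (Ssum b n K z - S z) <= 6 * rpow q q / rpow (1 - Cmod z) q * (/ 2) ^ K) ->
  lu_lim (Ssum b n) S.
Proof.
intros hl hS R0 hR eps he.
assert (hq := lac_q _ _ _ hl).
set (D := 6 * rpow q q / rpow (1 - R0) q).
assert (hx : 0 < rpow (1 - R0) q) by (apply rpow_gt0; lra).
assert (hD : 0 <= D) by (apply Rdiv_le_0_compat; trivial; assert (k := rpow_ge0 q q); lra).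
destruct (pow_half_small eps D he hD) as [N hN]. unfold Rdiv in hN. rewrite <- pow_inv in hN.
exists N. intros K z hK hz.
apply Rle_lt_trans with (1 := hS z K ltac:(lra)). apply Rle_lt_trans with (2 := hN).
apply Rmult_le_compat. apply Rdiv_le_0_compat. assert (k := rpow_ge0 q q); lra. apply rpow_gt0; lra.
apply Rlt_le, half_pow_pos.
- apply Rmult_le_compat_l. assert (k := rpow_ge0 q q); lra. apply Rinv_le_contravar; trivial. apply rpow_le; lra.
- replace K with (N + (K - N))%nat by lia. rewrite pow_add. rewrite <- (Rmult_1_r ((/ 2) ^ N)) at 2.
  apply Rmult_le_compat_l. apply Rlt_le, half_pow_pos. apply (pow_01 (/ 2)). lra.
Qed.

Lemma lu_lim_den t u S : 0 <= t <= 1 -> lu_lim u S -> lu_lim (fun K z => (den t z * u K z)%C) (fun z => (den t z * S z)%C).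
Proof.
intros ht h R0 hR eps he. destruct (h R0 hR (eps / 2) ltac:(lra)) as [N hN].
exists N. intros n z hn hz. specialize (hN n z hn hz).
replace (den t z * u n z - den t z * S z)%C with (den t z * (u n z - S z))%C by ring.
rewrite Cmod_mult.
assert (hden : Cmod (den t z) <= 2).
{ unfold den, Cminus. apply Rle_trans with (1 := Cmod_triangle _ _).
  rewrite Cmod_1, Cmod_opp, Cmod_mult, Cmod_R, Rabs_pos_eq by lra. assert (k := Cmod_ge_0 z). nra. }
assert (k := Cmod_ge_0 (u n z - S z)%C). nra.
Qed.

(** The factors 1 - tz cancel under the integral, and a segment in D has length below 1 from 0. *)
Lemma prim_lu t u S : 0 <= t <= 1 -> (forall K, holo 1 (u K)) -> holo 1 S -> lu_lim u S ->
  lu_lim (fun K => prim t (fun z => (den t z * u K z)%C)) (prim t (fun z => (den t z * S z)%C)).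
Proof.
intros ht hu hS h R0 hR eps he. destruct (h R0 hR (eps / 2) ltac:(lra)) as [N hN].
exists N. intros n z hn hz. assert (hz1 : Cmod z < 1) by lra. assert (h0 : Cmod (RtoC 0) < 1) by (rewrite Cmod_0; lra).
unfold prim.
assert (E : forall v, holo 1 v -> seg (fun xi => (den t xi * v xi / den t xi)%C) (RtoC 0) z = seg v (RtoC 0) z).
{ intros v hv. apply CI_ext. lra. intros s hs. f_equal. field. apply den_neq0; trivial. now apply seg_pt_lt. }
rewrite (E (u n)), (E S) by trivial.
assert (c1 : ccball 1 (u n)) by exact (holo_cts _ _ (hu n)). assert (c2 : ccball 1 S) by exact (holo_cts _ _ hS).
assert (c3 : ccball 1 (fun z => (u n z - S z)%C)) by exact (holo_cts _ _ (holo_minus _ _ _ (hu n) hS)).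
replace (seg (u n) (RtoC 0) z - seg S (RtoC 0) z)%C with (seg (fun z => (u n z - S z)%C) (RtoC 0) z).
2:{ replace (seg (u n) (RtoC 0) z) with (seg (fun z => (u n z - S z)%C) (RtoC 0) z + seg S (RtoC 0) z)%C. ring.
    rewrite <- (seg_plus 1) by trivial. apply CI_ext. lra. intros; f_equal; ring. }
apply Rle_lt_trans with (Cmod (z - 0) * (eps / 2)).
- apply (seg_bound 1); trivial. intros s hs. apply Rlt_le, hN; trivial.
  apply Rle_trans with (Cmod z); trivial. apply seg_pt_le; try lra. rewrite Cmod_0. apply Cmod_ge_0.
- replace (z - 0)%C with z by ring. assert (k := Cmod_ge_0 z). nra.
Qed.

Lemma prim_Ssum t b n K z : 0 <= t <= 1 -> (forall k, (1 <= n k)%nat) -> Cmod z < 1 ->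
  prim t (fun z => (den t z * Ssum b n K z)%C) z = Psum b n K z.
Proof.
intros ht hn. apply (prim_FTC t _ (Psum b n K)); trivial.
- apply holo_mult. apply den_holo. apply Ssum_holo.
- intros w hw. apply (cder_eq _ _ _ _ (Psum_der b n K w)). field. now apply den_neq0.
- now apply Psum_0.
Qed.

(** * Taylor coefficients *)

(** A Fourier coefficient: for u th = Q(circ r th) it is r^l times the l-th Taylor coefficient of
    Q. *)
Definition coef (l : nat) (u : R -> C) : C := Cavg (fun th => (u th * Cpow (Cconj (circ 1 th)) l)%C).

Lemma coef_cont l u : tcontC u -> tcontC (fun th => (u th * Cpow (Cconj (circ 1 th)) l)%C).
Proof.
intros hu th hth. assert (k := hu th hth). assert (k' := circ_cont1 1 th). cont.
Qed.

Lemma coef_plus l u v : tcontC u -> tcontC v -> coef l (fun th => (u th + v th)%C) = (coef l u + coef l v)%C.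
Proof.
intros hu hv. unfold coef. rewrite <- Cavg_plus by now apply coef_cont.
apply Cavg_ext. intros; ring.
Qed.

Lemma coef_scal l c u : tcontC u -> coef l (fun th => (c * u th)%C) = (c * coef l u)%C.
Proof.
intros hu. unfold coef. rewrite <- Cavg_scal by now apply coef_cont.
apply Cavg_ext. intros; ring.
Qed.

Lemma circ1_inv th : (circ 1 th * Cconj (circ 1 th))%C = RtoC 1.
Proof. rewrite circ_conj. now rewrite Rmult_1_r. Qed.

Lemma circ_conj_pder th : pder (fun th => Cconj (circ 1 th)) th (- (Ci * Cconj (circ 1 th)))%C.
Proof. split; unfold circ, Cconj, Re, Im; simpl; auto_derive; trivial; ring. Qed.

Lemma pder_mult u v s l m : pder u s l -> pder v s m ->
  pder (fun x => (u x * v x)%C) s (l * v s + u s * m)%C.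
Proof.
intros [u1 u2] [v1 v2].
assert (M : forall a b a' b', is_derive a s a' -> is_derive b s b' -> is_derive (fun x => a x * b x) s (a' * b s + a s * b')).
{ intros a b a' b' ha hb. apply (is_derive_mult a b s a' b' ha hb). intros; apply Rmult_comm. }
split.
- assert (k := is_derive_minus (V := R_NormedModule) _ _ s _ _ (M _ _ _ _ u1 v1) (M _ _ _ _ u2 v2)).
  apply (is_derive_ext (fun x => Re (u x) * Re (v x) - Im (u x) * Im (v x))). intros; reflexivity.
  match type of k with is_derive _ _ ?X => replace (Re (l * v s + u s * m)) with X end.
  exact k. unfold minus, plus, opp, Re, Im; simpl. ring.
- assert (k := is_derive_plus (V := R_NormedModule) _ _ s _ _ (M _ _ _ _ u1 v2) (M _ _ _ _ u2 v1)).
  apply (is_derive_ext (fun x => Re (u x) * Im (v x) + Im (u x) * Re (v x))). intros; reflexivity.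
  match type of k with is_derive _ _ ?X => replace (Im (l * v s + u s * m)) with X end.
  exact k. unfold plus, Re, Im; simpl. ring.
Qed.

(** Orthogonality: for m <> l the integrand is the derivative of a periodic function, itself divided
    by i (m - l). *)
Lemma coef_pow l m r : coef l (fun th => Cpow (circ r th) m) = if Nat.eq_dec m l then RtoC (r ^ l) else RtoC 0.
Proof.
destruct (Nat.eq_dec m l) as [->|n].
- unfold coef. rewrite (Cavg_ext _ (fun _ => RtoC (r ^ l))). apply Cavg_const.
  intros th _. rewrite <- Cpow_mult_l. rewrite (circ_scal r), <- Cmult_assoc, circ1_inv, Cmult_1_r.
  induction l; simpl; trivial. rewrite IHl. now rewrite RtoC_mult.
- unfold coef. set (d := INR m - INR l).
  assert (hd : RtoC d <> RtoC 0).
  { intros e. apply RtoC_inj in e. apply n, INR_eq. unfold d in e. lra. }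
  apply (Cavg_der (fun th => (/ (Ci * RtoC d) * (Cpow (circ r th) m * Cpow (Cconj (circ 1 th)) l))%C)).
  + intros th _.
    assert (k1 := pder_comp (fun z => Cpow z m) (circ r) th _ _ (cder_pow _ m) (circ_pder r th)).
    assert (k2 := pder_comp (fun z => Cpow z l) _ th _ _ (cder_pow _ l) (circ_conj_pder th)).
    apply (pder_eq _ _ _ _ (pder_scal _ _ _ _ (pder_mult _ _ _ _ _ k1 k2))).
    cbv beta. set (w := circ r th). set (w' := Cconj (circ 1 th)).
    assert (P : forall z j, (z * (RtoC (INR j) * Cpow z (pred j)))%C = (RtoC (INR j) * Cpow z j)%C).
    { intros z j. destruct j as [|j]. simpl. ring. simpl Nat.pred. simpl Cpow. ring. }
    replace (Ci * w * (RtoC (INR m) * Cpow w (pred m)) * Cpow w' l + Cpow w m * ((- (Ci * w')) * (RtoC (INR l) * Cpow w' (pred l))))%C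
     with (Ci * (w * (RtoC (INR m) * Cpow w (pred m)) * Cpow w' l - Cpow w m * (w' * (RtoC (INR l) * Cpow w' (pred l)))))%C by ring.
    rewrite !P. replace (RtoC (INR m)) with (RtoC d + RtoC (INR l))%C by (rewrite <- RtoC_plus; f_equal; unfold d; ring).
    field. split; trivial. apply Ci_nz.
  + apply coef_cont. intros th _. assert (k := circ_cont1 r th). cont.
  + now rewrite !circ_period.
Qed.

Lemma coef_csum l (c : nat -> C) (m : nat -> nat) r K :
  coef l (fun th => csum (fun k => (c k * Cpow (circ r th) (m k))%C) K) =
  csum (fun k => if Nat.eq_dec (m k) l then (c k * RtoC (r ^ l))%C else RtoC 0) K.
Proof.
assert (cc : forall k, tcontC (fun th => (c k * Cpow (circ r th) (m k))%C)).
{ intros k th _. assert (q := circ_cont1 r th). cont. }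
assert (cs : forall K, tcontC (fun th => csum (fun k => (c k * Cpow (circ r th) (m k))%C) K)).
{ intros K' th hth. induction K' as [|k IH]; simpl. apply continuous_const. apply ccont_plus; trivial. now apply cc. }
induction K as [|K IH]; simpl.
- unfold coef. rewrite (Cavg_ext _ (fun _ => RtoC 0)). apply Cavg_const. intros; ring.
- rewrite coef_plus by auto. rewrite IH. f_equal.
  rewrite coef_scal by (intros th _; assert (q := circ_cont1 r th); cont).
  rewrite coef_pow. destruct (Nat.eq_dec (m K) l); trivial. ring.
Qed.

Lemma csum_single (c : nat -> C) j K : (j < K)%nat -> (forall k, k <> j -> c k = RtoC 0) -> csum c K = c j.
Proof.
intros hj hc.
assert (Z : forall K, (K <= j)%nat -> csum c K = RtoC 0).
{ induction K0 as [|K0 IH]; simpl; trivial. intros h. rewrite IH, hc by lia. ring. }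
induction K as [|K IH]. lia. simpl.
destruct (Nat.eq_dec j K) as [->|n]. rewrite Z by lia. ring.
rewrite IH, (hc K) by lia. ring.
Qed.

Lemma csum_zero (c : nat -> C) K : (forall k, c k = RtoC 0) -> csum c K = RtoC 0.
Proof. intros hc. induction K as [|K IH]; simpl; trivial. rewrite IH, hc. ring. Qed.

(** On a circle of radius r < 1 the approximants converge uniformly, so |c| r^l is at most the mean
    of |u| there, hence at most the norm; then r tends to 1. The coefficient of the approximants is
    asked to be stationary, which spares any limit of coefficients. *)
Lemma coef_le l c Q u : (forall K, holo 1 (Q K)) -> lu_lim Q u -> mem (Hardy 1) u ->
  (exists K0, forall K r, (K0 <= K)%nat -> 0 < r < 1 -> coef l (fun th => Q K (circ r th)) = (c * RtoC (r ^ l))%C) ->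
  Cmod c <= nrm (Hardy 1) u.
Proof.
intros hQ hl hu [K0 hc]. assert (hh := proj1 (analytic_holo u) (proj1 hu)).
set (A := nrm (Hardy 1) u).
assert (step : forall r, 0 < r < 1 -> Cmod c * r ^ l <= A).
{ intros r hr. apply le_epsilon. intros eps he.
  destruct (hl r (proj2 hr) eps he) as [N hN]. set (K := max K0 N).
  specialize (hc K r ltac:(lia) hr).
  assert (cQ : tcontC (fun th => Q K (circ r th))) by (apply (holo_circ_cont 1); trivial; lra).
  assert (cu : tcontC (fun th => u (circ r th))) by (apply (holo_circ_cont 1); trivial; lra).
  replace (Cmod c * r ^ l) with (Cmod (c * RtoC (r ^ l))) by
    (rewrite Cmod_mult, Cmod_R, Rabs_pos_eq; trivial; apply pow_le; lra).
  rewrite <- hc. unfold coef. apply Rle_trans with (1 := Cavg_mod _ (coef_cont l _ cQ)).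
  apply Rle_trans with (avg (fun th => Cmod (u (circ r th)) + eps)).
  - apply avg_le. apply tcontC_mod, coef_cont, cQ.
    intros th hth. apply rcont_plus. now apply rcont_Cmod, cu. apply continuous_const.
    intros th _. rewrite Cmod_mult, Cmod_pow, Cmod_conj, circ_mod, pow1, Rmult_1_r by lra.
    replace (Q K (circ r th)) with (u (circ r th) + (Q K (circ r th) - u (circ r th)))%C by ring.
    apply Rle_trans with (1 := Cmod_triangle _ _). apply Rplus_le_compat_l.
    apply Rlt_le, hN. unfold K; lia. rewrite circ_mod; lra.
  - rewrite (avg_plus (fun th => Cmod (u (circ r th))) (fun _ => eps)).
    2: now apply tcontC_mod. 2: intros th _; apply continuous_const.
    rewrite avg_const. apply Rplus_le_compat_r. apply Hardy_M1_le; trivial; lra. }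
apply Rnot_lt_le. intros hlt. assert (A0 : 0 <= A) by now apply Hardy_norm_ge0.
set (B := Cmod c) in *.
assert (hcp : rcont (fun r : R => B * r ^ l) 1) by cont.
destruct (rcont_locally _ _ (B - A) hcp ltac:(lra)) as [d hd]. assert (dp := cond_pos d).
set (r := Rmax (/ 2) (1 - d / 2)).
assert (r1 : / 2 <= r) by apply Rmax_l. assert (r2 : 1 - d / 2 <= r) by apply Rmax_r.
assert (r3 : r < 1) by (apply Rmax_case; lra).
assert (hb : ball 1 d r). { change (Rabs (r - 1) < d). rewrite Rabs_left; lra. }
specialize (hd r hb). simpl in hd. rewrite pow1 in hd. apply Rabs_def2 in hd.
assert (k := step r ltac:(lra)). lra.
Qed.

(** * Strictness of the inclusions *)

Lemma npow_mono N k j : (4 <= N)%nat -> (k < j)%nat -> (4 * N ^ k <= N ^ j)%nat.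
Proof.
intros hN hkj. replace (N ^ j)%nat with (N ^ k * (N * N ^ (j - S k)))%nat.
- rewrite Nat.mul_comm. apply Nat.mul_le_mono_l.
  assert (1 <= N ^ (j - S k))%nat by (apply Nat.neq_0_lt_0, Nat.pow_nonzero; lia). nia.
- replace j with (k + S (j - S k))%nat at 2 by lia. now rewrite Nat.pow_add_r.
Qed.

Lemma npow_ge1 N k : (4 <= N)%nat -> (1 <= N ^ k)%nat.
Proof. intros hN. apply Nat.neq_0_lt_0, Nat.pow_nonzero; lia. Qed.

Lemma npow_inj N k j : (4 <= N)%nat -> (N ^ k = N ^ j)%nat -> k = j.
Proof.
intros hN e. assert (h1 := npow_ge1 N k hN). assert (h2 := npow_ge1 N j hN).
destruct (Nat.lt_trichotomy k j) as [h|[h|h]]; trivial.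
assert (q := npow_mono N k j hN h). lia. assert (q := npow_mono N j k hN h). lia.
Qed.

(** Multiplication by 1 - tz adds the exponents N^k to the exponents N^k - 1 of F'. The two families
    must not meet, or coefficients could cancel. *)
Lemma npow_neq_pred N k j : (4 <= N)%nat -> (N ^ k <> pred (N ^ j))%nat.
Proof.
intros hN e. assert (h1 := npow_ge1 N k hN). assert (h2 := npow_ge1 N j hN).
destruct (Nat.lt_trichotomy k j) as [h|[h|h]].
- assert (q := npow_mono N k j hN h). lia.
- subst k. lia.
- assert (q := npow_mono N j k hN h). lia.
Qed.

Lemma coef_Psum b N j : (4 <= N)%nat -> exists K0, forall K r, (K0 <= K)%nat -> 0 < r < 1 ->
  coef (N ^ j) (fun th => Psum b (Nat.pow N) K (circ r th)) = (RtoC (b j) * RtoC (r ^ (N ^ j)))%C.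
Proof.
intros hN. exists (S j). intros K r hK _. unfold Psum.
rewrite (coef_csum (N ^ j) (fun k => RtoC (b k)) (Nat.pow N)).
rewrite (csum_single _ j) by (try lia; intros k hk; destruct (Nat.eq_dec (N ^ k) (N ^ j)) as [e|]; trivial;
  apply npow_inj in e; trivial; contradiction).
destruct (Nat.eq_dec (N ^ j) (N ^ j)); trivial. contradiction.
Qed.

(** Of the two families of exponents in (1 - tz) F' only N^k - 1 contains N^j - 1, and only for k =
    j, so t does not enter the coefficient. *)
Lemma coef_den_Ssum t b N j : (4 <= N)%nat -> exists K0, forall K r, (K0 <= K)%nat -> 0 < r < 1 ->
  coef (pred (N ^ j)) (fun th => (den t (circ r th) * Ssum b (Nat.pow N) K (circ r th))%C) =
  (RtoC (b j * INR (N ^ j)) * RtoC (r ^ (pred (N ^ j))))%C.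
Proof.
intros hN. exists (S j). intros K r hK _.
set (c k := RtoC (b k * INR (N ^ k))). set (l := pred (N ^ j)).
assert (c1 : tcontC (fun th => Ssum b (Nat.pow N) K (circ r th))).
{ intros th _. apply (ccont_comp (circ r)). apply circ_cont1.
  apply (holo_cts (Cmod (circ r th) + 1)). apply Ssum_holo. lra. }
assert (c2 : tcontC (fun th => csum (fun k => (c k * Cpow (circ r th) (N ^ k))%C) K)).
{ intros th _. clear - th. induction K as [|K IH]; simpl. apply continuous_const.
  apply ccont_plus; trivial. assert (q := circ_cont1 r th). cont. }
transitivity (coef l (fun th => (Ssum b (Nat.pow N) K (circ r th) + (- RtoC t) * csum (fun k => (c k * Cpow (circ r th) (N ^ k))%C) K)%C)).
{ apply Cavg_ext. intros th _. f_equal.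
  assert (E : csum (fun k => (c k * Cpow (circ r th) (N ^ k))%C) K = (circ r th * Ssum b (Nat.pow N) K (circ r th))%C).
  { unfold Ssum. fold c. clear - hN. induction K as [|K IH]; simpl. ring. rewrite IH.
    assert (P : Cpow (circ r th) (N ^ K) = (circ r th * Cpow (circ r th) (pred (N ^ K)))%C).
    { assert (h := npow_ge1 N K hN). replace (N ^ K)%nat with (S (pred (N ^ K))) at 1 by lia. apply Cpow_S. }
    rewrite P. unfold c. ring. }
  rewrite E. unfold den. ring. }
rewrite coef_plus, coef_scal; trivial.
2:{ intros th hth. apply ccont_mult. apply continuous_const. now apply c2. }
rewrite (coef_csum l c (Nat.pow N)).
rewrite (csum_zero _ K).
2:{ intros k. destruct (Nat.eq_dec (N ^ k) l) as [e|]; trivial. now apply npow_neq_pred in e. }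
unfold Ssum. rewrite (coef_csum l (fun k => RtoC (b k * INR (N ^ k))) (fun k => pred (N ^ k))).
rewrite (csum_single _ j).
- destruct (Nat.eq_dec (pred (N ^ j)) l) as [e|n]. ring. now elim n.
- lia.
- intros k hk. destruct (Nat.eq_dec (pred (N ^ k)) l) as [e|n]; trivial.
  unfold l in e. assert (h1 := npow_ge1 N k hN). assert (h2 := npow_ge1 N j hN).
  elim hk. apply (npow_inj N); trivial. lia.
Qed.

Lemma INR_pow N k : INR (N ^ k) = INR N ^ k.
Proof. apply pow_INR. Qed.

Lemma pow_unbounded x A : 2 <= x -> exists k, A < x ^ k.
Proof.
intros hx. destruct (Pow_x_infinity x) with (b := A + 1) as [k hk]. rewrite Rabs_pos_eq; lra.
exists k. specialize (hk k (le_n _)). rewrite Rabs_pos_eq in hk by (apply pow_le; lra). lra.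
Qed.

(** f = (1 - tz) S, with S the limit of the differentiated partial sums, so that [prim t f] is the
    series with coefficients b. The last clause separates a polynomial from the tail and serves the
    growth estimate. *)
Lemma lac_example b N q t : (4 <= N)%nat -> lacunary b (Nat.pow N) q -> 0 <= t <= 1 ->
  exists f, holo 1 f /\
    lu_lim (fun K z => (den t z * Ssum b (Nat.pow N) K z)%C) f /\
    lu_lim (Psum b (Nat.pow N)) (prim t f) /\
    (forall z K, Cmod z < 1 -> Cmod (f z) <= 2 * (Cmod (Ssum b (Nat.pow N) K z) + 6 * rpow q q / rpow (1 - Cmod z) q * (/ 2) ^ K)).
Proof.
intros hN hl ht. destruct (lac_limit b _ q hl) as [S hS].
assert (lu := lac_lu b _ q S hl hS).
assert (hSh : holo 1 S) by (apply (lu_lim_holo _ S (fun K => Ssum_holo b _ K 1) lu)).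
exists (fun z => (den t z * S z)%C). split; [|split; [|split]].
- apply holo_mult; trivial. apply den_holo.
- now apply lu_lim_den.
- intros R0 hR eps he. destruct (prim_lu t _ S ht (fun K => Ssum_holo b _ K 1) hSh lu R0 hR eps he) as [M hM].
  exists M. intros n z hn hz. rewrite <- (prim_Ssum t b _ n z ht) by (try lra; intros; now apply npow_ge1). now apply hM.
- intros z K hz. rewrite Cmod_mult.
  assert (hden : Cmod (den t z) <= 2).
  { unfold den, Cminus. apply Rle_trans with (1 := Cmod_triangle _ _).
    rewrite Cmod_1, Cmod_opp, Cmod_mult, Cmod_R, Rabs_pos_eq by lra. assert (k := Cmod_ge_0 z). nra. }
  assert (k := hS z K hz). rewrite Cmod_sym in k.
  assert (k2 : Cmod (S z) <= Cmod (Ssum b (Nat.pow N) K z) + Cmod (S z - Ssum b (Nat.pow N) K z)).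
  { replace (S z) with (Ssum b (Nat.pow N) K z + (S z - Ssum b (Nat.pow N) K z))%C at 1 by ring.
    apply Cmod_triangle. }
  apply Rmult_le_compat; try apply Cmod_ge_0; lra.
Qed.

(** b_k = 2^-k and exponents 4^k: the series F is bounded by 2, hence F is in H^p, while the
    coefficient of f at 4^j - 1 is 2^j. *)
Theorem dom_not_H1 p t : 1 <= p -> 0 <= t <= 1 ->
  exists f, mem (opt_dom (C_op t) (Hardy p)) f /\ ~ mem (Hardy 1) f.
Proof.
intros hp ht. assert (hp0 : 0 < p) by lra.
set (b := fun k : nat => (/ 2) ^ k). assert (hN : (4 <= 4)%nat) by lia.
assert (hl : lacunary b (Nat.pow 4) 1).
{ split; unfold b.
  - intros k. apply Rlt_le, half_pow_pos.
  - intros k. now apply npow_ge1.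
  - lra.
  - intros k. rewrite rpow_1_r by apply pos_INR. lra. }
destruct (lac_example b 4 1 t hN hl ht) as [f [hf [lf [lp _]]]].
exists f. split.
- apply prim_mem_C_op; trivial.
  assert (hP := prim_holo t f ht hf).
  apply (Hardy_bound p _ 2); trivial; try lra.
  intros r hr. apply mp_const_bound; trivial; try lra.
  intros th _. set (z := circ r th). assert (hz : Cmod z = r) by (apply circ_mod; lra).
  apply le_epsilon. intros eps he. destruct (lp r (proj2 hr) eps he) as [K hK].
  specialize (hK K z (le_n _) ltac:(lra)).
  assert (k : Cmod (Psum b (Nat.pow 4) K z) <= 2 * 1).
  { apply csum_bound. lra. intros k. rewrite Cmod_mult, Cmod_R, Cmod_pow, Rabs_pos_eq by apply (lac_b _ _ _ hl).
    unfold b. rewrite (Rmult_comm 1), Rmult_1_r. rewrite <- (Rmult_1_r ((/ 2) ^ k)) at 2. apply Rmult_le_compat_l.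
    apply Rlt_le, half_pow_pos. apply pow_01. lra. }
  replace (prim t f z) with (Psum b (Nat.pow 4) K z + (prim t f z - Psum b (Nat.pow 4) K z))%C by ring.
  apply Rle_trans with (1 := Cmod_triangle _ _). rewrite Cmod_sym in hK. lra.
- intros hm. destruct (pow_unbounded 2 (nrm (Hardy 1) f) ltac:(lra)) as [j hj].
  assert (k := coef_le (pred (4 ^ j)) (RtoC (b j * INR (4 ^ j))) _ f
    (fun K => holo_mult 1 _ _ (den_holo 1 t) (Ssum_holo b _ K 1)) lf hm (coef_den_Ssum t b 4 j hN)).
  rewrite Cmod_R, Rabs_pos_eq in k by (apply Rmult_le_pos; [apply (lac_b _ _ _ hl) | apply pos_INR]).
  unfold b in k. rewrite INR_pow, <- Rpow_mult_distr in k.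
  replace (/ 2 * INR 4) with 2 in k by (simpl; lra). lra.
Qed.

Lemma rpow_pow x q k : 0 <= x -> rpow (x ^ k) q = rpow x q ^ k.
Proof.
intros hx. induction k as [|k IH]; simpl. apply rpow_1_l.
rewrite rpow_mult, IH; trivial. now apply pow_le.
Qed.

(** b_k = 2^k: the coefficients of F are unbounded, so F is not in H^1 and a fortiori not in H^p. A
    large N restores the little-o growth of F'. *)
Theorem growth0_not_dom p t : 1 < p -> 0 <= t <= 1 ->
  exists f, growth0 (1 / p + 1) f /\ ~ mem (opt_dom (C_op t) (Hardy p)) f.
Proof.
intros hp ht. assert (hp0 : 0 < p) by lra. assert (hip := Rinv_0_lt_compat p hp0).
set (q := 1 / p + 1). assert (hq : 0 < q) by (unfold q, Rdiv; lra).
(* N >= 4^p gives 2^k N^k <= 2^-k N^(k(1/p+1)), the condition [lac_le]; the summand 4 ensures N >=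
   4. *)
destruct (nfloor_ex (rpow 4 p) (rpow_ge0 4 p)) as [N0 [_ hN0]]. set (N := (S N0 + 4)%nat).
assert (hN : (4 <= N)%nat) by (unfold N; lia).
assert (hNp : rpow 4 p <= INR N).
{ unfold N. rewrite plus_INR, S_INR. assert (h := pos_INR 4). lra. }
assert (hNr : 4 <= rpow (INR N) (/ p)).
{ rewrite <- (rpow_root 4 p) at 1 by lra. apply rpow_le; trivial. split; trivial. apply rpow_ge0. }
set (b := fun k : nat => 2 ^ k).
assert (hl : lacunary b (Nat.pow N) q).
{ split; unfold b; trivial.
  - intros k. apply pow_le; lra.
  - intros k. now apply npow_ge1.
  - intros k. unfold q. rewrite rpow_plus_exp, rpow_1_r by apply pos_INR. rewrite <- Rmult_assoc.
    apply Rmult_le_compat_r. apply pos_INR. rewrite INR_pow. replace (1 / p) with (/ p) by (field; lra).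
    rewrite rpow_pow, <- Rpow_mult_distr. apply pow_incr. lra. apply pos_INR. }
destruct (lac_example b N q t hN hl ht) as [f [hf [_ [lp bd]]]].
exists f. split.
- split. now apply analytic_holo.
  intros eps he. fold q.
  set (D := 6 * rpow q q). assert (hD : 0 <= D) by (unfold D; assert (k := rpow_ge0 q q); lra).
  (* Beyond K terms the weighted tail is below eps / 4 on all of D. The first K terms form a
     polynomial, bounded on D, and the weight makes them small near the circle. *)
  destruct (pow_half_small (eps / 4) D ltac:(lra) hD) as [K hK]. unfold Rdiv in hK at 1. rewrite <- pow_inv in hK.
  assert (BK : exists B, 0 <= B /\ forall z, Cmod z < 1 -> Cmod (Ssum b (Nat.pow N) K z) <= B).
  { clear - hN. induction K as [|K [B [h0 hB]]].
    - exists 0. split. lra. intros z _. unfold Ssum. simpl. rewrite Cmod_0. lra.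
    - exists (B + Rabs (b K * INR (N ^ K))). assert (q1 := Rabs_pos (b K * INR (N ^ K))). split. lra. intros z hz. unfold Ssum in *. simpl.
      apply Rle_trans with (1 := Cmod_triangle _ _). apply Rplus_le_compat. now apply hB.
      rewrite Cmod_mult, Cmod_R, Cmod_pow. rewrite <- (Rmult_1_r (Rabs _)) at 2. apply Rmult_le_compat_l; trivial.
      apply pow_01. assert (k := Cmod_ge_0 z). lra. }
  destruct BK as [B [hB0 hB]].
  set (x := eps / (4 * (B + 1))). assert (hx : 0 < x) by (apply Rdiv_lt_0_compat; lra).
  exists (rpow x (/ q)). split. now apply rpow_gt0.
  intros z [hz1 hz2]. assert (hw : 0 < 1 - Cmod z) by lra.
  rewrite <- rpow_pos_eq by trivial.
  assert (Pw : rpow (1 - Cmod z) q < x).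
  { rewrite <- (rpow_root' x q) by lra. apply rpow_lt; lra. }
  assert (Pw0 := rpow_gt0 (1 - Cmod z) q hw). set (P := rpow (1 - Cmod z) q) in *.
  assert (k := bd z K hz2). fold D P in k. assert (k2 := hB z hz2).
  apply Rmult_le_compat_l with (r := P) in k; [|lra].
  apply Rle_lt_trans with (1 := k).
  set (SK := Cmod (Ssum b (Nat.pow N) K z)) in *.
  replace (P * (2 * (SK + D / P * (/ 2) ^ K))) with (2 * (P * SK) + 2 * (D * (/ 2) ^ K)) by (field; lra).
  assert (k3 : P * SK <= x * (B + 1)).
  { apply Rmult_le_compat; try lra. apply Cmod_ge_0. }
  replace (x * (B + 1)) with (eps / 4) in k3 by (unfold x; field; lra). lra.
- intros hm. assert (hP := C_op_mem_prim t p f ltac:(lra) ht hm).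
  assert (hP1 := Hardy_subset_1 p _ ltac:(lra) hP).
  destruct (pow_unbounded 2 (nrm (Hardy 1) (prim t f)) ltac:(lra)) as [j hj].
  assert (k := coef_le (N ^ j) (RtoC (b j)) _ (prim t f) (fun K => Psum_holo b _ K 1) lp hP1 (coef_Psum b N j hN)).
  rewrite Cmod_R, Rabs_pos_eq in k by apply (lac_b _ _ _ hl). unfold b in k. lra.
Qed.

Theorem proposition4p6 (p : R) (hp : 1 <= p) :
  (forall t : R, 0 <= t <= 1 ->
     equal_as_banach (opt_dom (V_op (g t)) (Hardy p)) (opt_dom (C_op t) (Hardy p)))
  /\
  (forall t : R, 0 <= t <= 1 ->
     proper_subspace (mem (Hardy p)) (mem (opt_dom (C_op t) (Hardy p))))
  /\
  (1 < p -> forall t : R, 0 <= t < 1 ->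
     strict_incl (mem (Hardy 1)) (mem (opt_dom (C_op t) (Hardy p))) /\
     strict_incl (mem (opt_dom (C_op t) (Hardy p))) (growth0 (1 / p + 1))).
Proof.
split; [|split].
- intros t ht. exact (optimal_domains_equal p t hp ht).
- intros t ht. split; [|split; [|split]].
  + exact (Hardy_linear p hp).
  + exact (dom_linear _ p (C_op_lin t ht) hp).
  (* For t < 1 the inclusion of H^1, which contains H^p, is enough; t = 1 needs the semigroup
     estimate. *)
  + intros f hf. destruct (Req_dec t 1) as [->|n].
    * exact (Cesaro_bounded p f hp hf).
    * exact (H1_subset t p f hp ltac:(lra) (Hardy_subset_1 p f hp hf)).
  (* A function outside H^1 is outside the smaller space H^p. *)
  + destruct (dom_not_H1 p t hp ht) as [f [h1 h2]]. exists f. split. exact h1.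
    intros h. exact (h2 (Hardy_subset_1 p f hp h)).
- intros hp1 t ht. assert (ht' : 0 <= t <= 1) by lra. split; split.
  + intros f hf. exact (H1_subset t p f hp ht hf).
  + exact (dom_not_H1 p t hp ht').
  + intros f hf. exact (dom_growth0 t p f hp1 ht' hf).
  + exact (growth0_not_dom p t hp1 ht').
Qed.
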